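(* Let $\lambda>0$, let $A:[0,+\infty)\to\mathbb{R}$ and $f:[0,1]\times[0,+\infty)\to[0,+\infty)$ be continuous, let $b\in L^1\big((0,1];[0,+\infty)\big)$ be positive almost everywhere with $(b*\mathbf{1})(1)\neq0$, let $0<\rho_1<\rho_2$ be such that $A(t)>0$ for each $t\in[\rho_1,\rho_2]$, let $p:[0,1]\to(0,1]$ be continuous with $0<p^-\le p(t)\le p^+\le1$ for all $t\in[0,1]$ ($p^-,p^+$ real constants), and let $G$ be a Green's function satisfying the assumptions listed in the context, with associated constants $\alpha,\beta,\eta_0,C_0$. Suppose that for some $q>1$ we have $b^{\frac{1}{1-q}}\in L^1\big((0,1]\big)$. Suppose moreover that both of the following inequalities hold: (1) $\displaystyle\left[\left(\frac{\lambda f^{m}_{[\alpha,\beta]\times[\eta_0m_{\rho_1},\overline{M}_{\rho_1}]}}{A(\rho_1)}\max_{\tau\in[0,1]}\int_{\alpha}^{\beta}G(\tau,s)\,ds\right)^{p^-}-1\right]\int_{\alpha}^{\beta}b(1-s)\,ds>\frac{\rho_1}{\eta_0^{p^+}}$; (2) $\displaystyle\max\left\{\left(\frac{\lambda f^{M}_{[0,1]\times[0,\overline{M}_{\rho_2}]}G^M}{A(\rho_2)}\right)^{p^+},\left(\frac{\lambda f^{M}_{[0,1]\times[0,\overline{M}_{\rho_2}]}G^M}{A(\rho_2)}\right)^{p^-}\right\}<\frac{\rho_2}{(b*\mathbf{1})(1)}$. Then the problem $$-A\left(\int_0^1b(1-s)\big(u(s)\big)^{p(s)}\,ds\right)u''(t)=\lambda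 f\big(t,u(t)\big),\quad t\in(0,1),$$ subject to the boundary data encoded by the Green's function $G$, has at least one positive solution $u_0\in\widehat{V}_{\rho_2}\setminus\overline{\widehat{V}_{\rho_1}}$, and $u_0$ satisfies $$\left(\frac{\rho_1}{(b*\mathbf{1})(1)}\right)^{\frac{1}{p^+}}+\varepsilon(\rho_1,b)\le\Vert u_0\Vert_{\infty}\le\frac{1}{\eta_0}(\beta-\alpha)^{-\frac{q}{p^-}}\left[\rho_2^{\frac{1}{q}}\left(\left(b^{\frac{1}{1-q}}*\mathbf{1}\right)(1)\right)^{\frac{q-1}{q}}+1\right]^{\frac{q}{p^-}}.$$
   Context: Notation. $\mathscr{C}([0,1])$ is the Banach space of continuous real functions on $[0,1]$ with the maximum norm $\Vert\cdot\Vert_\infty$. $\mathbf{1}$ is the constant function $1$. Finite convolution: $(v*w)(t):=\int_0^tv(t-s)w(s)\,ds$, $0\le t\le1$; in particular $(b*\mathbf{1})(1)=\int_0^1b(1-s)\,ds$ and $(b*u^{p(\cdot)})(1):=\int_0^1b(1-s)(u(s))^{p(s)}\,ds$. For continuous $h:[0,1]\times[0,+\infty)\to[0,+\infty)$, $h^m_{[a,b]\times[c,d]}$ and $h^M_{[a,b]\times[c,d]}$ denote respectively the minimum and the maximum of $h$ over $[a,b]\times[c,d]$. Assumptions on $G$: $G:[0,1]\times[0,1]\to[0,+\infty)$ is continuous and is the Green's function of $-u''$ under given (homogeneous) boundary data (e.g. Dirichlet). Put $\mathscr{G}(s):=\max_{t\in[0,1]}G(t,s)$. There are numbers $0\le\alpha<\beta\le1$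 and $\eta_0=\eta_0(\alpha,\beta)\in(0,1]$ with $\min_{t\in[\alpha,\beta]}G(t,s)\ge\eta_0\mathscr{G}(s)$ for each $s\in[0,1]$. Moreover $C_0:=\inf_{s\in(0,1)}\frac{1}{\mathscr{G}(s)}\int_0^1G(t,s)\,dt$ satisfies $C_0>0$ (implicitly $\mathscr{G}(s)>0$ for $s\in(0,1)$). Cone and sets: $$\mathscr{K}:=\Big\{u\in\mathscr{C}([0,1]):u\ge0,\ \min_{t\in[\alpha,\beta]}u(t)\ge\eta_0\Vert u\Vert_\infty,\ (\mathbf{1}*u)(1)\ge C_0\Vert u\Vert_\infty\Big\},$$ and for $\rho>0$, $\widehat{V}_\rho:=\{u\in\mathscr{K}:(b*u^{p(\cdot)})(1)<\rho\}$, a relatively open subset of $\mathscr{K}$; closures are relative to $\mathscr{K}$. A positive solution of the problem subject to the boundary data encoded by $G$ means a nontrivial $u\in\mathscr{K}$, with $A\big((b*u^{p(\cdot)})(1)\big)>0$, that is a fixed point $u=Tu$ of $$(Tu)(t):=\lambda\int_0^1\Big(A\big((b*u^{p(\cdot)})(1)\big)\Big)^{-1}G(t,s)f(s,u(s))\,ds;$$ such a fixed point satisfies the differential equation and the boundary conditions because $G$ is the Green's function. Constants, for $\rho>0$: $$G^M:=\max_{\tau\in[0,1]}\int_0^1G(\tau,s)\,ds,\qquad m_\rho:=\left(\frac{\rho}{(b*\mathbf{1})(1)}\right)^{\frac1{p^+}}+\varepsilon(\rho,b),$$ $$\overline{M}_\rho:=\frac1{\eta_0}(\beta-\alpha)^{-\frac{q}{p^-}}\left[\rho^{\frac1q}\left(\left(b^{\frac1{1-q}}*\mathbf{1}\right)(1)\right)^{\frac{q-1}{q}}+1\right]^{\frac{q}{p^-}},$$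 where $$\varepsilon(\rho,b):=\begin{cases}\left(\frac{\rho}{(b*\mathbf{1})(1)}\right)^{\frac1{p^-}}-\left(\frac{\rho}{(b*\mathbf{1})(1)}\right)^{\frac1{p^+}},&0<\left(\frac{\rho}{(b*\mathbf{1})(1)}\right)^{\frac1{p^+}}<1,\\0,&\left(\frac{\rho}{(b*\mathbf{1})(1)}\right)^{\frac1{p^+}}\ge1.\end{cases}$$ *)

(* Defs.v *)
From HB Require Import structures.
From mathcomp Require Import all_boot all_order all_algebra.
From mathcomp Require Import all_classical all_reals all_analysis.

Set Implicit Arguments.
Unset Strict Implicit.
Unset Printing Implicit Defensive.

Import Order.TTheory GRing.Theory Num.Theory.
Import numFieldNormedType.Exports.

Local Open Scope classical_set_scope.
Local Open Scope ring_scope.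

(* Conventions. A function on [0,1] (or (0,1], [0,+oo), ...) is a total
   function on R of which only the restriction to that set is ever used; in
   particular C([0,1]) is the set of u with {within `[0, 1], continuous u}.
   Integrals are real-valued Lebesgue integrals. *)

Section Extrema.
Context {R : realType} {T : Type}.

(* These are attained, hence maxima and minima, wherever they are used on a
   continuous function and a nonempty compact set. *)
Definition max_on (D : set T) (g : T -> R) : R := sup [set g x | x in D].
Definition min_on (D : set T) (g : T -> R) : R := inf [set g x | x in D].

End Extrema.

Section FunctionSpace.
Context {R : realType}.
Implicit Types (u v w b p : R -> R).

Definition maxnorm u : R := max_on `[0, 1] (fun t => `|u t|).

Definition convol v w (t : R) : R :=
  \int[lebesgue_measure]_(s in `[0, t]) (v (t - s) * w s).

(* (b * u^{p(.)})(1); at u s = 0 the power is 0, as p s > 0. *)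
Definition nonlocal b p u : R := convol b (fun s => u s `^ p s) 1.

Definition cone (alpha beta eta0 C0 : R) : set (R -> R) :=
  [set u : R -> R |
    [/\ {within `[0, 1], continuous u},
        forall t : R, t \in `[0, 1] -> 0 <= u t,
        eta0 * maxnorm u <= min_on `[alpha, beta] u
      & C0 * maxnorm u <= convol (cst 1) u 1]].

Definition Vhat (K : set (R -> R)) b p (rho : R) : set (R -> R) :=
  [set u : R -> R | K u /\ nonlocal b p u < rho].

(* The topology of {uniform` `[0, 1] -> R} is that of uniform convergence on
   [0,1], i.e. the one given by maxnorm. *)
Definition closure_in (K V : set (R -> R)) : set (R -> R) :=
  K `&` closure (V : set {uniform` (`[0, 1] : set R) -> R}).

End FunctionSpace.

Section BoundaryValueProblem.
Context {R : realType}.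
Implicit Types (u : R -> R) (B : 'M[R]_(2, 4)) (G f : R -> R -> R).

Definition right_derivative u (x l : R) : Prop :=
  h^-1 * (u (x + h) - u x) @[h --> 0^'+] --> l.

Definition left_derivative u (x l : R) : Prop :=
  h^-1 * (u (x + h) - u x) @[h --> 0^'-] --> l.

Definition twice_derivable u (t : R) : Prop :=
  derivable u t 1 /\ derivable (u^`())%classic t 1.

(* Homogeneous two-point boundary data: row i of B reads
   B i 0 * u(0) + B i 1 * u'(0) + B i 2 * u(1) + B i 3 * u'(1) = 0. *)
Definition boundary_conditions B u : Prop :=
  exists d0 d1 : R, [/\ right_derivative u 0 d0, left_derivative u 1 d1
    & B *m (\col_(i < 4) [:: u 0; d0; u 1; d1]`_i) = 0].

(* G is the Green's function of -u'' under the boundary data B: the homogeneous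
   problem has only the trivial solution and, for each s in (0,1), G(.,s)
   satisfies the boundary data and - d^2 G / dt^2 is the Dirac mass at s. *)
Definition is_green_function B G : Prop :=
  [/\ (forall u, {within `[0, 1], continuous u} ->
         (forall t : R, t \in `]0, 1[ ->
            twice_derivable u t /\ - (u^`(2))%classic t = 0) ->
         boundary_conditions B u -> forall t : R, t \in `[0, 1] -> u t = 0),
      {within `[0, 1] `*` `[0, 1], continuous (fun z : R * R => G z.1 z.2)}
    & forall s : R, s \in `]0, 1[ ->
        [/\ boundary_conditions B (G ^~ s),
            (forall t : R, t \in `]0, 1[ -> t != s ->
               twice_derivable (G ^~ s) t /\ - ((G ^~ s)^`(2))%classic t = 0)
          & exists dl dr : R, [/\ left_derivative (G ^~ s) s dl,
               right_derivative (G ^~ s) s dr & dr - dl = - 1]]].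

Definition Gmax G (s : R) : R := max_on `[0, 1] (G ^~ s).

Definition C0_of G : R :=
  inf [set (Gmax G s)^-1 * \int[lebesgue_measure]_(t in `[0, 1]) G t s
      | s in `]0, 1[].

Definition Tmap (lambda : R) (A b p : R -> R) G f u (t : R) : R :=
  lambda * \int[lebesgue_measure]_(s in `[0, 1])
             ((A (nonlocal b p u))^-1 * G t s * f s (u s)).

(* A nontrivial fixed point of Tmap in the cone K with positive coefficient. *)
Definition positive_solution (K : set (R -> R)) (lambda : R) (A b p : R -> R)
    G f u : Prop :=
  [/\ K u, (exists2 t : R, t \in `[0, 1] & u t != 0), 0 < A (nonlocal b p u)
    & forall t : R, t \in `[0, 1] -> u t = Tmap lambda A b p G f u t].

Definition solves_bvp B (lambda : R) (A b p : R -> R) f u : Prop :=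
  [/\ {within `[0, 1], continuous u},
      (forall t : R, t \in `]0, 1[ -> twice_derivable u t /\
         - A (nonlocal b p u) * (u^`(2))%classic t = lambda * f t (u t))
    & boundary_conditions B u].

End BoundaryValueProblem.

Section Constants.
Context {R : realType}.
Implicit Types (b : R -> R) (G f : R -> R -> R).

Definition rect_max f (a b c d : R) : R :=
  max_on (`[a, b] `*` `[c, d]) (fun z : R * R => f z.1 z.2).

Definition rect_min f (a b c d : R) : R :=
  min_on (`[a, b] `*` `[c, d]) (fun z : R * R => f z.1 z.2).

(* max over tau in [0,1] of the integral of G(tau,.) over [a,b] *)
Definition Gint_max G (a b : R) : R :=
  max_on `[0, 1] (fun tau => \int[lebesgue_measure]_(s in `[a, b]) G tau s).

Definition eps_rho b (pm pp rho : R) : R :=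
  let r := rho / convol b (cst 1) 1 in
  if (0 < r `^ (1 / pp)) && (r `^ (1 / pp) < 1)
  then r `^ (1 / pm) - r `^ (1 / pp) else 0.

Definition m_rho b (pm pp rho : R) : R :=
  (rho / convol b (cst 1) 1) `^ (1 / pp) + eps_rho b pm pp rho.

Definition Mbar_rho b (alpha beta eta0 pm q rho : R) : R :=
  1 / eta0 * (beta - alpha) `^ (- (q / pm)) *
  (rho `^ (1 / q) *
     (convol (fun t => b t `^ (1 / (1 - q))) (cst 1) 1) `^ ((q - 1) / q) + 1)
    `^ (q / pm).

End Constants.

(* Main.v *)
From HB Require Import structures.
Require Import Defs.
From mathcomp Require Import all_boot zify.

(** Why the theorem holds.  Write N(u) for the nonlocal term (b * u^{p(.)})(1).
    The map T divides by A(N(u)), and A is positive only on [rho1, rho2], so T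
    does not act on a convex set.  Instead of computing a fixed point index on
    the sets where N(u) < rho, the equation is modified so that it makes sense
    for every bounded measurable u: N(u) is clipped to [rho1, rho2], and the
    argument of f is truncated to the range which a solution must have anyway,
    namely at most Mbar at the clipped value and, on [alpha, beta], at least
    eta0 * m_rho1.  The modified operator [hammerstein] takes values in a fixed
    order interval, its images have a common Lipschitz constant, and it is
    continuous for pointwise convergence by dominated convergence; Schauder's
    theorem ([equicontinuous_fixed_point]) gives a fixed point u.

    The rest is the proof that neither modification is active at u.  Since u is
    the image of a nonnegative function under the Green operator, it lies in the
    cone ([harnack], [mean_value_ge]).  If N(u) >= rho2, the clipped value is
    rho2, so u is at most the number y of condition (2), whence
    N(u) <= max(y^pp, y^pm) (b * 1)(1) < rho2, a contradiction
    ([nonlocal_lt_rho2]).  If N(u) <= rho1, the clipped value is rho1 and on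
    [alpha, beta] the truncation puts the argument of f in the rectangle of
    condition (1); so the maximum norm of u is at least the number X which (1)
    raises to the power pm, u >= eta0 * X on [alpha, beta], and N(u) is at least
    eta0^pp X^pm times the integral of b(1 - s) over [alpha, beta], which exceeds
    rho1, again a contradiction ([rho1_lt_nonlocal]).  Finally N(u) = rho bounds
    the norm of u below by m_rho, because u is at most its norm, and above by
    Mbar_rho, because u >= eta0 times its norm on [alpha, beta] and Hoelder's
    inequality for b^{1/q} b^{-1/q} = 1 bounds the integral of b below; so the
    truncation is inactive too and u is a fixed point of T.

    Only N(u) > rho1 remains to be turned into u lying outside the closure of the
    set where N < rho1: N is continuous for uniform convergence, so N <= rho1 on
    that closure ([closure_nonlocal_le]).

    The differential equation needs the structure of G.  Being affine in t on
    both sides of s with a derivative jump of -1, G is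
    G(t,s) = G(0,s) + t * slope(s) - max(0, t - s) ([green_formula]); integrating
    this against a continuous g gives a function whose second derivative is -g,
    and which inherits the boundary conditions, these being linear.

    Schauder's theorem is obtained here from Scarf's combinatorial lemma
    ([rainbow_primitive]), a substitute for Sperner's lemma in which linear
    orders of a finite set play the part of a triangulation.  Applied to the grid
    points of a simplex it gives Brouwer's theorem ([brouwer_simplex],
    [brouwer_cube]); and for an operator which is continuous under pointwise
    convergence Brouwer's theorem solves u = Tu at finitely many nodes, among step
    functions. *)

Set Implicit Arguments.
Unset Strict Implicit.
Unset Printing Implicit Defensive.

(** * Scarf's lemma *)

Section Primitive.
Variables (X I : finType) (key : I -> X -> nat) (slack : I -> X) (c : X -> I).
Hypothesis key_inj : forall i, injective (key i).
Hypothesis slack_inj : injective slack.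
Hypothesis slack_low : forall i x, x != slack i -> key i (slack i) < key i x.
Hypothesis slack_high :
  forall i j x, j != i -> x \notin codom slack -> key i x < key i (slack j).
Hypothesis c_slack : forall i, c (slack i) = i.
Implicit Types (D P : {set X}) (i j k : I) (x y t : X).

(** Scarf's primitive sets: no point exceeds, in every order, the element of D
    which is lowest in that order.  A primitive set with #|I| elements is a room,
    one with #|I| - 1 elements a door; they play the part of the simplices and facets of a triangulation. *)
Definition primitive D :=
  [forall y, exists i, forall x in D, key i y <= key i x].

Lemma primitiveP D :
  reflect (forall y, exists i, forall x, x \in D -> key i y <= key i x)
          (primitive D).
Proof.
apply: (iffP forallP) => H y.
  by have /existsP[i /forall_inP Hi] := H y; exists i.
by have [i Hi] := H y; apply/existsP; exists i; apply/forall_inP.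
Qed.

Lemma primitiveS D P : D \subset P -> primitive P -> primitive D.
Proof.
move=> /fintype.subsetP DP /primitiveP H; apply/primitiveP => y.
by have [i Hi] := H y; exists i => x /DP; apply: Hi.
Qed.

Definition lowest D i : X :=
  if [pick x0 in D] is Some x0 then [arg min_(x < x0 in D) key i x]
  else slack i.

Lemma lowestP D i : D != set0 ->
  lowest D i \in D /\ forall x, x \in D -> key i (lowest D i) <= key i x.
Proof.
move=> D0; rewrite /lowest; case: pickP => [x0 x0D|H].
  by case: arg_minnP => // x xD xmin; split.
by case/set0Pn: D0 => x xD; have := H x; rewrite /= xD.
Qed.

Lemma lowest_uniq D i x : x \in D ->
  (forall y, y \in D -> key i x <= key i y) -> lowest D i = x.
Proof.
move=> xD xmin; have D0 : D != set0 by apply/set0Pn; exists x.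
have [lD lmin] := lowestP i D0.
by apply: (@key_inj i); apply/eqP; rewrite eqn_leq lmin // xmin.
Qed.

Lemma primitive_lowest D : primitive D -> D \subset lowest D @: setT.
Proof.
move=> /primitiveP H; apply/fintype.subsetP => y yD.
have [i Hi] := H y; apply/imsetP; exists i; first by rewrite finset.inE.
by rewrite (lowest_uniq yD).
Qed.

(** A room has as many elements as there are orders, and each of them is the
    lowest one in some order; so it is the lowest one in exactly one order. *)
Lemma room_lowest_inj P : primitive P -> #|P| = #|I| -> injective (lowest P).
Proof.
move=> Pp Pc.
have: #|lowest P @: setT| == #|[set: I]|.
  rewrite eqn_leq leq_imset_card /= cardsT -Pc.
  exact/subset_leq_card/primitive_lowest.
by move=> /imset_injP H i j; apply: H; rewrite finset.inE.
Qed.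

Variable i0 : I.

(** Doors showing each colour but i0 exactly once. *)
Definition coloured D := (#|D|.+1 == #|I|) && (c @: D == ~: [set i0]).

(** When i and j share their lowest element in a door D, the room behind D on
    the side of i is obtained by adding the highest of these points in order i. *)
Definition above D i := [set y | [forall k, (k != i) ==> (key k (lowest D k) < key k y)]].

Lemma aboveP D i y :
  reflect (forall k, k != i -> key k (lowest D k) < key k y) (y \in above D i).
Proof.
rewrite finset.inE; apply: (iffP forallP) => H k.
  by move=> ki; have := H k; rewrite ki.
by apply/implyP; apply: H.
Qed.

Section Door.
Variables (D : {set X}) (i j : I).
Hypotheses (Dn0 : D != set0) (Dp : primitive D) (Dc : #|D|.+1 = #|I|).
Hypotheses (ij : i != j) (lij : lowest D i = lowest D j).

Let lowest_image k : lowest D k \in D.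
Proof. by have [] := lowestP k Dn0. Qed.

Lemma door_cover x : x \in D -> exists2 k, k != i & x = lowest D k.
Proof.
move=> xD; have /imsetP[k _ ->] := fintype.subsetP (primitive_lowest Dp) x xD.
by have [->|ki] := eqVneq k i; [exists j; rewrite // eq_sym|exists k].
Qed.

Lemma above_dominated y : y \in above D i -> forall x, x \in D -> key i y <= key i x.
Proof.
move=> /aboveP yY; have /primitiveP/(_ y)[l Hl] := Dp.
have [<-//|li] := eqVneq l i.
by have := yY l li; rewrite ltnNge Hl.
Qed.

Lemma above_notin y : y \in above D i -> y \notin D.
Proof.
move=> /aboveP yY; apply/negP => /door_cover[k ki yk].
by have := yY k ki; rewrite yk ltnn.
Qed.

Lemma above_top_primitive t : t \in above D i ->
  (forall y, y \in above D i -> key i y <= key i t) -> primitive (t |: D).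
Proof.
move=> tY tmax; apply/primitiveP => y.
have [yY|] := boolP (y \in above D i).
  by exists i => x; rewrite !finset.inE => /orP[/eqP->|]; [exact: tmax|exact: above_dominated].
rewrite finset.inE negb_forall => /existsP[k]; rewrite negb_imply -leqNgt => /andP[ki yk].
exists k => x; rewrite !finset.inE => /orP[/eqP->|xD]; apply: (leq_trans yk).
  by apply: ltnW; move/aboveP: tY; apply.
by have [_ ->] := lowestP k Dn0.
Qed.

Lemma room_above x : x \notin D -> primitive (x |: D) ->
  lowest (x |: D) i = x ->
  x \in above D i /\ forall y, y \in above D i -> key i y <= key i x.
Proof.
move=> xD Pp lx.
have Pc : #|x |: D| = #|I| by rewrite cardsU1 xD add1n Dc.
have linj := room_lowest_inj Pp Pc.
have P0 : x |: D != set0 by apply/set0Pn; exists x; rewrite setU11.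
have lo k : k != i -> key k (lowest D k) < key k x.
  move=> ki; have [lP lmin] := lowestP k P0.
  have lx' : lowest (x |: D) k != x by rewrite -[X in _ != X]lx (inj_eq linj).
  have lD : lowest (x |: D) k \in D by move: lP; rewrite !finset.inE (negPf lx').
  rewrite (@lowest_uniq D k (lowest (x |: D) k)) //.
    rewrite ltn_neqAle lmin ?setU11 // andbT.
    by apply: contra lx' => /eqP/key_inj ->.
  by move=> y yD; apply: lmin; rewrite finset.inE yD orbT.
split; first exact/aboveP.
move=> y /aboveP yY; have /primitiveP/(_ y)[l Hl] := Pp.
have [<-|li] := eqVneq l i; first by apply: Hl; rewrite setU11.
have := yY l li; rewrite ltnNge Hl // finset.inE.
by rewrite lowest_image orbT.
Qed.

Lemma room_lowest_new x : x \notin D -> primitive (x |: D) ->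
  lowest (x |: D) i = x \/ lowest (x |: D) j = x.
Proof.
move=> xD Pp.
have Pc : #|x |: D| = #|I| by rewrite cardsU1 xD add1n Dc.
have linj := room_lowest_inj Pp Pc.
have P0 : x |: D != set0 by apply/set0Pn; exists x; rewrite setU11.
have old k : lowest (x |: D) k != x -> lowest (x |: D) k = lowest D k.
  have [lP lmin] := lowestP k P0; move=> lx'; apply/esym/lowest_uniq.
    by move: lP; rewrite !finset.inE (negPf lx').
  by move=> y yD; apply: lmin; rewrite finset.inE yD orbT.
have [|li] := eqVneq (lowest (x |: D) i) x; first by left.
have [|lj] := eqVneq (lowest (x |: D) j) x; first by right.
by move: ij; rewrite -(inj_eq linj) (old i li) (old j lj) lij eqxx.
Qed.

End Door.

(** By counting, some two orders i and j share their lowest element in a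
    door.  In a room containing the door the new element is the lowest one for
    i or for j, and it is then determined by maximality; the hypothesis on slack
    points makes both sides nonempty. *)
Lemma two_rooms D : D != set0 -> primitive D -> #|D|.+1 = #|I| ->
  (forall k l, l != k -> lowest D k != slack l) ->
  exists t u, [/\ t != u, t \notin D, u \notin D &
    forall x, (x \notin D) && primitive (x |: D) = (x \in [set t; u])].
Proof.
move=> D0 Dp Dc Dslack.
have [i [j [ij lij]]] : exists i j, i != j /\ lowest D i = lowest D j.
  have /injectivePn[i [j ij lij]] : ~~ injectiveb (lowest D).
    apply/negP => /injectiveP linj.
    have: #|lowest D @: setT| <= #|D|.
      apply: subset_leq_card; apply/fintype.subsetP => _ /imsetP[k _ ->].
      by have [] := lowestP k D0.
    by rewrite card_imset // cardsT -Dc ltnn.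
  by exists i, j.
have aboveN k : slack k \in above D k.
  apply/aboveP => l lk.
  have [m|m] := boolP (lowest D l \in codom slack); last by apply: slack_high; rewrite // eq_sym.
  case/codomP: m => e le.
  have [el|el] := eqVneq e l; last by have := Dslack l e el; rewrite le eqxx.
  by rewrite le el; apply: slack_low; rewrite (inj_eq slack_inj) eq_sym.
have top k : exists t, t \in above D k /\
    forall y, y \in above D k -> key k y <= key k t.
  case: (@arg_maxnP _ (slack k) (fun x => x \in above D k) (key k) (aboveN k)) => t tY tm.
  by exists t.
have [t [tY tmax]] := top i; have [u [uY umax]] := top j.
have ji : j != i by rewrite eq_sym.
exists t, u; split.
- apply/negP => /eqP tu; have /primitiveP/(_ t)[l Hl] := Dp.
  have [lD _] := lowestP l D0; have := Hl _ lD; rewrite leqNgt => /negP; apply.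
  have [li|li] := eqVneq l i; last by move/aboveP: tY; apply.
  by rewrite tu; move/aboveP: uY; apply; rewrite li.
- exact: (above_notin Dp ij lij tY).
- exact: (above_notin Dp ji (esym lij) uY).
move=> x; rewrite !finset.inE; apply/andP/orP.
  move=> [xD Pp].
  have [lx|lx] := room_lowest_new Dc ij lij xD Pp; [left|right].
    have [xY xmax] := room_above D0 Dc xD Pp lx.
    by apply/eqP/(@key_inj i)/eqP; rewrite eqn_leq tmax // xmax.
  have [xY xmax] := room_above D0 Dc xD Pp lx.
  by apply/eqP/(@key_inj j)/eqP; rewrite eqn_leq umax // xmax.
case=> /eqP ->; split.
- exact: (above_notin Dp ij lij tY).
- exact: (above_top_primitive D0 Dp tY tmax).
- exact: (above_notin Dp ji (esym lij) uY).
- exact: (above_top_primitive D0 Dp uY umax).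
Qed.

(** The doors excluded by the hypothesis of two_rooms are the boundary ones, made
    of slack points only. *)
Lemma slack_door D k : D != set0 -> #|D|.+1 = #|I| ->
  (exists2 l, l != k & lowest D k = slack l) ->
  D = slack @: ~: [set k].
Proof.
move=> D0 Dc [l lk lD]; apply/eqP; rewrite eqEcard; apply/andP; split; last first.
  by rewrite card_imset // cardsCs setCK cards1 -Dc subn1.
apply/fintype.subsetP => x xD; have [_ lmin] := lowestP k D0.
have := lmin x xD; rewrite lD => lx.
have [/codomP[e xe]|xn] := boolP (x \in codom slack); last first.
  by have := slack_high lk xn; rewrite ltnNge lx.
apply/imsetP; exists e => //; rewrite !finset.inE; apply/negP => /eqP ek.
have : slack l != slack k by rewrite (inj_eq slack_inj).
by move=> /slack_low; rewrite -{2}ek -xe ltnNge lx.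
Qed.

Variable x0 : X.
Hypothesis x0P : x0 \notin codom slack.

Let D0 : {set X} := slack @: ~: [set i0].

(** The boundary door D0 opens into one room only: its missing slack point
    cannot be added, as x0 would exceed the lowest element in every order, and
    among the other points the same happens unless the highest one in order i0
    is added. *)
Lemma first_door : exists2 t, t \notin D0 &
  forall x, (x \notin D0) && primitive (x |: D0) = (x == t).
Proof.
have [t tT tmax] := @arg_maxnP _ x0 (fun x => x \notin codom slack) (key i0) x0P.
have {}tmax y : y \notin codom slack -> key i0 y <= key i0 t by exact: tmax.
have inD0 x : x \in D0 -> exists2 k, k != i0 & x = slack k.
  by case/imsetP => k; rewrite !finset.inE => ki ->; exists k.
have tD : t \notin D0.
  by apply/negP => /inD0[k _ tk]; case/negP: tT; rewrite tk codom_f.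
exists t => // x; apply/andP/eqP => [[xD Px]|->]; last first.
  split=> //; apply/primitiveP => y.
  have [/codomP[k ->]|yT] := boolP (y \in codom slack).
    exists k => z _; have [->//|zk] := eqVneq z (slack k).
    exact/ltnW/slack_low.
  exists i0 => z; rewrite !finset.inE => /orP[/eqP->|/inD0[k ki ->]].
    exact: tmax.
  exact/ltnW/slack_high.
have [/codomP[k xk]|xT] := boolP (x \in codom slack).
  have ki : k = i0.
    by apply/eqP/negPn/negP => ki; case/negP: xD; rewrite xk imset_f // !finset.inE.
  have /primitiveP/(_ x0)[l Hl] := Px.
  have := Hl (slack l).
  have lP : slack l \in x |: D0.
    rewrite !finset.inE xk ki; have [->|li] := eqVneq l i0; first by rewrite eqxx.
    by rewrite imset_f ?orbT // !finset.inE.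
  move=> /(_ lP); rewrite leqNgt slack_low //.
  by apply: contra x0P => /eqP ->; exact: codom_f.
have /primitiveP/(_ t)[l Hl] := Px.
have [li|li] := eqVneq l i0.
  apply: (@key_inj i0); apply/eqP; rewrite eqn_leq tmax //=.
  by rewrite -li; apply: Hl; rewrite setU11.
have := Hl (slack l); rewrite !finset.inE imset_f ?orbT ?finset.inE //.
move=> /(_ isT); rewrite leqNgt slack_low //.
by apply: contra tT => /eqP ->; exact: codom_f.
Qed.

Definition rooms_of D := [set P | [&& primitive P, #|P| == #|I| & D \subset P]].
Definition doors_of P := [set D | [&& coloured D, primitive D & D \subset P]].

Lemma rooms_ofE D : #|D|.+1 = #|I| ->
  rooms_of D = (fun x => x |: D) @: [set x | (x \notin D) && primitive (x |: D)].
Proof.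
move=> Dc; apply/setP => P; rewrite finset.inE; apply/and3P/imsetP.
  move=> [Pp /eqP Pc DP].
  have /set0Pn[x] : P :\: D != set0.
    rewrite -card_gt0 cardsD (setIidPr DP) Pc -Dc subSnn //.
  rewrite finset.inE => /andP[xD xP].
  have PE : P = x |: D.
    apply/esym/eqP; rewrite eqEcard cardsU1 xD add1n Dc Pc leqnn andbT.
    by apply/fintype.subsetP => z; rewrite !finset.inE => /orP[/eqP->//|]; exact: fintype.subsetP.
  by exists x => //; rewrite finset.inE xD -PE.
move=> [x]; rewrite finset.inE => /andP[xD Pp] ->.
by split=> //; rewrite ?cardsU1 ?xD ?add1n ?Dc //; apply: subsetUr.
Qed.

(** Every door but D0 with the colours other than i0 leads to two rooms: the
    other boundary doors show the colour i0, since slack points bear the colour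
    of their own order. *)
Lemma card_rooms_of D : coloured D -> primitive D -> odd #|rooms_of D| = (D == D0).
Proof.
move=> /andP[/eqP Dc /eqP Dcol] Dp; rewrite rooms_ofE // card_in_imset; last first.
  move=> x y; rewrite !finset.inE => /andP[xD _] /andP[yD _] /setP/(_ x).
  by rewrite !finset.inE eqxx (negPf xD) /= orbF => /esym/eqP.
have [DD|DD] := eqVneq D D0.
  have [t _ H] := first_door.
  have -> : [set x | (x \notin D) && primitive (x |: D)] = [set t].
    by apply/setP => x; rewrite !finset.inE DD H.
  by rewrite cards1.
have Dn0 : D != set0.
  apply: contra DD => /eqP D_0; apply/eqP.
  move: Dcol; rewrite D_0 imset0 /D0 => <-.
  by rewrite imset0.
have [|t [u [tu _ _ H]]] := two_rooms Dn0 Dp Dc.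
  move=> k l lk; apply: contra DD => /eqP kl; apply/eqP.
  have DE : D = slack @: ~: [set k] by apply: slack_door => //; exists l.
  suff ik : i0 = k by rewrite DE /D0 ik.
  move/setP/(_ i0): Dcol; rewrite !finset.inE eqxx /= => /negbT H.
  apply/eqP/negPn/negP => ik; case/negP: H.
  by apply/imsetP; exists (slack i0); rewrite ?c_slack // DE imset_f // !finset.inE.
have -> : [set x | (x \notin D) && primitive (x |: D)] = [set t; u].
  by apply/setP => x; rewrite finset.inE H.
by rewrite cards2 tu.
Qed.

(** If a room misses a colour, either it has no coloured door, or it consists of
    one and a further element repeating a colour; exactly the two elements of
    that colour can then be removed. *)
Lemma card_doors_of P : primitive P -> #|P| = #|I| -> c @: P != setT ->
  ~~ odd #|doors_of P|.
Proof.
move=> Pp Pc Pcol.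
have [->|/set0Pn[D]] := eqVneq (doors_of P) set0; first by rewrite cards0.
rewrite finset.inE => /and3P[/andP[/eqP Dc /eqP Dcol] Dp DP].
have cinj : {in D &, injective c}.
  apply/imset_injP; rewrite Dcol cardsCs setCK cards1 -Dc subn1 //.
have [x [xD PE]] : exists x, x \notin D /\ P = x |: D.
  have : P \in rooms_of D by rewrite finset.inE Pp Pc eqxx.
  rewrite rooms_ofE // => /imsetP[x]; rewrite finset.inE => /andP[xD _] ->.
  by exists x.
have xi0 : c x != i0.
  apply: contra Pcol => /eqP cx; rewrite PE imsetU1 Dcol cx; apply/eqP/setP => i.
  by rewrite !finset.inE; case: eqP.
have : c x \in c @: D by rewrite Dcol !finset.inE.
case/imsetP => y yD cxy.
have xy : x != y by apply: contra xD => /eqP ->.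
suff -> : doors_of P = [set P :\ x; P :\ y].
  rewrite cards2; suff -> : P :\ x != P :\ y by [].
  apply/negP => /eqP/setP/(_ x); rewrite !finset.inE eqxx xy PE /= !finset.inE eqxx.
  by [].
have Px : P :\ x = D by rewrite PE setU1K.
have yP : y \in P by rewrite PE !finset.inE yD orbT.
apply/setP => E; rewrite !finset.inE; apply/and3P/orP.
  move=> [/andP[/eqP Ec /eqP Ecol] Ep EP].
  have [z zE PzE] : exists2 z, z \notin E & P = z |: E.
    have : P \in rooms_of E by rewrite finset.inE Pp Pc eqxx.
    by rewrite rooms_ofE // => /imsetP[z]; rewrite finset.inE => /andP[zE _] ->; exists z.
  have Pz : E = P :\ z by rewrite PzE setU1K.
  have [zx|zx] := eqVneq z x; first by left; rewrite Pz zx.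
  have [zy|zy] := eqVneq z y; first by right; rewrite Pz zy.
  have cinjE : {in E &, injective c}.
    by apply/imset_injP; rewrite Ecol cardsCs setCK cards1 -Ec subn1.
  have xE : x \in E by rewrite Pz !finset.inE eq_sym zx PE setU11.
  have yE : y \in E by rewrite Pz !finset.inE eq_sym zy.
  by have := cinjE x y xE yE cxy => xy'; rewrite xy' eqxx in xy.
case=> /eqP ->.
  by rewrite Px; split=> //; rewrite /coloured Dc Dcol !eqxx.
have yPc : #|P :\ y|.+1 = #|I| by rewrite -Pc (cardsD1 y P) yP add1n.
split; last by apply: subsetDl.
- rewrite /coloured yPc eqxx /= -Dcol; apply/eqP/setP => k; apply/imsetP/imsetP.
    move=> [z]; rewrite PE !finset.inE => /andP[zy /orP[/eqP->|zD] ->].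
      by exists y.
    by exists z.
  move=> [z zD ->]; have [->|zy] := eqVneq z y.
    by exists x; rewrite // PE !finset.inE eqxx xy.
  by exists z; rewrite // PE !finset.inE zy zD orbT.
- by apply: primitiveS Pp; apply: subsetDl.
Qed.

(** Pairs of a coloured door and a room containing it are counted in two ways:
    by doors the count is odd, so some room has an odd number of coloured doors. *)
Lemma rainbow_primitive_slack :
  exists P : {set X}, [/\ primitive P, #|P| = #|I| & c @: P = setT].
Proof.
pose rooms := [set P | primitive P & #|P| == #|I|].
pose doors := [set D | coloured D & primitive D].
have count : \sum_(D in doors) #|rooms_of D| = \sum_(P in rooms) #|doors_of P|.
  under eq_bigr => D _ do rewrite -sum1_card.
  under [RHS]eq_bigr => P _ do rewrite -sum1_card.
  rewrite (exchange_big_dep (fun P => P \in rooms)) /=; last first.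
    by move=> D P _; rewrite !finset.inE => /and3P[-> ->].
  apply: eq_bigr => P; rewrite finset.inE => /andP[Pp Pc].
  apply: eq_bigl => D; rewrite !finset.inE Pp Pc /=.
  by rewrite andbA.
(* D0 itself is a coloured door, the only one with a single room. *)
have D0col : coloured D0.
  apply/andP; split.
    by rewrite card_imset // cardsCs setCK cards1 subn1 prednK //; apply/card_gt0P; exists i0.
  by rewrite /D0 -imset_comp (eq_imset _ (g := id)) ?imset_id // => k /=; rewrite c_slack.
have D0p : primitive D0.
  have [t tD H] := first_door; apply: (@primitiveS _ (t |: D0)); first exact: subsetUr.
  by have := H t; rewrite eqxx => /andP[].
have [/existsP[P /and3P[Pp /eqP Pc /eqP Pcol]]|] :=
    boolP [exists P : {set X}, [&& primitive P, #|P| == #|I| & c @: P == setT]].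
  by exists P.
rewrite negb_exists => /forallP none.
have : odd (\sum_(D in doors) #|rooms_of D|).
  rewrite (bigD1 D0) /=; last by rewrite finset.inE D0col.
  rewrite oddD card_rooms_of // eqxx /=.
  apply: (big_ind (fun n => ~~ odd n)) => //.
    by move=> m n; rewrite oddD => /negPf-> /negPf->.
  by move=> D; rewrite finset.inE => /andP[/andP[Dc Dp] DD]; rewrite card_rooms_of.
rewrite count => /negPn/negP; case; apply: (big_ind (fun n => ~~ odd n)) => //.
  by move=> m n; rewrite oddD => /negPf-> /negPf->.
move=> P; rewrite finset.inE => /andP[Pp Pc]; apply: card_doors_of => //; first exact/eqP.
by have := none P; rewrite Pp Pc.
Qed.

End Primitive.

(** Scarf's lemma.  One slack point per index i is added, below everything in
    order i and above everything in the other orders, so that exactly one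
    boundary door makes the parity count odd; slack points cannot bear the colour in whose
    order some original point is dominated, so they can be discarded at the end. *)
Lemma rainbow_primitive (T I : finType) (key : I -> T -> nat) (c : T -> I) (t0 : T) :
  (forall i, injective (key i)) ->
  exists S : {set T}, forall y : T, exists2 s, s \in S &
      forall s', s' \in S -> key (c s) y <= key (c s) s'.
Proof.
move=> key_inj.
pose key' i (x : T + I) := match x with
  | inl t => (key i t).+1
  | inr j => if j == i then 0 else (\max_t key i t).+2 + enum_rank j end.
pose c' (x : T + I) := match x with inl t => c t | inr j => j end.
have key_max i t : key i t <= \max_t key i t by apply: (@leq_bigmax _ (key i)).
have big m b r : m <= b -> m.+1 <> b.+2 + r.
  move=> mb E; have : m.+1 < b.+2 + r by rewrite !addSn !ltnS (leq_trans mb) ?leq_addr.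
  by rewrite E ltnn.
have codomN t : inl t \notin codom (@inr T I) by apply/negP => /codomP[].
have [P [Pp Pc Pcol]] : exists P : {set T + I},
    [/\ primitive key' P, #|P| = #|I| & c' @: P = setT].
  apply: (@rainbow_primitive_slack _ _ key' inr c' _ _ _ _ _ (c t0) (inl t0)) => //.
  - move=> i [t|j] [u|k] //=.
    + by move=> [/key_inj ->].
    + by case: ifP => // _ /(big _ _ _ (key_max i t)).
    + by case: ifP => // _ /esym/(big _ _ _ (key_max i u)).
    + case: eqP => [->|_]; case: eqP => [->|_] //.
      by move=> /eqP; rewrite eqn_add2l => /eqP/val_inj/enum_rank_inj ->.
  - by move=> i j [].
  - move=> i [t|j] /=; rewrite eqxx //.
    by case: (eqVneq j i) => [->|]; rewrite ?eqxx.
  - move=> i j [t|k] /negPf ji; last by rewrite codom_f.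
    by rewrite /= ji addSn ltnS (leq_ltn_trans (key_max i t)) // leq_addr.
exists [set t | inl t \in P] => y.
have /primitiveP/(_ (inl y))[i Hi] := Pp.
have : i \in c' @: P by rewrite Pcol finset.inE.
case/imsetP => -[s sP iE|j jP iE]; last first.
  by have := Hi _ jP; move: iE => /= ->; rewrite eqxx.
exists s; first by rewrite finset.inE.
by move=> s'; rewrite finset.inE => /Hi; move: iE => /= <-.
Qed.

(** Scarf's lemma on the points of the simplex scaled by m, the
    orders being the coordinates with ties broken by an enumeration.  If the
    minima over S of the coordinates j whose colour occurs, plus one each, added
    up to at most m, some grid point would exceed S in all these coordinates; so
    the minima add up to more than m - #|J| and S has diameter at most #|J|.  A
    colour that does not occur belongs to a coordinate which is at most #|J| on S. *)
Lemma grid_cluster (J : finType) (m : nat) (c : {ffun J -> 'I_m.+1} -> J) (j0 : J) :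
  exists (x0 : {ffun J -> 'I_m.+1}) (w : J -> {ffun J -> 'I_m.+1}),
    \sum_j x0 j = m /\ forall j,
    [/\ \sum_i w j i = m, forall i, w j i <= x0 i + #|J|,
        forall i, x0 i <= w j i + #|J|
      & c (w j) = j \/ w j = x0 /\ x0 j <= #|J|].
Proof.
pose T : finType := {x : {ffun J -> 'I_m.+1} | \sum_j x j == m}.
have mkT (y : J -> nat) : \sum_j y j = m -> exists x : T, forall j, val x j = y j :> nat.
  move=> ym; have ylt j : y j < m.+1 by rewrite ltnS -ym (bigD1 j) //= leq_addr.
  pose x := [ffun j => Ordinal (ylt j)].
  have xm : \sum_j x j == m.
    by apply/eqP; rewrite -[RHS]ym; apply: eq_bigr => j _; rewrite ffunE.
  by exists (exist _ x xm) => j; rewrite /= ffunE.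
have [t0 _] : exists x : T, forall j, val x j = (j == j0) * m :> nat.
  by apply: mkT; rewrite (bigD1 j0) //= eqxx mul1n big1 ?addn0 // => j /negPf->.
(* The rank is below #|T|, so this orders by coordinate j first. *)
pose key j (x : T) := val x j * #|T| + enum_rank x.
have key_inj j : injective (key j).
  move=> x y /(congr1 (modn^~ #|T|)); rewrite /key !modnMDl !modn_small //.
  by move=> /val_inj/enum_rank_inj.
have key_le j (x y : T) : key j x <= key j y -> val x j <= val y j.
  rewrite /key => xy; rewrite leqNgt; apply/negP => yx.
  have : (val y j).+1 * #|T| <= val x j * #|T| by rewrite leq_mul2r yx orbT.
  rewrite mulSn => /leq_trans/(_ (leq_addr (enum_rank x) _))/leq_trans/(_ xy).
  by rewrite addnC leq_add2l leqNgt ltn_ord.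
have [S Sdom] := rainbow_primitive (fun x : T => c (val x)) t0 key_inj.
have [s0 s0S _] := Sdom t0.
pose low j := if [exists s in S, c (val s) == j]
  then val [arg min_(s < s0 in S) val s j] j : nat else 0.
have lowS j s : s \in S -> low j <= val s j.
  by move=> sS; rewrite /low; case: ifP => // _; case: arg_minnP => // t _; apply.
pose C := [pred j | [exists s in S, c (val s) == j]].
(* Otherwise y, with these coordinates and the surplus put on one of them,
   exceeds S in every order whose colour occurs. *)
have low_sum : m < \sum_j (low j + C j).
  rewrite ltnNge; apply/negP => lem.
  have [y yE] : exists x : T, forall j, val x j =
      low j + C j + (j == c (val s0)) * (m - \sum_j (low j + C j)) :> nat.
    apply: mkT; rewrite big_split /= -big_distrl /=.
    have -> : \sum_j (j == c (val s0)) = 1.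
      by rewrite (bigD1 (c (val s0))) //= eqxx big1 // => j /negPf->.
    by rewrite mul1n subnKC.
  have [s sS sdom] := Sdom y.
  have Cs : C (c (val s)) by apply/existsP; exists s; rewrite sS eqxx.
  have [t tS tE] : exists2 t, t \in S & low (c (val s)) = val t (c (val s)).
    rewrite /low [X in if X then _ else _]Cs.
    by case: arg_minnP => // t tS _; exists t.
  by have := key_le _ _ _ (sdom t tS); rewrite yE tE Cs; lia.
have spread j s : s \in S -> val s j <= low j + #|J|.
  move=> sS; have sm : \sum_j val s j = m := eqP (valP s).
  have lowC : \sum_j (low j + C j) <= \sum_j low j + #|J|.
    rewrite big_split leq_add2l -sum1_card; apply: leq_sum => i _; exact: leq_b1.
  have : val s j - low j <= \sum_i (val s i - low i) by rewrite (bigD1 j) //= leq_addr.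
  rewrite sumnB; last by move=> i _; apply: lowS.
  have : \sum_i low i <= \sum_i val s i by apply: leq_sum => i _; apply: lowS.
  rewrite sm; lia.
have near i s t : s \in S -> t \in S -> val s i <= val t i + #|J|.
  by move=> sS tS; apply: leq_trans (spread i s sS) _; rewrite leq_add2r lowS.
exists (val s0), (fun j => if [pick s in S | c (val s) == j] is Some s then val s else val s0).
split=> [|j]; first exact: eqP (valP s0).
case: pickP => [s /andP[sS /eqP sj]|none].
  by split=> [|i|i|]; [exact: eqP (valP s)|exact: near|exact: near|left].
split=> [|i|i|]; [exact: eqP (valP s0)|exact: near|exact: near|right; split=> //].
have := spread j s0 s0S; rewrite /low; case: ifP => // /existsP[s].
by have := none s; rewrite /= => ->.
Qed.

From mathcomp Require Import all_order all_algebra.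
From mathcomp Require Import all_classical all_reals all_analysis.
From mathcomp Require Import measurable_realfun ring lra.

Import Order.TTheory GRing.Theory Num.Theory.
Import numFieldNormedType.Exports.

Local Open Scope classical_set_scope.
Local Open Scope ring_scope.

(** * Uniformly convergent subsequences *)

(** Bolzano-Weierstrass for finite T and Arzela-Ascoli for equicontinuous
    families at once.  The limit is taken along a free ultrafilter, which needs no
    diagonal extraction; the finite net makes the convergence uniform.  The
    indices phi k are only asked to tend to infinity. *)
Lemma compact_subsequence (R : realType) (T : eqType) (D : set T)
    (u_ : nat -> T -> R) (M : R) :
  (forall n t, D t -> `|u_ n t| <= M) ->
  (forall e, 0 < e -> exists2 s : seq T, (forall t, t \in s -> D t) &
     forall t, D t -> exists2 t', t' \in s & forall n, `|u_ n t - u_ n t'| <= e) ->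
  exists (phi : nat -> nat) (u : T -> R), (forall k, (k <= phi k)%N) /\
    forall k t, D t -> `|u_ (phi k) t - u t| <= k.+1%:R^-1.
Proof.
move=> uM net.
have [U [UU ooU]] := @ultraFilterLemma nat \oo _.
have cvU t : D t -> exists l : R, forall e, 0 < e -> U [set n | `|u_ n t - l| <= e].
  move=> Dt; have FF : ProperFilter (u_ n t @[n --> U]) by apply: fmap_proper_filter.
  have [|l [_ Ul]] := @segment_compact R (- M) M _ FF.
    by apply: (@filterE _ U) => n; rewrite /= in_itv /= -ler_norml uM.
  exists l => e e0; have [//|UC] := in_ultra_setVsetC [set n | `|u_ n t - l| <= e] UU.
  have [] := Ul (~` [set x | `|x - l| <= e]) (ball l e).
  - exact: UC.
  - exact: nbhsx_ballx.
  by move=> x [/= + /ltW]; rewrite distrC.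
have [u uP] : exists u : T -> R, forall t, D t -> forall e, 0 < e ->
    U [set n | `|u_ n t - u t| <= e].
  have /choice[u uP] : forall t, exists l : R, D t -> forall e, 0 < e ->
      U [set n | `|u_ n t - l| <= e].
    move=> t; have [Dt|nDt] := pselect (D t); last by exists 0.
    by have [l Hl] := cvU t Dt; exists l.
  by exists u.
have unif e : 0 < e -> U [set n | forall t, D t -> `|u_ n t - u t| <= e].
  move=> e0; have e50 : 0 < e / 5%:R by rewrite divr_gt0.
  have [s sD sn] := net _ e50.
  have Us : U [set n | forall t', t' \in s -> `|u_ n t' - u t'| <= e / 5%:R].
    elim: s sD {sn} => [|x s IH] sD; first exact: filterE.
    have Ux := uP x (sD x (mem_head _ _)) _ e50.
    have {}IH := IH (fun t ts => sD t (mem_behead (s := x :: s) ts)).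
    apply: filterS (filterI Ux IH) => n [/= Hx Hs] t'.
    by rewrite inE => /orP[/eqP->|/Hs].
  apply: filterS (Us) => n /= un t Dt.
  have [t' ts tt'] := sn t Dt.
  have [n' [/= un' ut']] := filter_ex (filterI Us (uP t Dt _ e50)).
  have := un t' ts; have := un' t' ts; have := tt' n; have := tt' n'; move: ut'.
  rewrite !ler_norml => /andP[? ?] /andP[? ?] /andP[? ?] /andP[? ?] /andP[? ?].
  by apply/andP; split; lra.
have /choice[phi phiP] : forall k, exists n, (k <= n)%N /\
    forall t, D t -> `|u_ n t - u t| <= k.+1%:R^-1.
  move=> k; have Uk : U [set n | (k <= n)%N] by apply: ooU; exact: nbhs_infty_ge.
  have k0 : 0 < k.+1%:R^-1 :> R by rewrite invr_gt0.
  by have [n [/= kn un]] := filter_ex (filterI Uk (unif _ k0)); exists n.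
by exists phi, u; split=> [k|k t Dt]; have [? ?] := phiP k; auto.
Qed.

(** * Brouwer's theorem *)

Lemma cvg_dist_le (R : realType) (u_ e_ : nat -> R) (l : R) :
  (forall n, `|u_ n - l| <= e_ n) -> e_ n @[n --> \oo] --> (0 : R) -> u_ n @[n --> \oo] --> l.
Proof.
move=> ue e0; apply: (@cvg_sub0 _ _ _ _ _ u_ (fun=> l)); last exact: cvg_cst.
apply: norm_cvg0; apply: (@squeeze_cvgr _ _ _ _ (fun=> 0) e_) => //; last exact: cvg_cst.
by apply: nearW => n; rewrite normr_ge0 ue.
Qed.

Lemma cvg_minr (R : realType) T (F : set_system T) (FF : Filter F) (f g : T -> R) (a b : R) :
  f x @[x --> F] --> a -> g x @[x --> F] --> b ->
  Num.min (f x) (g x) @[x --> F] --> Num.min a b.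
Proof.
move=> fa gb; rewrite minr_absE; under eq_fun do rewrite minr_absE.
by apply: cvgMl; apply: cvgB; [exact: cvgD|apply: cvg_norm; exact: cvgB].
Qed.

Lemma cvg_maxr (R : realType) T (F : set_system T) (FF : Filter F) (f g : T -> R) (a b : R) :
  f x @[x --> F] --> a -> g x @[x --> F] --> b ->
  Num.max (f x) (g x) @[x --> F] --> Num.max a b.
Proof.
move=> fa gb; rewrite maxr_absE; under eq_fun do rewrite maxr_absE.
by apply: cvgMl; apply: cvgD; [exact: cvgD|apply: cvg_norm; exact: cvgB].
Qed.

Lemma cvg_inv_succ (R : realType) (phi : nat -> nat) (a : R) : (forall k, (k <= phi k)%N) ->
  a / (phi k).+1%:R @[k --> \oo] --> (0 : R).
Proof.
move=> phik; rewrite -[X in _ --> X](mulr0 a); apply: cvgMr.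
apply: (@cvg_dist_le _ _ harmonic); last exact: cvg_harmonic.
move=> n; rewrite subr0 ger0_norm ?invr_ge0 // /harmonic /=.
by rewrite lef_pV2 ?posrE // ler_nat ltnS.
Qed.

(** Grid points are coloured by a coordinate which F does not decrease.  The
    clusters of all colours accumulate at a point none of whose coordinates is
    decreased by F, and the coordinates of v and F v have the same sum. *)
Lemma brouwer_simplex (R : realType) (J : finType) (j0 : J) (L : R)
    (F : (J -> R) -> J -> R) :
  0 < L ->
  (forall v j, 0 <= F v j) -> (forall v, \sum_j F v j = L) ->
  (forall (v_ : nat -> J -> R) v, (forall j, v_ n j @[n --> \oo] --> v j) ->
     forall j, F (v_ n) j @[n --> \oo] --> F v j) ->
  exists v, [/\ forall j, 0 <= v j, \sum_j v j = L & forall j, F v j = v j].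
Proof.
move=> L0 F0 FL Fcont.
pose step (m : nat) : R := L / m.+1%:R.
have step0 m : 0 < step m by rewrite divr_gt0.
have sumstep m (x : {ffun J -> 'I_m.+2}) : (\sum_j x j = m.+1)%N ->
    \sum_j (x j)%:R * step m = L.
  move=> xm; rewrite -mulr_suml -natr_sum xm mulrC /step -mulrA mulVf ?mulr1 //.
have /choice[xw xwP] : forall m, exists xw : (J -> R) * (J -> J -> R),
    [/\ forall j, 0 <= xw.1 j, \sum_j xw.1 j = L,
        forall j i, `|xw.2 j i - xw.1 i| <= step m * #|J|%:R
      & forall j, xw.1 j - step m * #|J|%:R <= F (xw.2 j) j].
  move=> m; pose pt (x : {ffun J -> 'I_m.+2}) j := (x j)%:R * step m.
  have /choice[c cP] : forall x : {ffun J -> 'I_m.+2}, exists j,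
      (\sum_j x j = m.+1)%N -> pt x j <= F (pt x) j.
    move=> x; have [/forallP H|] := boolP [forall j, F (pt x) j < pt x j].
      exists j0 => xm; have := FL (pt x); rewrite -(sumstep m x xm) => /eqP.
      rewrite lt_eqF // ; apply: ltr_sum; first by apply/hasP; exists j0; rewrite // mem_index_enum.
      by move=> i _; apply: H.
    by rewrite negb_forall => /existsP[j]; rewrite -leNgt => Hj; exists j.
  have [x [w [xm wP]]] := grid_cluster c j0.
  exists (pt x, fun j => pt (w j)); split=> /=.
  - by move=> j; rewrite mulr_ge0 // ltW.
  - exact: sumstep.
  - move=> j i; have [_ wx xw _] := wP j.
    rewrite /pt -mulrBl normrM (gtr0_norm (step0 m)) mulrC ler_pM2l //.
    rewrite ler_norml; apply/andP; split.
      by rewrite lerBrDr addrC lerBlDr -natrD ler_nat.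
    by rewrite lerBlDr addrC -natrD ler_nat.
  - move=> j; have [wm wx xw [wj|[-> xj]]] := wP j.
      have := cP (w j) wm; rewrite wj; apply: le_trans.
      rewrite /pt mulrC -mulrBr [leRHS]mulrC ler_pM2l // lerBlDr -natrD ler_nat.
      exact: xw.
    apply: le_trans (F0 _ _); rewrite /pt mulrC -mulrBr pmulr_rle0 // subr_le0 ler_nat.
    exact: xj.
have [|e e0|phi [x [phik phix]]] :=
    @compact_subsequence R J setT (fun m => (xw m).1) L.
- move=> m j _; have [x0 xL _ _] := xwP m; rewrite ger0_norm // -xL (bigD1 j) //=.
  by rewrite lerDl sumr_ge0.
- exists (index_enum J) => // j _; exists j; first exact: mem_index_enum.
  by move=> m; rewrite subrr normr0 ltW.
have xcvg j : (xw (phi k)).1 j @[k --> \oo] --> x j.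
  by apply: (@cvg_dist_le _ _ harmonic) (cvg_harmonic) => k; exact: phix.
have steps : step (phi k) * #|J|%:R @[k --> \oo] --> (0 : R).
  under eq_fun do rewrite /step mulrAC.
  exact: cvg_inv_succ.
have wcvg j i : (xw (phi k)).2 j i @[k --> \oo] --> x i.
  apply: (@cvg_sub0 _ _ _ _ _ _ (fun k => (xw (phi k)).1 i)); last exact: xcvg.
  apply: (@cvg_dist_le _ _ (fun k => step (phi k) * #|J|%:R)) steps => k.
  by rewrite subr0; have [_ _ + _] := xwP (phi k); apply.
have xle j : x j <= F x j.
  have xs : (xw (phi k)).1 j - step (phi k) * #|J|%:R @[k --> \oo] --> x j - 0.
    exact: cvgB.
  have Fx : F ((xw (phi k)).2 j) j @[k --> \oo] --> F x j by apply: Fcont.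
  rewrite -[leLHS]subr0; apply: (ler_cvg_to xs Fx).
  by apply: nearW => k; have [_ _ _] := xwP (phi k); apply.
have xL : \sum_j x j = L.
  have : \sum_j (xw (phi k)).1 j @[k --> \oo] --> \sum_j x j.
    by apply: cvg_big => [|j _]; [exact: add_continuous|exact: xcvg].
  have -> : (fun k => \sum_j (xw (phi k)).1 j) = fun=> L.
    by apply/funext => k; have [_ ] := xwP (phi k).
  move=> H; apply: (cvg_unique _ H (cvg_cst L)).
  exact: norm_hausdorff.
exists x; split=> // j.
  apply: (cvgr_to_ge (xcvg j)).
  by apply: nearW => k; have [] := xwP (phi k).
have : \sum_j (F x j - x j) == 0 by rewrite sumrB FL xL subrr.
rewrite psumr_eq0; last by move=> i _; rewrite subr_ge0.
by move=> /allP/(_ j (mem_index_enum _)) /=; rewrite subr_eq0 => /eqP.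
Qed.

(** The cube is a retract of the simplex of sum #|I| + 1, through one additional
    coordinate taking up the difference. *)
Lemma brouwer_cube (R : realType) (I : finType) (F : (I -> R) -> I -> R) :
  (forall z, (forall i, 0 <= z i <= 1) -> forall i, 0 <= F z i <= 1) ->
  (forall (z_ : nat -> I -> R) z, (forall n i, 0 <= z_ n i <= 1) ->
     (forall i, z_ n i @[n --> \oo] --> z i) ->
     forall i, F (z_ n) i @[n --> \oo] --> F z i) ->
  exists z, (forall i, 0 <= z i <= 1) /\ forall i, F z i = z i.
Proof.
move=> F01 Fcont.
(* Precomposing with the retraction makes F defined and continuous everywhere. *)
pose ret (v : option I -> R) i := Num.max 0 (Num.min 1 (v (Some i))).
have ret01 v i : 0 <= ret v i <= 1.
  by rewrite le_max lexx /= ge_max ler01 ge_min lexx.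
pose L : R := #|I|.+1%:R.
pose Fb v (j : option I) := if j is Some i then F (ret v) i else L - \sum_i F (ret v) i.
have sumopt (v : option I -> R) : \sum_j v j = v None + \sum_i v (Some i).
  rewrite (bigD1 None) //= (reindex_omap Some id) /=; last by case.
  by congr (_ + _); apply: eq_bigl => i; rewrite eqxx.
have [] := @brouwer_simplex R (option I) None L Fb.
- by [].
- move=> v [i|] /=; first by have /andP[] := F01 _ (ret01 v) i.
  rewrite subr_ge0 (@le_trans _ _ (\sum_(i : I) 1)) //.
    by apply: ler_sum => i _; have /andP[] := F01 _ (ret01 v) i.
  by rewrite sumr_const ler_nat leqnSn.
- by move=> v; rewrite sumopt /= subrK.
- move=> v_ v v_v.
  have Fc i : F (ret (v_ n)) i @[n --> \oo] --> F (ret v) i.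
    apply: Fcont => [n k|k]; first exact: ret01.
    by apply: cvg_maxr; [exact: cvg_cst|apply: cvg_minr; [exact: cvg_cst|exact: v_v]].
  case=> [i|] /=; first exact: Fc.
  by apply: cvgB; [exact: cvg_cst|apply: cvg_big => [|i _]; [exact: add_continuous|exact: Fc]].
move=> v [v0 _ vE]; exists (ret v); split=> // i.
have Fi : F (ret v) i = v (Some i) := vE (Some i).
have /andP[_] := F01 _ (ret01 v) i; rewrite Fi => v1.
by rewrite /ret min_r // max_r.
Qed.

(** * Schauder's theorem *)

Section Clip.
Variable R : realType.
Implicit Types a b x : R.

Definition clip a b x : R := Num.max a (Num.min b x).

Lemma clip_itv a b x : a <= b -> a <= clip a b x <= b.
Proof. by move=> ab; rewrite /clip le_max lexx /= ge_max ab ge_min lexx. Qed.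

Lemma clip_id a b x : a <= x <= b -> clip a b x = x.
Proof. by move=> /andP[ax xb]; rewrite /clip min_r // max_r. Qed.

Lemma clip_continuous a b : continuous (clip a b).
Proof. by move=> x; apply: cvg_maxr; [exact: cvg_cst|apply: cvg_minr; [exact: cvg_cst|exact: cvg_id]]. Qed.

End Clip.

Lemma continuous_retract (X Y Z : topologicalType) (D : set X) (g : X -> Y) (r : Z -> X) :
  {within D, continuous g} -> continuous r -> (forall z, D (r z)) -> continuous (g \o r).
Proof.
move=> /subspace_continuousP gD rc rD z.
apply: (@cvg_comp _ _ _ r g _ (within D (nbhs (r z)))); last exact: gD.
move=> A wA; have nA : \forall y \near z, D (r y) -> A (r y) := rc z _ wA.
by apply: (@filterS _ (nbhs z)) nA => y; apply.
Qed.

Lemma measurable_truncn_glue (R : realType) d (T : measurableType d) (kappa : T -> R)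
    (g : nat -> T -> R) :
  measurable_fun setT kappa -> (forall n, measurable_fun setT (g n)) ->
  measurable_fun setT (fun x => g (Num.truncn (kappa x)) x).
Proof.
move=> mk mg _ Y mY; rewrite setTI.
have -> : (fun x => g (Num.truncn (kappa x)) x) @^-1` Y =
  \bigcup_n ([set x | (Num.truncn (kappa x))%:R = n%:R :> R] `&` g n @^-1` Y).
  apply/seteqP; split=> x /=; first by move=> Yx; exists (Num.truncn (kappa x)).
  by move=> [n _ [/= /eqP + Yx]]; rewrite eqr_nat => /eqP ->.
apply: bigcup_measurable => n _; apply: measurableI.
  have mt : measurable_fun setT (fun x : R => (Num.truncn x)%:R : R).
    by apply: nondecreasing_measurable => // x y xy; rewrite ler_nat le_truncn.
  have := measurableT_comp mt mk; move=> /(_ measurableT [set n%:R] (measurable_set1 _)).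
  by rewrite setTI.
by rewrite -[X in measurable X]setTI; apply: mg.
Qed.

Lemma truncn_dist (R : realType) (x : R) (n : nat) : 0 <= x ->
  `|(Num.truncn (x * n.+1%:R))%:R / n.+1%:R - x| <= n.+1%:R^-1.
Proof.
move=> x0; have n0 : 0 < n.+1%:R :> R by [].
have /andP[l u] := truncn_itv (mulr_ge0 x0 (ltW n0)).
rewrite -[X in _ - X](mulfK (lt0r_neq0 n0)) -mulrBl normrM normfV (gtr0_norm n0).
rewrite -[leRHS]mul1r ler_pM2r ?invr_gt0 // ler_norml.
by move: l u; rewrite -natr1 => l u; apply/andP; split; lra.
Qed.

(** The first argument is discretised, which leaves countably many measurable
    pieces, and continuity in it permits the limit. *)
Lemma measurable_caratheodory (R : realType) d (T : measurableType d) (kappa : T -> R)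
    (h : R -> T -> R) :
  measurable_fun setT kappa -> (forall x, 0 <= kappa x) ->
  (forall t, measurable_fun setT (h t)) -> (forall x, continuous (h ^~ x)) ->
  measurable_fun setT (fun x => h (kappa x) x).
Proof.
move=> mk k0 mh hc.
apply: (@measurable_fun_cvg _ _ _ _
  (fun n x => h ((Num.truncn (kappa x * n.+1%:R))%:R / n.+1%:R) x)) => [m|x _].
  apply: (@measurable_truncn_glue _ _ _ (fun x => kappa x * m.+1%:R)
    (fun n x => h (n%:R / m.+1%:R) x)) => //.
  exact: measurable_funM.
apply: (@cvg_comp _ _ _ _ (h ^~ x) _ (nbhs (kappa x))); last exact: hc.
apply: (@cvg_dist_le _ _ harmonic); last exact: cvg_harmonic.
by move=> n; exact: truncn_dist.
Qed.

Section Schauder.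
Variables (R : realType) (M : R).
Hypothesis M0 : 0 < M.

(** The domain of the operators below: it contains the step functions by which
    continuous functions are approximated. *)
Definition bounded_measurable (u : R -> R) :=
  measurable_fun setT u /\ forall t, 0 <= u t <= M.

(** The index of the left endpoint of the cell containing t, among the N + 2
    points k/(N + 1). *)
Definition node (N : nat) (t : R) : 'I_N.+2 := inord (Num.truncn (clip 0 1 t * N.+1%:R)).

Definition step N (z : 'I_N.+2 -> R) (t : R) : R := M * z (node N t).

Lemma node_dist N (t : R) : t \in `[0, 1] -> `|(node N t)%:R / N.+1%:R - t| <= N.+1%:R^-1.
Proof.
rewrite in_itv /= => t01; rewrite /node clip_id // inordK; last first.
  rewrite ltnS -(@ler_nat R); have /andP[t0 t1] := t01.
  rewrite (@le_trans _ _ (t * N.+1%:R)) // ?truncn_le ?mulr_ge0 //.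
  by rewrite ler_piMl.
by apply: truncn_dist; case/andP: t01.
Qed.

Lemma node_itv N (i : 'I_N.+2) : i%:R / N.+1%:R \in `[(0 : R), 1].
Proof. by rewrite in_itv /= divr_ge0 //= ler_pdivrMr // mul1r ler_nat -ltnS. Qed.

Lemma step_bounded N z : (forall i, 0 <= z i <= 1) -> bounded_measurable (@step N z).
Proof.
move=> z01; split=> [|t].
  apply: measurable_funM => //.
  apply: (@measurable_truncn_glue _ _ _ (fun t => clip 0 1 t * N.+1%:R) (fun n t => z (inord n))) => //.
  apply: measurable_funM => //; apply: continuous_measurable_fun.
  exact: clip_continuous.
have /andP[z0 z1] := z01 (node N t).
by rewrite /step mulr_ge0 ?(ltW M0) //= ler_piMr ?(ltW M0).
Qed.

Variable Phi : (R -> R) -> R -> R.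
Hypothesis Phi_itv : forall u (t : R), bounded_measurable u -> t \in `[0, 1] -> 0 <= Phi u t <= M.
Hypothesis Phi_equi : forall e : R, 0 < e -> exists2 d : R, 0 < d &
  forall u (s t : R), bounded_measurable u -> s \in `[0, 1] -> t \in `[0, 1] ->
    `|s - t| <= d -> `|Phi u s - Phi u t| <= e.
Hypothesis Phi_cont : forall (u_ : nat -> R -> R) u,
  (forall n, bounded_measurable (u_ n)) -> bounded_measurable u ->
  (forall t : R, t \in `[0, 1] -> u_ n t @[n --> \oo] --> u t) ->
  forall t : R, t \in `[0, 1] -> Phi (u_ n) t @[n --> \oo] --> Phi u t.

(** The discretised equation: a step function reproduced by Phi at the nodes is a
    fixed point of a map of the finite-dimensional cube. *)
Lemma step_fixed_point N : exists z : 'I_N.+2 -> R, (forall i, 0 <= z i <= 1) /\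
  forall i : 'I_N.+2, Phi (step z) (i%:R / N.+1%:R) = M * z i.
Proof.
have [|z_ z z01 z_z i|z [z01 zE]] := @brouwer_cube R 'I_N.+2
    (fun z i => Phi (step z) (i%:R / N.+1%:R) / M).
- move=> z z01 i; have /andP[P0 PM] := Phi_itv (step_bounded z01) (node_itv i).
  by rewrite divr_ge0 ?(ltW M0) //= ler_pdivrMr // mul1r.
- apply: cvgMl; apply: Phi_cont (node_itv i) => [n||t _].
  + exact: step_bounded.
  + apply: step_bounded => j; apply/andP; split.
      by apply: (cvgr_to_ge (z_z j)); apply: nearW => n; case/andP: (z01 n j).
    by apply: (cvgr_to_le (z_z j)); apply: nearW => n; case/andP: (z01 n j).
  + by apply: cvgMr; exact: z_z.
- by exists z; split=> // i; rewrite -zE mulrCA divff ?mulr1 ?lt0r_neq0.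
Qed.

Lemma inv_succ_le (e : R) : 0 < e -> exists N, forall n, (N <= n)%N -> n.+1%:R^-1 <= e.
Proof.
move=> e0; exists (Num.truncn e^-1) => n Nn.
rewrite invf_ple ?posrE // ltW // (lt_le_trans (truncnS_gt _)) // ler_nat ltnS //.
Qed.

(** Schauder's theorem for operators with equicontinuous range.  The images of
    the discrete solutions have a uniformly convergent subsequence; by
    equicontinuity the step functions themselves converge to the same limit, so
    continuity under pointwise convergence identifies it as a fixed point. *)
Theorem equicontinuous_fixed_point : exists u, [/\ bounded_measurable u,
  {within `[0, 1], continuous u} & forall t : R, t \in `[0, 1] -> Phi u t = u t].
Proof.
pose z N := projT1 (cid (step_fixed_point N)).
have zP N : (forall i, 0 <= z N i <= 1) /\ forall i : 'I_N.+2,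
    Phi (step (z N)) (i%:R / N.+1%:R) = M * z N i.
  exact: projT2 (cid (step_fixed_point N)).
pose v N := Phi (step (z N)).
have Dz N : bounded_measurable (step (z N)) by apply: step_bounded; have [] := zP N.
have stepv N t : t \in `[0, 1] -> step (z N) t = v N ((node N t)%:R / N.+1%:R).
  by move=> _; rewrite /step /v; have [_ ->] := zP N.
have I01 (t : R) : `[0, 1]%classic t -> t \in `[0, 1] by [].
have [|e e0|phi [u [phik phiu]]] := @compact_subsequence R R `[0, 1] v M.
- by move=> n t /I01 /(Phi_itv (Dz n)) /andP[v0 vM]; rewrite ger0_norm.
- have [d d0 dP] := Phi_equi e0; have [N NP] := inv_succ_le d0.
  exists [seq (nat_of_ord i)%:R / N.+1%:R | i : 'I_N.+2].
    by move=> t /mapP[i _ ->]; exact: node_itv.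
  move=> t /I01 t01; exists ((node N t)%:R / N.+1%:R).
    by apply: (map_f (fun i : 'I_N.+2 => (nat_of_ord i)%:R / N.+1%:R)); rewrite mem_enum.
  move=> n; apply: dP => //; first exact: node_itv.
  by rewrite distrC (le_trans (node_dist _ t01)) // NP.
have vcvg t : t \in `[0, 1] -> v (phi k) t @[k --> \oo] --> u t.
  by move=> t01; apply: (@cvg_dist_le _ _ harmonic) cvg_harmonic => k; exact: phiu.
have scvg t : t \in `[0, 1] -> step (z (phi k)) t @[k --> \oo] --> u t.
  move=> t01; apply: (@cvg_sub0 _ _ _ _ _ _ (fun k => v (phi k) t)); last exact: vcvg.
  apply/cvgrPdist_le => e e0; have [d d0 dP] := Phi_equi e0; have [N NP] := inv_succ_le d0.
  exists N => // k /= Nk; rewrite sub0r normrN.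
  suff : `|step (z (phi k)) t - v (phi k) t| <= e by [].
  rewrite stepv //; apply: dP => //; first exact: node_itv.
  by rewrite (le_trans (node_dist _ t01)) // NP // (leq_trans Nk).
have uE e : 0 < e -> exists2 d, 0 < d & forall s t, s \in `[0, 1] -> t \in `[0, 1] ->
    `|s - t| <= d -> `|u s - u t| <= e.
  move=> e0; have [d d0 dP] := Phi_equi e0; exists d => // s t s01 t01 st.
  have : `|v (phi k) s - v (phi k) t| @[k --> \oo] --> `|u s - u t|.
    by apply: cvg_norm; apply: cvgB; exact: vcvg.
  by move=> /cvgr_to_le; apply; apply: nearW => k; exact: dP.
(* u is only controlled on [0,1]; its constant continuation is in the domain. *)
have clip01 t : clip 0 1 t \in `[(0 : R), 1] by rewrite in_itv /= clip_itv.
have step_clip N t : step (z N) (clip 0 1 t) = step (z N) t.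
  by rewrite /step /node (@clip_id _ _ _ (clip 0 1 t)) // clip_itv.
have Du : bounded_measurable (u \o clip 0 1).
  split.
    apply: (@measurable_fun_cvg _ _ _ _ (fun k => step (z (phi k)))) => [k|t _].
      by have [] := Dz (phi k).
    by under eq_fun do rewrite -step_clip; apply: scvg.
  move=> t; apply/andP; split.
    apply: (cvgr_to_ge (vcvg _ (clip01 t))); apply: nearW => k.
    by have /andP[] := Phi_itv (Dz (phi k)) (clip01 t).
  apply: (cvgr_to_le (vcvg _ (clip01 t))); apply: nearW => k.
  by have /andP[] := Phi_itv (Dz (phi k)) (clip01 t).
have uclip t : t \in `[0, 1] -> (u \o clip 0 1) t = u t.
  by rewrite in_itv /= => t01; rewrite /= clip_id.
exists (u \o clip 0 1); split=> //.
  apply/subspace_continuousP => x /I01 x01; apply/cvgrPdist_le => e e0.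
  have [d d0 dP] := uE e e0.
  rewrite near_withinE; apply: filterS (nbhsx_ballx x d d0) => t /= /ltW xt /I01 t01.
  suff : `|(u \o clip 0 1) x - (u \o clip 0 1) t| <= e by [].
  by rewrite !uclip //; apply: dP.
move=> t t01; rewrite uclip //.
have : Phi (step (z (phi k))) t @[k --> \oo] --> Phi (u \o clip 0 1) t.
  apply: Phi_cont => // s s01; rewrite uclip //; exact: scvg.
by move=> H; apply: (cvg_unique _ H (vcvg t t01)); exact: norm_hausdorff.
Qed.

End Schauder.

(** * Integration: reflection, dominated convergence, Hoelder *)

Section Reflection.
Variable R : realType.
Notation mu := (@lebesgue_measure R).

Let refl (x : measurableTypeR R) : measurableTypeR R := 1 - (x : R).

Let refl_measurable : measurable_fun setT refl.
Proof. by apply: (measurable_funB (f := cst 1)). Qed.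

Let refl_mu : {measure set (measurableTypeR R) -> \bar R} :=
  measure_function_pushforward__canonical__measure_function_Measure mu refl_measurable.

(** The reflected measure agrees with Lebesgue measure on intervals, hence on
    Borel sets; this transfers hypotheses on b(t) to b(1 - s). *)
Lemma lebesgue_measure_reflect (A : set R) : measurable A ->
  mu ((fun x => 1 - x) @^-1` A) = mu A.
Proof.
move=> mA; apply/esym.
suff H X : ocitv X -> mu X = refl_mu X.
  exact: (@lebesgue_measure_unique R refl_mu H A mA).
move=> [[a b] _ <-] /=.
rewrite /refl_mu /= /pushforward /=.
have -> : refl @^-1` `]a, b] = `[1 - b, 1 - a[%classic.
  apply/seteqP; split=> x /=; rewrite !in_itv /= /refl => /andP[? ?]; apply/andP; split; lra.
rewrite !lebesgue_measure_itv /= !lte_fin ltrD2l ltrN2; case: ifP => // _.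
by rewrite -!EFinD; congr EFin; lra.
Qed.

Lemma integral_reflect (D : set R) (h : R -> \bar R) : measurable D ->
  measurable_fun D h -> (forall x, D x -> 0 <= h x)%E ->
  (\int[mu]_(x in (fun x => 1 - x)%R @^-1` D) h (1 - x)%R = \int[mu]_(x in D) h x)%E.
Proof.
move=> mD mh h0; have h0' : {in D, forall y, 0 <= h y}%E by move=> y /[!inE]; exact: h0.
rewrite -[LHS](@ge0_integral_pushforward _ _ _ _ _ refl refl_measurable mu D h mD mh h0').
apply: eq_measure_integral => A mA _; exact: lebesgue_measure_reflect.
Qed.

Lemma integrable_reflect (h : R -> R) : mu.-integrable `]0, 1] (EFin \o h) ->
  mu.-integrable `[0, 1[ (EFin \o (fun x => h (1 - x))).
Proof.
have preE : (fun x : R => 1 - x) @^-1` `]0, 1] = `[0, 1[%classic.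
  by apply/seteqP; split=> x /=; rewrite !in_itv /= => /andP[? ?]; apply/andP; split; lra.
move=> /integrableP[mh hoo]; apply/integrableP; split.
  have mr : measurable_fun (`[0, 1[ : set R) (fun x : R => 1 - x) by apply: measurable_funB.
  suff : measurable_fun (`[0, 1[ : set R) ((EFin \o h) \o (fun x => 1 - x)) by [].
  apply: (measurable_comp _ _ mh mr) => //.
  by move=> _ [x /= + <-]; rewrite !in_itv /= => /andP[? ?]; apply/andP; split; lra.
have := @integral_reflect `]0, 1]%classic (abse \o (EFin \o h)).
by rewrite preE /= => -> //; exact: measurableT_comp.
Qed.

Lemma ae_reflect (P : R -> Prop) : {ae mu, forall x, P x} -> {ae mu, forall x, P (1 - x)}.
Proof.
move=> [N [mN N0 subN]]; exists ((fun x => 1 - x) @^-1` N); split.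
- by rewrite -[X in measurable X]setTI; apply: refl_measurable.
- by rewrite lebesgue_measure_reflect.
- by move=> x Px; exact: subN.
Qed.

End Reflection.

Section Dominated.
Context d (T : measurableType d) (R : realType) (mu : {measure set T -> \bar R}).

Lemma Rintegral_dominated (D : set T) (f_ : nat -> T -> R) (f g : T -> R) :
  measurable D -> (forall n, measurable_fun D (f_ n)) -> mu.-integrable D (EFin \o g) ->
  (forall n x, D x -> `|f_ n x| <= g x) ->
  (forall x, D x -> f_ n x @[n --> \oo] --> f x) ->
  \int[mu]_(x in D) f_ n x @[n --> \oo] --> \int[mu]_(x in D) f x.
Proof.
move=> mD mf_ ig fg f_f.
have mf : measurable_fun D f by apply: measurable_fun_cvg mf_ f_f.
have [||||i_f _ cvgf] := @dominated_convergence _ _ _ mu D mD (fun n => EFin \o f_ n)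
    (EFin \o f) (EFin \o g) _ _ _ ig.
- by move=> n; exact/measurable_EFinP.
- exact/measurable_EFinP.
- by apply: aeW => x Dx; apply: cvg_EFin; [exact: nearW|exact: f_f].
- by apply: aeW => x n Dx; rewrite /= lee_fin fg.
have fn : (\int[mu]_(x in D) (f x)%:E \is a fin_num)%E by exact: integrable_fin_num.
by apply: fine_cvg; rewrite fineK.
Qed.

Lemma bounded_integrable (D : set T) (w h : T -> R) (c : R) : measurable D ->
  mu.-integrable D (EFin \o w) -> measurable_fun D h -> (forall x, D x -> `|h x| <= c) ->
  mu.-integrable D (EFin \o (fun x => w x * h x)).
Proof.
move=> mD iw mh hc; have [/measurable_EFinP mw _] := integrableP _ _ _ iw.
apply: (@le_integrable _ _ _ mu D mD _ (fun x => c%:E * (w x)%:E)%E).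
- by apply/measurable_EFinP; apply: measurable_funM.
- move=> x Dx /=; rewrite lee_fin !normrM mulrC ler_wpM2r //.
  by rewrite (le_trans (hc _ Dx)) // ler_norm.
- exact: integrableZl.
Qed.

Lemma Rintegral_subset (A B : set T) (f : T -> R) : measurable A -> measurable B ->
  A `<=` B -> mu.-integrable B (EFin \o f) -> (forall x, B x -> 0 <= f x) ->
  \int[mu]_(x in A) f x <= \int[mu]_(x in B) f x.
Proof.
move=> mA mB AB fi f0; apply: fine_le.
- by apply: integrable_fin_num => //; apply: integrableS fi.
- by apply: integrable_fin_num.
- apply: ge0_subset_integral => //; by case/integrableP: fi.
Qed.

(** Hoelder's inequality for the constant 1 = w^{1/q} v^{(q-1)/q} bounds the
    measure of E; it turns integrability of a negative power of w into a lower
    bound for the integral of w. *)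
Lemma hoelder_reciprocal (E : set T) (w v : T -> R) (q : R) : measurable E ->
  mu.-integrable E (EFin \o w) -> mu.-integrable E (EFin \o v) ->
  (forall x, E x -> 0 <= w x) -> (forall x, E x -> 0 <= v x) -> 1 < q ->
  {ae mu, forall x, E x -> w x `^ q^-1 * v x `^ ((q - 1) / q) = 1} ->
  fine (mu E) <= (\int[mu]_(x in E) w x) `^ q^-1 * (\int[mu]_(x in E) v x) `^ ((q - 1) / q).
Proof.
move=> mE iw iv w0 v0 q1 wv.
have q0 : 0 < q by lra.
have q10 : 0 < (q - 1) / q by rewrite divr_gt0 ?subr_gt0.
have restrict_powR (u : T -> R) a : mu.-integrable E (EFin \o u) ->
    (forall x, E x -> 0 <= u x) -> 0 < a ->
    measurable_fun setT (fun x => (u \_ E) x `^ a) /\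
    Lnorm mu (a^-1)%:E (EFin \o (fun x => (u \_ E) x `^ a)) = ((\int[mu]_(x in E) u x) `^ a)%:E.
  move=> iu u0 a0; have mu' : measurable_fun setT (u \_ E).
    apply/(measurable_restrictT _ _).1 => //.
    by have [/measurable_EFinP] := integrableP _ _ _ iu.
  split; first exact: measurableT_comp (measurable_powR _) mu'.
  rewrite unlock /= invrK -poweR_EFin; congr (_ `^ _)%E.
  rewrite fineK ?integrable_fin_num // [RHS]integral_mkcond.
  apply: eq_integral => x _; rewrite patchE /=.
  have ux : 0 <= (u \_ E) x by rewrite patchE; case: ifPn => // /[!inE] /u0.
  rewrite ger0_norm ?powR_ge0 // -powRrM divff ?lt0r_neq0 // powRr1 //.
  by rewrite patchE; case: ifP.
have iq0 : 0 < q^-1 by rewrite invr_gt0.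
have [mf fN] := restrict_powR w q^-1 iw w0 iq0.
have [mg gN] := restrict_powR v _ iv v0 q10.
have := @hoelder _ _ _ mu _ _ (q^-1)^-1 ((q - 1) / q)^-1 mf mg.
rewrite fN gN !invr_gt0 !invrK q0 q10 => /(_ isT isT).
have -> : q^-1 + (q - 1) / q = 1 by rewrite -[X in X + _]mul1r -mulrDl addrC subrK divff // lt0r_neq0.
move=> /(_ erefl) holder.
have muE : (mu E <= ((\int[mu]_(x in E) w x) `^ q^-1 *
    (\int[mu]_(x in E) v x) `^ ((q - 1) / q))%:E)%E.
  rewrite EFinM; apply: le_trans holder.
  rewrite Lnorm1 -[mu E]mul1e -integral_cst // [leLHS]integral_mkcond.
  apply: ae_ge0_le_integral => //.
  - by move=> x _; rewrite patchE; case: ifP; rewrite ?lee01.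
  - apply/(measurable_restrictT _ _).1 => //.
  - apply: measurableT_comp => //; apply/measurable_EFinP; exact: measurable_funM.
  apply: filterS wv => x wvx _; rewrite /= !patchE; case: ifPn => [|_]; last by rewrite lee_fin.
  by rewrite inE => Ex; rewrite /= lee_fin wvx // normr1.
have mufin : mu E \is a fin_num.
  by rewrite ge0_fin_numE // (le_lt_trans muE) // ltry.
by rewrite -lee_fin fineK.
Qed.

End Dominated.

(** * Variable powers and the constants of the norm bounds *)

Section VariablePowers.
Variable R : realType.
Implicit Types (c r x pm pp : R).

Lemma measurable_powR_var d (T : measurableType d) (D : set T) (u p : T -> R) :
  measurable D -> measurable_fun D u -> measurable_fun D p ->
  measurable_fun D (fun s => u s `^ p s).
Proof.
move=> mD mu mp; rewrite /powR; apply: measurable_fun_if => //.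
- exact: measurable_fun_eqr.
- apply: (@measurable_funS _ _ _ _ D) => //.
  apply: (@measurableT_comp _ _ _ _ _ _ (fun c : bool => c%:R : R)) => //.
  exact: measurable_fun_eqr.
- apply: (@measurable_funS _ _ _ _ D) => //.
  apply: measurableT_comp => //; apply: measurable_funM => //.
  exact: measurableT_comp.
Qed.

(** At the limit 0 the power is not differentiable, and the convergence comes
    from inverting the power instead. *)
Lemma powR_cvg (x_ : nat -> R) x r : 0 < r -> (forall n, 0 <= x_ n) ->
  x_ n @[n --> \oo] --> x -> x_ n `^ r @[n --> \oo] --> x `^ r.
Proof.
move=> r0 x0 xx; have xge : 0 <= x by apply: (cvgr_to_ge xx); exact: nearW.
move: xge; rewrite le_eqVlt => /predU1P[xE|xpos]; last first.
  have c : {for x, continuous (fun y : R => y `^ r)}.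
    have d : derivable (fun y : R => y `^ r) x 1 by apply: derivable_powR; rewrite in_itv /= xpos.
    by apply: differentiable_continuous; apply/derivable1_diffP.
  by apply: (@cvg_comp _ _ _ x_ (fun y : R => y `^ r)); [exact: xx|exact: c].
rewrite -xE powR0 ?lt0r_neq0 //; apply/cvgrPdist_le => e e0.
have e'0 : 0 < e `^ r^-1 by apply: powR_gt0.
move: xx => /cvgrPdist_le/(_ _ e'0); apply: filterS => n.
rewrite -xE !sub0r !normrN ger0_norm // ger0_norm ?powR_ge0 // => xe.
have := @ge0_ler_powR _ r (ltW r0) (x_ n) (e `^ r^-1).
rewrite !nnegrE => /(_ (x0 n) (ltW e'0) xe) /le_trans; apply.
by rewrite -powRrM mulVf ?lt0r_neq0 // powRr1 // ltW.
Qed.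

(** Which of the two extreme exponents dominates depends on whether c >= 1. *)
Lemma powR_var_le x c r pm pp : 0 < pm -> pm <= r <= pp -> 0 <= x <= c ->
  x `^ r <= Num.max (c `^ pp) (c `^ pm).
Proof.
move=> pm0 /andP[pr rp] /andP[x0 xc]; have r0 : 0 < r by exact: lt_le_trans pr.
have c0 : 0 <= c by exact: le_trans xc.
apply: (@le_trans _ _ (c `^ r)).
  by apply: ge0_ler_powR; rewrite ?nnegrE // ltW.
rewrite le_max; have [c1|c1] := leP 1 c; first by rewrite ler_powR.
move: c0; rewrite le_eqVlt => /predU1P[<-|c0].
  by rewrite !powR0 ?lexx ?orbT // lt0r_neq0 // (lt_le_trans r0).
by rewrite [X in _ || X]ger_powR ?orbT // c0 ltW.
Qed.

Lemma powR_var_ge x c r pm pp : pm <= r <= pp -> 0 < c <= 1 -> 1 <= x ->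
  c `^ pp * x `^ pm <= (c * x) `^ r.
Proof.
move=> /andP[pr rp] /andP[c0 c1] x1.
rewrite powRM ?(ltW c0) ?(le_trans ler01) // ler_pM ?powR_ge0 //.
  by apply: ger_powR; rewrite ?c0.
exact: ler_powR.
Qed.

Lemma powR_lt1 c r : 0 < r -> 0 <= c < 1 -> c `^ r < 1.
Proof.
move=> r0 /andP[c0 c1]; have <- : 1 `^ r = 1 :> R by rewrite powR1.
by rewrite gt0_ltr_powR ?nnegrE.
Qed.

Lemma powR_ge1 c r : 0 <= r -> 1 <= c -> 1 <= c `^ r.
Proof. by move=> r0 c1; rewrite -[leLHS](powRr0 c) ler_powR. Qed.

Lemma powR_root_le r c a : 0 < a -> 0 <= r -> 0 <= c -> r <= c `^ a -> r `^ (1 / a) <= c.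
Proof.
move=> a0 r0 c0 rc; rewrite mul1r -[leRHS]powRr1 // -(mulfV (lt0r_neq0 a0)) powRrM.
by rewrite ge0_ler_powR ?nnegrE ?powR_ge0 // invr_ge0 ltW.
Qed.

(** m_rho is rho / (b * 1)(1) to the power 1 / pp or 1 / pm according as this
    number is at least 1 or not: it is the inverse of c |-> max(c^pp, c^pm). *)
Lemma m_rho_le (b : R -> R) pm pp rho c : 0 < pm -> pm <= pp -> 0 < rho -> 0 <= c ->
  0 < convol b (cst 1) 1 ->
  rho <= Num.max (c `^ pp) (c `^ pm) * convol b (cst 1) 1 ->
  m_rho b pm pp rho <= c.
Proof.
move=> pm0 pmp rho0 c0 W0; rewrite -ler_pdivrMr // /m_rho /eps_rho.
set r := rho / _ => rc; have r0 : 0 < r by exact: divr_gt0.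
have pp0 : 0 < pp by exact: lt_le_trans pmp.
have ipp0 : 0 < 1 / pp by exact: divr_gt0.
rewrite (powR_gt0 _ r0) /=; have [r1|r1] := ltP.
  have {}r1 : r < 1.
    by rewrite ltNge; apply/negP => /(powR_ge1 (ltW ipp0)); rewrite leNgt r1.
  rewrite addrC subrK; have [c1|c1] := leP 1 c.
    by apply: le_trans c1; rewrite ltW // powR_lt1 ?divr_gt0 // r1 ltW.
  apply: powR_root_le => //; first exact: ltW.
  move: rc; rewrite le_max => /orP[|//] /le_trans; apply.
  move: c0; rewrite le_eqVlt => /predU1P[<-|c0].
    by rewrite !powR0 ?lexx // lt0r_neq0.
  by apply: ger_powR => //; rewrite c0 ltW.
rewrite addr0; have {}r1 : 1 <= r.
  by rewrite leNgt; apply/negP => r1'; move: r1; rewrite leNgt powR_lt1 // r1' ltW.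
have c1 : 1 <= c.
  rewrite leNgt; apply/negP => c1; move: (le_trans r1 rc); apply/negP.
  by rewrite -ltNge gt_max !powR_lt1 ?c0.
apply: powR_root_le => //; first exact: ltW.
by move: rc; rewrite le_max => /orP[//|] /le_trans; apply; exact: ler_powR.
Qed.

(** The algebra behind Mbar_rho, with X for eta0 times the norm, I for the
    integral of b(1 - s) over an interval of length l, and V for the dual factor of
    Hoelder's inequality: combining the last two hypotheses gives
    X^{pm/q} l <= rho^{1/q} V when X >= 1, and the summand 1 covers X < 1. *)
Lemma root_product_le (X I V rho l pm q : R) : 0 < pm -> 1 < q -> 0 < rho -> 0 <= X ->
  0 <= I -> 0 <= V -> 0 < l <= 1 ->
  (1 <= X -> X `^ pm * I <= rho) -> l <= I `^ q^-1 * V ->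
  X <= l `^ (- (q / pm)) * (rho `^ (1 / q) * V + 1) `^ (q / pm).
Proof.
move=> pm0 q1 rho0 X0 I0 V0 /andP[l0 l1] XI lI.
have q0 : 0 < q by lra.
have a0 : 0 < q / pm by exact: divr_gt0.
have Z0 : 0 <= rho `^ (1 / q) * V + 1 by rewrite addr_ge0 // mulr_ge0 // powR_ge0.
have key : X `^ (pm / q) * l <= rho `^ (1 / q) * V + 1.
  have [X1|/ltW X1] := leP 1 X.
    apply: (@le_trans _ _ (rho `^ (1 / q) * V)); last by rewrite lerDl.
    apply: (@le_trans _ _ (X `^ (pm / q) * (I `^ q^-1 * V))); first by rewrite ler_wpM2l ?powR_ge0.
    rewrite mulrA ler_wpM2r // powRrM -powRM ?powR_ge0 // mul1r.
    by rewrite ge0_ler_powR ?nnegrE ?mulr_ge0 ?powR_ge0 ?invr_ge0 ?XI // ltW.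
  apply: (@le_trans _ _ 1); last by rewrite lerDr mulr_ge0 // powR_ge0.
  rewrite mulr_ile1 ?powR_ge0 ?(ltW l0) //.
  have <- : 1 `^ (pm / q) = 1 :> R by rewrite powR1.
  by rewrite ge0_ler_powR ?nnegrE // divr_ge0 // ltW.
have -> : X = (X `^ (pm / q)) `^ (q / pm).
  by rewrite -powRrM -[X in _ `^ X](_ : 1 = _) ?powRr1 //; field; rewrite !lt0r_neq0.
rewrite powRN [leRHS]mulrC ler_pdivlMr ?powR_gt0 // -powRM ?powR_ge0 ?(ltW l0) //.
apply: ge0_ler_powR => //; rewrite ?nnegrE //; first exact: ltW.
by rewrite mulr_ge0 ?powR_ge0 ?(ltW l0).
Qed.

End VariablePowers.

(** * Green's functions of the second derivative *)

Section OneSided.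
Variable R : realType.
Implicit Types (u v : R -> R) (a b c l t x : R).

Lemma is_derive_quotient u x l : is_derive x 1 u l ->
  h^-1 * (u (x + h) - u x) @[h --> 0^'] --> l.
Proof.
move=> [du <-]; rewrite /derive; apply: cvg_trans du.
by apply: near_eq_cvg; near=> h; rewrite /= -[h *: 1]/(h * 1) mulr1 [h + x]addrC.
Unshelve. all: by end_near. Qed.

Lemma is_derive_right u x l : is_derive x 1 u l -> right_derivative u x l.
Proof.
move=> /is_derive_quotient H; apply: cvg_trans H; apply: cvg_app => A nA.
by apply: (@filterS _ (nbhs (0 : R))) nA => y yA y0; apply: yA; rewrite gt_eqF.
Qed.

Lemma is_derive_left u x l : is_derive x 1 u l -> left_derivative u x l.
Proof.
move=> /is_derive_quotient H; apply: cvg_trans H; apply: cvg_app => A nA.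
by apply: (@filterS _ (nbhs (0 : R))) nA => y yA y0; apply: yA; rewrite lt_eqF.
Qed.

Lemma right_derivative_eq u v x b l : x < b -> (forall t, t \in `[x, b] -> u t = v t) ->
  right_derivative u x l -> right_derivative v x l.
Proof.
move=> xb uv; rewrite /right_derivative => H; apply: cvg_trans H.
apply: near_eq_cvg; near=> h.
have h0 : 0 < h by near: h; exact: nbhs_right_gt.
have hb : h < b - x by near: h; apply: nbhs_right_lt; rewrite subr_gt0.
by rewrite !uv // in_itv /=; apply/andP; split; lra.
Unshelve. all: by end_near. Qed.

Lemma left_derivative_eq u v x a l : a < x -> (forall t, t \in `[a, x] -> u t = v t) ->
  left_derivative u x l -> left_derivative v x l.
Proof.
move=> ax uv; rewrite /left_derivative => H; apply: cvg_trans H.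
apply: near_eq_cvg; near=> h.
have h0 : h < 0 by near: h; exact: nbhs_left_lt.
have ha : a - x < h by near: h; apply: nbhs_left_gt; rewrite subr_lt0.
by rewrite !uv // in_itv /=; apply/andP; split; lra.
Unshelve. all: by end_near. Qed.

Lemma is_derive_affine a c x : is_derive x 1 (fun t => a + c * t) c.
Proof.
have -> : (fun t => a + c * t) = cst a + (c *: (id : R -> R)) by apply/funext.
have := is_deriveD (is_derive_cst a x 1) (is_deriveZ c (is_derive_id x (1 : R))).
by rewrite add0r /GRing.scale /= mulr1.
Qed.

Lemma right_derivative_affine u x b a c l : x < b ->
  (forall t, t \in `[x, b] -> u t = a + c * t) -> right_derivative u x l -> l = c.
Proof.
move=> xb uE ul.
have := right_derivative_eq xb uE ul; have := is_derive_right (is_derive_affine a c x).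
by rewrite /right_derivative => H1 H2; apply: (cvg_unique _ H2 H1); exact: norm_hausdorff.
Qed.

Lemma left_derivative_affine u x b a c l : b < x ->
  (forall t, t \in `[b, x] -> u t = a + c * t) -> left_derivative u x l -> l = c.
Proof.
move=> xb uE ul.
have := left_derivative_eq xb uE ul; have := is_derive_left (is_derive_affine a c x).
by rewrite /left_derivative => H1 H2; apply: (cvg_unique _ H2 H1); exact: norm_hausdorff.
Qed.

(** The mean value theorem applied to u' and then to u. *)
Lemma affine_of_second_derivative0 u a b : a < b -> {within `[a, b], continuous u} ->
  (forall t, t \in `]a, b[ -> twice_derivable u t /\ - (u^`(2))%classic t = 0) ->
  exists c, forall t, t \in `[a, b] -> u t = (u a - c * a) + c * t.
Proof.
move=> ab uc u2.
have sub x y z : x \in `]a, b[ -> y \in `]a, b[ -> z \in `[x, y] -> z \in `]a, b[.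
  rewrite !in_itv /= => /andP[? ?] /andP[? ?] /andP[? ?]; apply/andP; split; lra.
have du0 t : t \in `]a, b[ -> is_derive t 1 (u^`())%classic 0.
  move=> /u2[[_ d2] /eqP]; rewrite oppr_eq0 => /eqP u20.
  by split; [exact: d2|rewrite -derive1E; exact: u20].
have du_cst x y : x \in `]a, b[ -> y \in `]a, b[ -> x < y ->
    (u^`())%classic x = (u^`())%classic y.
  move=> xI yI xy.
  have cts : {within `[x, y], continuous (u^`())%classic}.
    apply: derivable_within_continuous => z zI.
    by have [[_ d2] _] := u2 z (sub _ _ _ xI yI zI).
  have dxy z : z \in `]x, y[ -> is_derive z 1 (u^`())%classic 0.
    by move=> zI; apply: du0; apply: (sub x y) => //; exact: subset_itv_oo_cc zI.
  have [z _] := @MVT R (u^`())%classic (fun=> 0) x y xy dxy cts.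
  by rewrite mul0r => /eqP; rewrite subr_eq0 => /eqP.
pose m := (a + b) / 2; have mI : m \in `]a, b[ by rewrite in_itv /= /m; apply/andP; split; lra.
pose c := (u^`())%classic m.
have duc t : t \in `]a, b[ -> is_derive t 1 u c.
  move=> tI; have [[d1 _] _] := u2 t tI; split; first exact: d1.
  rewrite -derive1E /c; have [tm|mt|->//] := ltgtP t m; first exact: du_cst.
  by apply/esym; exact: du_cst.
exists c => t; rewrite in_itv /= => /andP[at_ tb].
move: at_; rewrite le_eqVlt => /predU1P[<-|at_]; first by rewrite subrK.
have dat z : z \in `]a, t[ -> is_derive z 1 u c.
  by rewrite in_itv /= => /andP[? ?]; apply: duc; rewrite in_itv /=; apply/andP; split; lra.
have cat : {within `[a, t], continuous u}.
  apply: continuous_subspaceW uc => z /=; rewrite !in_itv /= => /andP[? ?].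
  by apply/andP; split; lra.
by have [z _ H] := @MVT R u (fun=> c) a t at_ dat cat; lra.
Qed.

End OneSided.

Section UnitInterval.
Variable R : realType.
Notation mu := (@lebesgue_measure R).
Implicit Types (a b c x t s : R) (u v f g h : R -> R).

Lemma within_eq_continuous (D : set R) u v : continuous v ->
  (forall t, D t -> u t = v t) -> {within D, continuous u}.
Proof.
move=> vc uv; have := continuous_subspaceT vc (A := D).
by apply: subspace_eq_continuous => t; rewrite inE => Dt; exact: esym (uv t Dt).
Qed.

Lemma continuous_itv_integrable a b f : continuous f -> mu.-integrable `[a, b] (EFin \o f).
Proof.
move=> fc; apply: continuous_compact_integrable; first exact: segment_compact.
exact: continuous_subspaceT.
Qed.

Lemma Rintegral_oo a b f : mu.-integrable `[a, b] (EFin \o f) ->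
  \int[mu]_(s in `]a, b[) f s = \int[mu]_(s in `[a, b]) f s.
Proof.
move=> fi; rewrite Rintegral_itv_bndo_bndc; last first.
  by apply: integrableS fi => //; apply: subset_itvW.
rewrite Rintegral_itv_obnd_cbnd //; apply: integrableS fi => // x /=.
by rewrite !in_itv /= => /andP[/ltW-> ->].
Qed.

Lemma eq_Rintegral_oo a b f g : mu.-integrable `[a, b] (EFin \o f) ->
  mu.-integrable `[a, b] (EFin \o g) -> (forall s, s \in `]a, b[ -> f s = g s) ->
  \int[mu]_(s in `[a, b]) f s = \int[mu]_(s in `[a, b]) g s.
Proof.
move=> fi gi fg; rewrite -!Rintegral_oo //; apply: eq_Rintegral => s.
by rewrite inE => sI; apply: fg.
Qed.

Lemma Rintegral_split a x b f : continuous f -> a <= x <= b ->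
  \int[mu]_(s in `[a, b]) f s = \int[mu]_(s in `[a, x]) f s + \int[mu]_(s in `[x, b]) f s.
Proof.
move=> fc /andP[ax xb]; have fi := continuous_itv_integrable a b fc.
rewrite -[X in _ = _ + X]Rintegral_itv_obnd_cbnd; last first.
  by apply: integrableS fi => //; apply: subset_itv; rewrite bnd_simp.
by rewrite -(@Rintegral_itvB _ _ (BLeft a) (BRight b) x) ?bnd_simp // addrC subrK.
Qed.

Lemma Rintegral_lincomb a b c f g h : continuous f -> continuous g -> continuous h ->
  \int[mu]_(s in `[a, b]) ((c * f s + g s) * h s) =
  c * \int[mu]_(s in `[a, b]) (f s * h s) + \int[mu]_(s in `[a, b]) (g s * h s).
Proof.
move=> fc gc hc.
have fi : mu.-integrable `[a, b] (EFin \o (fun s => f s * h s)).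
  by apply: continuous_itv_integrable => s; apply: cvgM; [exact: fc|exact: hc].
have gi : mu.-integrable `[a, b] (EFin \o (fun s => g s * h s)).
  by apply: continuous_itv_integrable => s; apply: cvgM; [exact: gc|exact: hc].
rewrite -RintegralZl // -RintegralD //; last first.
  by apply: continuous_itv_integrable => s; apply: cvgMr; apply: cvgM; [exact: fc|exact: hc].
by apply: eq_Rintegral => s _; rewrite mulrDl mulrA.
Qed.

Section DoubleIntegral.
Variable g : R -> R.
Hypothesis gc : continuous g.
Let g1 s := s * g s.
Let g1c : continuous g1.
Proof. by move=> s; apply: cvgM; [exact: cvg_id|exact: gc]. Qed.

(** Starting at -1 makes the primitive two-sided differentiable at 0. *)
Definition primitive_from f t := \int[mu]_(s in `[-1, t]) f s.

Lemma is_derive_primitive f t : continuous f -> -1 < t -> is_derive t 1 (primitive_from f) (f t).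
Proof.
move=> fc t1.
have [||d <-] := @continuous_FTC1_closed R f (-1) t (t + 1) _ _ t1 (fc t).
- by rewrite ltrDl.
- exact: continuous_itv_integrable.
by rewrite derive1E; exact: DeriveDef.
Qed.

(** The double primitive of g vanishing with its derivative at 0, that is the
    integral of (t - s) g(s) over [0, t], written so that t occurs only in
    the limits of integration. *)
Definition moment t : R := t * (primitive_from g t - primitive_from g 0)
  - (primitive_from g1 t - primitive_from g1 0).

Lemma is_derive_moment t : -1 < t ->
  is_derive t 1 moment (primitive_from g t - primitive_from g 0).
Proof.
move=> t1.
have d0 := is_deriveB (is_derive_primitive gc t1) (is_derive_cst (primitive_from g 0) t 1).
have d1 := is_deriveB (is_derive_primitive g1c t1) (is_derive_cst (primitive_from g1 0) t 1).
have := is_deriveB (is_deriveM (is_derive_id t (1 : R)) d0) d1.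
rewrite /moment => H; apply: (is_derive_eq H).
rewrite /g1 /cst /= !subr0 /GRing.scale /=.
rewrite -[(primitive_from g - _) t]/(primitive_from g t - primitive_from g 0); ring.
Qed.

Lemma momentE t : t \in `[0, 1] ->
  \int[mu]_(s in `[0, 1]) (Num.max 0 (t - s) * g s) = moment t.
Proof.
rewrite in_itv /= => /andP[t0 t1].
have kc : continuous (fun s => Num.max 0 (t - s) * g s).
  move=> s; apply: cvgM; last exact: gc.
  by apply: cvg_maxr; [exact: cvg_cst|apply: cvgB; [exact: cvg_cst|exact: cvg_id]].
rewrite (@Rintegral_split 0 t 1) ?t0 //.
have -> : \int[mu]_(s in `[t, 1]) (Num.max 0 (t - s) * g s) = 0.
  transitivity (\int[mu]_(s in `[t, 1]) (0 : R)); last by rewrite Rintegral_cst // mul0r.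
  apply: eq_Rintegral => s; rewrite inE /= in_itv /= => /andP[ts _].
  by rewrite max_l ?mul0r // subr_le0.
rewrite addr0.
have -> : \int[mu]_(s in `[0, t]) (Num.max 0 (t - s) * g s) =
    \int[mu]_(s in `[0, t]) ((t * 1 - s) * g s).
  apply: eq_Rintegral => s; rewrite inE /= in_itv /= => /andP[_ st].
  by rewrite max_r ?mulr1 // subr_ge0.
rewrite (@Rintegral_lincomb _ _ t (cst 1) -%R) //; last first.
- exact: oppr_continuous.
- by move=> s; exact: cvg_cst.
have cg : continuous (fun s => cst 1 s * g s).
  by move=> s; apply: cvgM; [exact: cvg_cst|exact: gc].
have cg1 : continuous (fun s => - s * g s).
  by move=> s; apply: cvgM; [apply: cvgN; exact: cvg_id|exact: gc].
have e0 : -1 <= (0 : R) <= t by rewrite t0 andbT; lra.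
have := Rintegral_split cg e0; have := Rintegral_split cg1 e0.
have I1 x : \int[mu]_(s in `[-1, x]) (cst 1 s * g s) = primitive_from g x.
  by apply: eq_Rintegral => s _; rewrite /= mul1r.
have I2 x : \int[mu]_(s in `[-1, x]) (- s * g s) = - primitive_from g1 x.
  transitivity (-1 * primitive_from g1 x); last by rewrite mulN1r.
  rewrite /primitive_from -RintegralZl //; last exact: continuous_itv_integrable.
  by apply: eq_Rintegral => s _; rewrite /g1 mulN1r mulNr.
rewrite !I2 !I1 /moment.
by move=> /(congr1 -%R); rewrite opprD !opprK => -> ->; ring.
Qed.

End DoubleIntegral.
End UnitInterval.

Section Green.
Variables (R : realType) (B : 'M[R]_(2, 4)) (G : R -> R -> R).
Notation mu := (@lebesgue_measure R).
Hypothesis GB : is_green_function B G.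

(** G continued outside the unit square by its boundary values, so that it is
    continuous on the plane and the slices can be integrated and differentiated
    without restricting them. *)
Definition green_ext (z : R * R) : R := G (clip 0 1 z.1) (clip 0 1 z.2).

Lemma clip_pair_continuous : continuous (fun z : R * R => (clip 0 1 z.1, clip 0 1 z.2)).
Proof.
move=> z.
have c1 : clip 0 1 z'.1 @[z' --> z] --> clip 0 1 z.1.
  by apply: (@cvg_comp _ _ _ fst (clip 0 1) _ (nbhs z.1)); [exact: cvg_fst|exact: clip_continuous].
have c2 : clip 0 1 z'.2 @[z' --> z] --> clip 0 1 z.2.
  by apply: (@cvg_comp _ _ _ snd (clip 0 1) _ (nbhs z.2)); [exact: cvg_snd|exact: clip_continuous].
exact: cvg_pair c1 c2.
Qed.

Lemma green_ext_continuous : continuous green_ext.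
Proof.
have [_ Gc _] := GB.
apply: (continuous_retract Gc clip_pair_continuous) => z /=.
by split; rewrite /= in_itv /= clip_itv.
Qed.

Lemma green_extE (t s : R) : t \in `[0, 1] -> s \in `[0, 1] -> green_ext (t, s) = G t s.
Proof. by rewrite !in_itv /= => t01 s01; rewrite /green_ext /= !clip_id. Qed.

Lemma green_ext_r s : continuous (fun t => green_ext (t, s)).
Proof.
move=> t; apply: (@cvg_comp _ _ _ (fun t => (t, s)) green_ext); last exact: green_ext_continuous.
exact: cvg_pair (@cvg_id _ (nbhs t)) (cvg_cst s).
Qed.

Lemma green_ext_l t : continuous (fun s => green_ext (t, s)).
Proof.
move=> s; apply: (@cvg_comp _ _ _ (fun s => (t, s)) green_ext); last exact: green_ext_continuous.
exact: cvg_pair (cvg_cst t) (@cvg_id _ (nbhs s)).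
Qed.

(** The slope of G(., s) to the left of s; it is recovered from the end values
    because the slope drops by 1 at s. *)
Definition slope s : R := green_ext (1, s) - green_ext (0, s) + (1 - s).

Lemma slope_continuous : continuous slope.
Proof.
move=> s; apply: cvgD; first by apply: cvgB; exact: green_ext_l.
by apply: cvgB; [exact: cvg_cst|exact: cvg_id].
Qed.

Lemma green_affine (s : R) : s \in `]0, 1[ ->
  (forall t, t \in `[0, s] -> G t s = G 0 s + slope s * t) /\
  (forall t, t \in `[s, 1] -> G t s = G 0 s + s + (slope s - 1) * t).
Proof.
move=> sI; have [_ _ /(_ s sI)[_ G2 [dl [dr [Gl Gr drl]]]]] := GB.
have /andP[s0 s1] : 0 < s < 1 by move: sI; rewrite in_itv.
have s01 : s \in `[0, 1] by rewrite in_itv /= !ltW.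
have Gc : {within `[0, 1], continuous (G ^~ s)}.
  by apply: (within_eq_continuous (@green_ext_r s)) => t t01; rewrite green_extE.
have [||c1 G1] := @affine_of_second_derivative0 R (G ^~ s) 0 s s0.
- by apply: continuous_subspaceW Gc => t /=; rewrite !in_itv /= => /andP[-> /= ?]; lra.
- move=> t; rewrite in_itv /= => /andP[t0 ts]; apply: G2; last by rewrite lt_eqF.
  by rewrite in_itv /= t0 (lt_trans ts).
have [||c2 G2'] := @affine_of_second_derivative0 R (G ^~ s) s 1 s1.
- by apply: continuous_subspaceW Gc => t /=; rewrite !in_itv /= => /andP[? ->]; rewrite andbT; lra.
- move=> t; rewrite in_itv /= => /andP[st t1]; apply: G2; last by rewrite gt_eqF.
  by rewrite in_itv /= t1 (lt_trans s0).
have dlE := left_derivative_affine s0 G1 Gl.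
have drE := right_derivative_affine s1 G2' Gr.
have Gs : G s s = G 0 s + c1 * s.
  by rewrite G1 ?mulr0 ?subr0 // in_itv /= lexx ltW.
have G1s : G 1 s = G s s - c2 * s + c2 * 1 by rewrite G2' // in_itv /= lexx ltW.
have e0 : (0 : R) \in `[0, 1] by rewrite in_itv /= lexx ler01.
have e1 : (1 : R) \in `[0, 1] by rewrite in_itv /= lexx ler01.
have c1E : slope s = c1.
  by rewrite /slope !green_extE // G1s Gs; move: drl; rewrite dlE drE => /eqP; rewrite subr_eq => /eqP ->; ring.
have c2E : slope s - 1 = c2 by rewrite c1E -dlE -drE; lra.
split=> t tI; first by rewrite G1 // c1E; ring.
by rewrite G2' // Gs c2E -c2E c1E; ring.
Qed.

(** Both affine pieces in a single formula whose terms are continuous in s, ready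
    to be integrated against g. *)
Lemma green_formula (t s : R) : t \in `[0, 1] -> s \in `]0, 1[ ->
  G t s = t * slope s + (-1 * Num.max 0 (t - s) + G 0 s).
Proof.
move=> tI sI; have [Gl Gr] := green_affine sI; move: tI; rewrite in_itv /= => /andP[t0 t1].
have [ts|st] := leP t s.
  by rewrite Gl ?in_itv /= ?t0 // max_l ?subr_le0 //; ring.
by rewrite Gr ?in_itv /= ?t1 ?ltW // max_r ?subr_ge0 ?ltW //; ring.
Qed.

Lemma boundary_col (a b c d : R) : B *m (\col_(i < 4) [:: a; b; c; d]`_i) = 0 <->
  forall i, B i 0 * a + (B i 1 * b + (B i 2%:R * c + B i 3%:R * d)) = 0.
Proof.
have E i : (B *m (\col_(i < 4) [:: a; b; c; d]`_i)) i 0 =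
    B i 0 * a + (B i 1 * b + (B i 2%:R * c + B i 3%:R * d)).
  rewrite mxE !big_ord_recl big_ord0 !mxE /= addr0.
  by congr (_ + (_ + (_ + _))); congr (B i _ * _); apply: val_inj.
split=> [H i|H]; first by rewrite -E H mxE.
by apply/matrixP => i j; rewrite ord1 E H mxE.
Qed.

(** The boundary conditions of G(., s), with the one-sided derivatives at 0 and 1
    replaced by their values: they can now be integrated in s. *)
Lemma green_boundary (s : R) : s \in `]0, 1[ ->
  forall i, B i 0 * G 0 s + (B i 1 * slope s + (B i 2%:R * G 1 s + B i 3%:R * (slope s - 1))) = 0.
Proof.
move=> sI; have [Gl Gr] := green_affine sI.
have /andP[s0 s1] : 0 < s < 1 by move: sI; rewrite in_itv.
have [_ _ /(_ s sI)[[d0 [d1 [D0 D1 BG]]] _ _]] := GB.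
have d0E : d0 = slope s by exact: right_derivative_affine s0 Gl D0.
have d1E : d1 = slope s - 1 by exact: left_derivative_affine s1 Gr D1.
by move/boundary_col: BG; rewrite d0E d1E.
Qed.

Section Representation.
Variables (g u : R -> R).
Hypothesis gc : continuous g.
Hypothesis uE : forall t : R, t \in `[0, 1] -> u t = \int[mu]_(s in `[0, 1]) (G t s * g s).

Let U0 := \int[mu]_(s in `[0, 1]) (green_ext (0, s) * g s).
Let C := \int[mu]_(s in `[0, 1]) (slope s * g s).
Let Q t : R := t * C + (-1 * moment g t + U0).

Let e0 : (0 : R) \in `[0, 1]. Proof. by rewrite in_itv /= lexx ler01. Qed.
Let e1 : (1 : R) \in `[0, 1]. Proof. by rewrite in_itv /= lexx ler01. Qed.

Let oo_cc (s : R) : s \in `]0, 1[ -> s \in `[0, 1 : R].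
Proof. by rewrite !in_itv /= => /andP[/ltW-> /ltW->]. Qed.

Let max_continuous t : continuous (fun s : R => Num.max 0 (t - s)).
Proof.
by move=> s; apply: cvg_maxr; [exact: cvg_cst|apply: cvgB; [exact: cvg_cst|exact: cvg_id]].
Qed.

Let mul_continuous (f h : R -> R) : continuous f -> continuous h -> continuous (fun s => f s * h s).
Proof. by move=> fc hc s; apply: cvgM; [exact: fc|exact: hc]. Qed.

(** The integrated form of green_formula. *)
Lemma representation_eq (t : R) : t \in `[0, 1] -> u t = Q t.
Proof.
move=> tI; rewrite uE //.
have hc : continuous (fun s => -1 * Num.max 0 (t - s) + green_ext (0, s)).
  by move=> s; apply: cvgD; [apply: cvgMr; exact: max_continuous|exact: green_ext_l].
have -> : \int[mu]_(s in `[0, 1]) (G t s * g s) =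
    \int[mu]_(s in `[0, 1]) ((t * slope s + (-1 * Num.max 0 (t - s) + green_ext (0, s))) * g s).
  transitivity (\int[mu]_(s in `[0, 1]) (green_ext (t, s) * g s)).
    by apply: eq_Rintegral => s; rewrite inE /= => sI; rewrite green_extE.
  apply: eq_Rintegral_oo.
  - by apply: continuous_itv_integrable; apply: mul_continuous => //; exact: green_ext_l.
  - apply: continuous_itv_integrable; apply: mul_continuous => // s.
    by apply: cvgD; [apply: cvgMr; exact: slope_continuous|exact: hc].
  - by move=> s sI; rewrite (green_extE tI (oo_cc sI)) (green_extE e0 (oo_cc sI)) green_formula.
rewrite Rintegral_lincomb //; last exact: slope_continuous.
by rewrite Rintegral_lincomb ?momentE //; exact: green_ext_l.
Qed.

Let is_derive_Q (t : R) : -1 < t -> is_derive t 1 Q (C - (primitive_from g t - primitive_from g 0)).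
Proof.
move=> t1; have dm := is_deriveZ (-1) (is_derive_moment gc t1).
have := is_deriveD (is_deriveM (is_derive_id t (1 : R)) (is_derive_cst C t 1))
  (is_deriveD dm (is_derive_cst U0 t 1)).
move=> H; apply: (is_derive_eq H); rewrite /cst /= /GRing.scale /=; ring.
Qed.

Lemma representation_twice_derivable (t : R) : t \in `]0, 1[ ->
  twice_derivable u t /\ (u^`(2))%classic t = - g t.
Proof.
have near_oo (t' : R) : t' \in `]0, 1[ -> \forall x \near t', x \in `]0, 1[.
  by move=> t'I; apply: near_in_itvoo.
have du (t' : R) : t' \in `]0, 1[ ->
    is_derive t' 1 u (C - (primitive_from g t' - primitive_from g 0)).
  move=> t'I; apply: (near_eq_is_derive _ (is_derive_Q _)).
    by apply: filterS (near_oo _ t'I) => x xI; rewrite representation_eq // oo_cc.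
  by move: t'I; rewrite in_itv /= => /andP[? _]; lra.
move=> tI; have t1 : -1 < t by move: tI; rewrite in_itv /= => /andP[? _]; lra.
have ddu : is_derive t 1 (u^`())%classic (- g t).
  have d := is_deriveB (is_derive_cst C t 1)
    (is_deriveB (is_derive_primitive gc t1) (is_derive_cst (primitive_from g 0) t 1)).
  apply: (near_eq_is_derive _ (is_derive_eq d _)); last by rewrite subr0 sub0r.
  apply: filterS (near_oo _ tI) => x xI.
  by have [_ ] := du x xI; rewrite derive1E => ->.
split; last by have [_ ] := ddu; rewrite -derive1E.
by split; [have [] := du t tI|have [] := ddu].
Qed.

(** The one-sided derivatives of u at 0 and 1 are integrals of those of G(., s),
    so each boundary condition of u is the integral over s of that of G(., s). *)
Lemma representation_boundary : boundary_conditions B u.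
Proof.
have I01 (t : R) : t \in `[0, 1] -> Q t = u t by move=> tI; rewrite representation_eq.
exists C, (C - (primitive_from g 1 - primitive_from g 0)); split.
- apply: (right_derivative_eq ltr01 I01); apply: is_derive_right.
  have := @is_derive_Q 0; rewrite subrr subr0; apply; lra.
- by apply: (left_derivative_eq ltr01 I01); apply: is_derive_left; apply: is_derive_Q; lra.
have e01 : -1 <= (0 : R) <= 1 by apply/andP; split; lra.
have -> : C - (primitive_from g 1 - primitive_from g 0) =
    \int[mu]_(s in `[0, 1]) ((-1 * 1 + slope s) * g s).
  have cst_c : continuous (cst 1 : R -> R) by move=> s; exact: cvg_cst.
  rewrite (Rintegral_lincomb _ _ _ cst_c slope_continuous gc).
  have := Rintegral_split gc e01; rewrite -!/(primitive_from g _) => ->.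
  have -> : \int[mu]_(s in `[0, 1]) (cst 1 s * g s) = \int[mu]_(s in `[0, 1]) g s.
    by apply: eq_Rintegral => s _; rewrite /= mul1r.
  rewrite -/C; lra.
have uG t : t \in `[0, 1] -> u t = \int[mu]_(s in `[0, 1]) (green_ext (t, s) * g s).
  by move=> tI; rewrite uE //; apply: eq_Rintegral => s; rewrite inE /= => sI; rewrite green_extE.
rewrite !uG //; apply/boundary_col => i.
have sc : continuous (fun s => -1 * 1 + slope s : R).
  by move=> s; apply: cvgD; [exact: cvg_cst|exact: slope_continuous].
have B3 : \int[mu]_(s in `[0, 1]) ((B i 3%:R * (-1 * 1 + slope s) + 0) * g s) =
    B i 3%:R * \int[mu]_(s in `[0, 1]) ((-1 * 1 + slope s) * g s).
  have cst_c : continuous (cst 0 : R -> R) by move=> s; exact: cvg_cst.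
  rewrite (Rintegral_lincomb _ _ _ sc cst_c gc).
  rewrite [X in _ + X](_ : _ = 0) ?addr0 //.
  transitivity (\int[mu]_(s in `[0, 1]) (0 : R)); last by rewrite Rintegral_cst // mul0r.
  by apply: eq_Rintegral => s _; rewrite /= mul0r.
have c3 : continuous (fun s => B i 3%:R * (-1 * 1 + slope s) + 0 : R).
  by move=> s; apply: cvgD; [apply: cvgMr; exact: sc|exact: cvg_cst].
rewrite -B3 -Rintegral_lincomb //; last exact: green_ext_l.
have c2 : continuous (fun s => B i 2%:R * green_ext (1, s) +
    (B i 3%:R * (-1 * 1 + slope s) + 0) : R).
  by move=> s; apply: cvgD; [apply: cvgMr; exact: green_ext_l|exact: c3].
rewrite -Rintegral_lincomb //; last exact: slope_continuous.
have c1 : continuous (fun s => B i 1 * slope s + (B i 2%:R * green_ext (1, s) +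
    (B i 3%:R * (-1 * 1 + slope s) + 0)) : R).
  by move=> s; apply: cvgD; [apply: cvgMr; exact: slope_continuous|exact: c2].
rewrite -Rintegral_lincomb //; last exact: green_ext_l.
transitivity (\int[mu]_(s in `[0, 1]) (0 : R)); last by rewrite Rintegral_cst // mul0r.
apply: eq_Rintegral_oo.
- apply: continuous_itv_integrable; apply: mul_continuous => // s.
  by apply: cvgD; [apply: cvgMr; exact: green_ext_l|exact: c1].
- by apply: continuous_itv_integrable => s; exact: cvg_cst.
move=> s sI; have := green_boundary sI i.
rewrite (green_extE e0 (oo_cc sI)) (green_extE e1 (oo_cc sI)) => H.
by rewrite [X in X * _](_ : _ = 0) ?mul0r // -[RHS]H; ring.
Qed.

End Representation.
End Green.

(** * The nonlocal functional *)

Lemma eq_Rintegral_bndo (R : realType) (a r : R) (f g : R -> R) :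
  measurable_fun (`[a, r[ : set R) f -> (forall s, s \in `[a, r[ -> f s = g s) ->
  \int[lebesgue_measure]_(s in `[a, r]) f s = \int[lebesgue_measure]_(s in `[a, r]) g s.
Proof.
move=> mf fg; rewrite /Rintegral -!integral_itv_bndo_bndc.
- by congr fine; apply: eq_integral => s; rewrite inE /= => sI; rewrite fg.
- apply/measurable_EFinP; apply: eq_measurable_fun mf => s; rewrite inE /= => sI; exact: fg.
- exact/measurable_EFinP.
Qed.

Section NonlocalFunctional.
Variables (R : realType) (b p : R -> R) (pm pp : R).
Notation mu := (@lebesgue_measure R).
Notation I01 := (`[0, 1]%classic : set R).
Hypothesis b_ge0 : forall t : R, t \in `]0, 1] -> 0 <= b t.
Hypothesis b_L1 : mu.-integrable `]0, 1] (EFin \o b).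
Hypothesis b_neq0 : convol b (cst 1) 1 != 0.
Hypothesis p_cont : {within `[0, 1], continuous p}.
Hypothesis pm_gt0 : 0 < pm.
Hypothesis p_bounds : forall t : R, t \in `[0, 1] -> pm <= p t /\ p t <= pp.

(** b is only controlled on (0, 1], and its reflection on [0, 1); the value at
    the remaining endpoint is arbitrary and is replaced by 0. *)
Definition reflected (k : R -> R) : R -> R := (fun s => k (1 - s)) \_ `[0, 1[.

Lemma reflectedE k (s : R) : s \in `[0, 1[ -> reflected k s = k (1 - s).
Proof. by move=> sI; rewrite /reflected patchE mem_set. Qed.

Lemma reflected_integrable (k : R -> R) (D : set R) : measurable D ->
  mu.-integrable `]0, 1] (EFin \o k) -> mu.-integrable D (EFin \o reflected k).
Proof.
move=> mD /integrable_reflect ik; apply: (@integrableS _ _ _ mu setT) => //.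
by rewrite /reflected -restrict_EFin; apply/integrable_restrict => //; rewrite setTI.
Qed.

Lemma reflected_ge0 k s : (forall t : R, t \in `]0, 1] -> 0 <= k t) -> 0 <= reflected k s.
Proof.
move=> k0; rewrite /reflected patchE; case: ifPn => // /[!inE] /=; rewrite in_itv /= => /andP[? ?].
by apply: k0; rewrite in_itv /=; apply/andP; split; lra.
Qed.

Lemma reflected_integral (k h : R -> R) (a r : R) : mu.-integrable `]0, 1] (EFin \o k) ->
  0 <= a -> r <= 1 -> measurable_fun (`[a, r] : set R) h ->
  \int[mu]_(s in `[a, r]) (k (1 - s) * h s) = \int[mu]_(s in `[a, r]) (reflected k s * h s).
Proof.
move=> ik a0 r1 mh; apply/esym; apply: eq_Rintegral_bndo.
  apply: measurable_funM.
    by have [/measurable_EFinP] :=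
      integrableP _ _ _ (@reflected_integrable k _ (measurable_itv `[a, r[) ik).
  by apply: measurable_funS mh => // s /=; rewrite !in_itv /= => /andP[-> /ltW].
move=> s; rewrite in_itv /= => /andP[as_ sr]; rewrite reflectedE // in_itv /=.
by rewrite (le_trans a0) // (lt_le_trans sr).
Qed.

Lemma reflected_integral1 (k : R -> R) (a r : R) : mu.-integrable `]0, 1] (EFin \o k) ->
  0 <= a -> r <= 1 ->
  \int[mu]_(s in `[a, r]) k (1 - s) = \int[mu]_(s in `[a, r]) reflected k s.
Proof.
move=> ik a0 r1; transitivity (\int[mu]_(s in `[a, r]) (k (1 - s) * cst 1 s)).
  by apply: eq_Rintegral => s _; rewrite /= mulr1.
by rewrite reflected_integral //; apply: eq_Rintegral => s _; rewrite /= mulr1.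
Qed.

Lemma convol1E (k : R -> R) : mu.-integrable `]0, 1] (EFin \o k) ->
  convol k (cst 1) 1 = \int[mu]_(s in `[0, 1]) reflected k s.
Proof.
move=> ik; rewrite /convol reflected_integral //.
by apply: eq_Rintegral => s _; rewrite /= mulr1.
Qed.

Lemma convol1_gt0 : 0 < convol b (cst 1) 1.
Proof.
rewrite lt_neqAle eq_sym b_neq0 /= convol1E //.
by apply: Rintegral_ge0 => s _; exact: reflected_ge0.
Qed.

Let W := convol b (cst 1) 1.
Let w := reflected b.

Let p_measurable : measurable_fun I01 p.
Proof. exact: subspace_continuous_measurable_fun. Qed.

Let p_gt0 (t : R) : t \in `[0, 1] -> 0 < p t.
Proof. by move=> /p_bounds[+ _]; exact: lt_le_trans. Qed.

Lemma nonlocalE (u : R -> R) : measurable_fun I01 u ->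
  nonlocal b p u = \int[mu]_(s in `[0, 1]) (w s * u s `^ p s).
Proof.
by move=> mu_; rewrite /nonlocal /convol reflected_integral //; exact: measurable_powR_var.
Qed.

Let w_integrable (D : set R) : measurable D -> mu.-integrable D (EFin \o w).
Proof. by move=> mD; exact: reflected_integrable. Qed.

Let scaled_integrable (D : set R) (k : R) : measurable D ->
  mu.-integrable D (EFin \o (fun s => w s * k)).
Proof.
move=> mD; apply: (@bounded_integrable _ _ _ mu D w (cst k) `|k|) => //.
exact: w_integrable.
Qed.

Let powR_integrable (u : R -> R) (c : R) : measurable_fun I01 u ->
  (forall s : R, s \in `[0, 1] -> 0 <= u s <= c) ->
  mu.-integrable `[0, 1] (EFin \o (fun s => w s * u s `^ p s)).
Proof.
move=> mu_ uc; apply: (@bounded_integrable _ _ _ mu _ w (fun s => u s `^ p s)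
  (Num.max (c `^ pp) (c `^ pm))) => //.
- exact: w_integrable.
- exact: measurable_powR_var.
move=> s sI; rewrite ger0_norm ?powR_ge0 //; apply: powR_var_le => //.
  by apply/andP; exact: p_bounds.
exact: uc.
Qed.

Lemma nonlocal_le (u : R -> R) (c : R) : measurable_fun I01 u ->
  (forall s : R, s \in `[0, 1] -> 0 <= u s <= c) ->
  nonlocal b p u <= Num.max (c `^ pp) (c `^ pm) * W.
Proof.
move=> mu_ uc; rewrite nonlocalE // /W convol1E // mulrC -RintegralZr //; last exact: w_integrable.
apply: le_Rintegral => //.
- exact: powR_integrable uc.
- exact: scaled_integrable.
move=> s sI; rewrite ler_wpM2l ?reflected_ge0 //; apply: powR_var_le => //.
  by apply/andP; exact: p_bounds.
exact: uc.
Qed.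

Lemma nonlocal_ge (u : R -> R) (c a r k : R) : measurable_fun I01 u ->
  (forall s : R, s \in `[0, 1] -> 0 <= u s <= c) -> 0 <= a -> r <= 1 -> 0 <= k ->
  (forall s : R, s \in `[a, r] -> k <= u s `^ p s) ->
  k * \int[mu]_(s in `[a, r]) b (1 - s) <= nonlocal b p u.
Proof.
move=> mu_ uc a0 r1 k0 ku; rewrite nonlocalE //.
have sub : `[a, r] `<=` `[0, 1 : R].
  by move=> s /=; rewrite !in_itv /= => /andP[? ?]; apply/andP; split; lra.
have pi := powR_integrable mu_ uc.
apply: (@le_trans _ _ (\int[mu]_(s in `[a, r]) (w s * u s `^ p s))); last first.
  by apply: Rintegral_subset => // s _; rewrite mulr_ge0 ?powR_ge0 ?reflected_ge0.
rewrite reflected_integral1 // mulrC -RintegralZr //; last exact: w_integrable.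
apply: le_Rintegral => //.
- exact: scaled_integrable.
- exact: integrableS pi.
by move=> s sI; rewrite ler_wpM2l ?reflected_ge0 ?ku.
Qed.

(** The functions are uniformly bounded, so a multiple of b dominates. *)
Lemma nonlocal_cvg (u_ : nat -> R -> R) (u : R -> R) (c : R) :
  (forall n, measurable_fun I01 (u_ n)) ->
  measurable_fun I01 u ->
  (forall n (s : R), s \in `[0, 1] -> 0 <= u_ n s <= c) ->
  (forall s : R, s \in `[0, 1] -> u_ n s @[n --> \oo] --> u s) ->
  nonlocal b p (u_ n) @[n --> \oo] --> nonlocal b p u.
Proof.
move=> mu_ mu0 uc uu; rewrite nonlocalE //.
under eq_fun do rewrite nonlocalE //.
have mw (D : set R) : measurable D -> measurable_fun D w.
  by move=> mD; have [/measurable_EFinP] := integrableP _ _ _ (w_integrable mD).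
apply: (@Rintegral_dominated _ _ _ mu _ _ _ (fun s => w s * Num.max (c `^ pp) (c `^ pm))) => //.
- by move=> n; apply: measurable_funM; [exact: mw|apply: measurable_powR_var => //; exact: mu_].
- exact: scaled_integrable.
- move=> n s sI; rewrite ger0_norm ?mulr_ge0 ?powR_ge0 ?reflected_ge0 //.
  rewrite ler_wpM2l ?reflected_ge0 //; apply: powR_var_le => //; last exact: uc.
  by apply/andP; exact: p_bounds.
- move=> s sI; apply: cvgMr; apply: powR_cvg; [exact: p_gt0| |exact: uu].
  by move=> n; have /andP[] := uc n s sI.
Qed.

(** Positivity of b almost everywhere enters here: b^{1/q} and the power
    (q-1)/q of b^{1/(1-q)} are reciprocal only where b > 0. *)
Lemma interval_length_le (a r q : R) : 0 <= a -> a < r -> r <= 1 -> 1 < q ->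
  {ae mu, forall t : R, t \in `]0, 1] -> 0 < b t} ->
  mu.-integrable `]0, 1] (EFin \o (fun t => b t `^ (1 / (1 - q)))) ->
  r - a <= (\int[mu]_(s in `[a, r]) b (1 - s)) `^ q^-1 *
    (convol (fun t => b t `^ (1 / (1 - q))) (cst 1) 1) `^ ((q - 1) / q).
Proof.
move=> a0 ar r1 q1 bpos biq.
set v := fun t => b t `^ (1 / (1 - q)).
have v0 (t : R) : t \in `]0, 1] -> 0 <= v t by rewrite powR_ge0.
have sub (s : R) : s \in `[a, r[ -> s \in `[0, 1[.
  by rewrite !in_itv /= => /andP[? ?]; apply/andP; split; lra.
have ae1 : {ae mu, forall s, s \in `[a, r[ ->
    w s `^ q^-1 * reflected v s `^ ((q - 1) / q) = 1}.
  apply: negligibleS (ae_reflect bpos); apply: subsetC => s bs sI.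
  have sI' := sub s sI.
  rewrite /w !reflectedE // /v -powRrM.
  have {}bs : 0 < b (1 - s).
    by apply: bs; move: sI'; rewrite !in_itv /= => /andP[? ?]; apply/andP; split; lra.
  have E : q^-1 + 1 / (1 - q) * ((q - 1) / q) = 0.
    have q0 : q != 0 by apply: lt0r_neq0; lra.
    have q1' : 1 - q != 0 by rewrite lt_eqF //; lra.
    by field; rewrite q0.
  rewrite -powRD; first by rewrite E powRr0.
  by rewrite (gt_eqF bs) implybT.
have <- : fine (mu `[a, r[%classic) = r - a by rewrite lebesgue_measure_itv /= lte_fin ar.
have H : fine (mu `[a, r[%classic) <= (\int[mu]_(s in `[a, r[) w s) `^ q^-1 *
    (\int[mu]_(s in `[a, r[) reflected v s) `^ ((q - 1) / q).
  apply: (@hoelder_reciprocal _ _ _ mu) => //.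
  - exact: w_integrable.
  - exact: reflected_integrable.
  - by move=> s _; exact: reflected_ge0.
  - by move=> s _; exact: reflected_ge0.
apply: (le_trans H).
apply: ler_pM; [exact: powR_ge0|exact: powR_ge0| |].
  rewrite (_ : \int[mu]_(s in `[a, r]) b (1 - s) = \int[mu]_(s in `[a, r[) w s) //.
  by rewrite reflected_integral1 // Rintegral_itv_bndo_bndc //; exact: w_integrable.
apply: ge0_ler_powR; rewrite ?nnegrE.
- by apply: divr_ge0; [rewrite subr_ge0 ltW|apply: ltW; apply: lt_trans q1].
- by apply: Rintegral_ge0 => s _; exact: reflected_ge0.
- by rewrite convol1E //; apply: Rintegral_ge0 => s _; exact: reflected_ge0.
rewrite convol1E //; apply: Rintegral_subset => //.
- by move=> s /= /sub; rewrite !in_itv /= => /andP[-> /ltW].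
- exact: reflected_integrable.
- by move=> s _; exact: reflected_ge0.
Qed.

End NonlocalFunctional.

(** * Green's operator maps into the cone *)

Section Extrema.
Context {R : realType} {T : Type}.
Implicit Types (D : set T) (h : T -> R) (c : R).

Lemma max_on_ge D h c x : (forall y, D y -> h y <= c) -> D x -> h x <= max_on D h.
Proof. by move=> hc Dx; apply: ub_le_sup; [exists c => _ [y Dy <-]; exact: hc|exists x]. Qed.

Lemma max_on_le D h c : D !=set0 -> (forall y, D y -> h y <= c) -> max_on D h <= c.
Proof.
move=> [x Dx] hc; apply: ge_sup; first by exists (h x), x.
by move=> _ [y Dy <-]; exact: hc.
Qed.

Lemma min_on_le D h c x : (forall y, D y -> c <= h y) -> D x -> min_on D h <= h x.
Proof. by move=> hc Dx; apply: ge_inf; [exists c => _ [y Dy <-]; exact: hc|exists x]. Qed.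

Lemma min_on_ge D h c : D !=set0 -> (forall y, D y -> c <= h y) -> c <= min_on D h.
Proof.
move=> [x Dx] hc; apply: lb_le_inf; first by exists (h x), x.
by move=> _ [y Dy <-]; exact: hc.
Qed.

End Extrema.

Lemma continuous_rect_bounded (R : realType) (h : R * R -> R) (a b c d : R) :
  a <= b -> c <= d -> {within `[a, b] `*` `[c, d], continuous h} ->
  exists M, forall x y : R, x \in `[a, b] -> y \in `[c, d] -> h (x, y) <= M.
Proof.
move=> ab cd hc.
have ne : `[a, b] `*` `[c, d] !=set0.
  by exists (a, c); split; rewrite /= in_itv /= lexx.
have cp : compact (`[a, b] `*` `[c, d]).
  by apply: compact_setX; exact: segment_compact.
have [z _ zmax] := compact_EVT_max ne cp hc.
by exists (h z) => x y xI yI; apply: zmax; rewrite inE.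
Qed.

Section ConeImage.
Variables (R : realType) (B : 'M[R]_(2, 4)) (G : R -> R -> R) (alpha beta eta0 : R).
Notation mu := (@lebesgue_measure R).
Notation I01 := (`[0, 1]%classic : set R).
Hypothesis GB : is_green_function B G.
Hypothesis G_ge0 : forall t s : R, t \in `[0, 1] -> s \in `[0, 1] -> 0 <= G t s.

Lemma green_ext_ge0 z : 0 <= green_ext G z.
Proof. by apply: G_ge0; rewrite in_itv /= clip_itv. Qed.

Lemma green_ext_bounded : exists2 Gam, 0 < Gam & forall z, green_ext G z <= Gam.
Proof.
have [M Mb] := @continuous_rect_bounded R (green_ext G) 0 1 0 1 ler01 ler01
  (continuous_subspaceT (green_ext_continuous GB)).
exists (`|M| + 1); first by rewrite ltr_wpDl.
move=> [x y]; have := Mb (clip 0 1 x) (clip 0 1 y).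
rewrite !in_itv /= !clip_itv // => /(_ isT isT) H.
rewrite /green_ext /= in H *; rewrite !(@clip_id _ _ _ (clip 0 1 _)) ?clip_itv // in H.
by apply: le_trans H _; rewrite (le_trans (ler_norm _)) // lerDl.
Qed.

Lemma green_ext_measurable : measurable_fun setT (green_ext G).
Proof.
have := @measurable_caratheodory R _ (R * R)%type (fun z => clip 0 1 z.1)
  (fun t z => green_ext G (t, z.2)).
have -> : (fun z : R * R => green_ext G (clip 0 1 z.1, z.2)) = green_ext G.
  by apply/funext => z; rewrite /green_ext /= (@clip_id _ _ _ (clip 0 1 _)) ?clip_itv.
have clip_m : measurable_fun setT (clip 0 1 : R -> R).
  by apply: continuous_measurable_fun; exact: clip_continuous.
apply.
- exact: (measurableT_comp clip_m measurable_fst).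
- by move=> z; have /andP[] := @clip_itv R 0 1 z.1 ler01.
- move=> t; apply: (@measurableT_comp _ _ _ _ _ _ (fun s => green_ext G (t, s))) measurable_snd.
  by apply: continuous_measurable_fun; exact: (green_ext_l GB).
- by move=> z; exact: (green_ext_r GB).
Qed.

Variables (g u : R -> R) (c : R).
Hypothesis g_measurable : measurable_fun setT g.
Hypothesis g_itv : forall s, 0 <= g s <= c.
Hypothesis uE : forall t : R, t \in `[0, 1] -> u t = \int[mu]_(s in `[0, 1]) (G t s * g s).

Let uE' (t : R) : t \in `[0, 1] -> u t = \int[mu]_(s in `[0, 1]) (green_ext G (t, s) * g s).
Proof.
by move=> tI; rewrite uE //; apply: eq_Rintegral => s; rewrite inE /= => sI; rewrite green_extE.
Qed.

Lemma green_image_integrable t :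
  mu.-integrable `[0, 1] (EFin \o (fun s => green_ext G (t, s) * g s)).
Proof.
apply: (@bounded_integrable _ _ _ mu I01 (fun s => green_ext G (t, s)) g c) => //.
- by apply: continuous_itv_integrable; exact: (green_ext_l GB).
- exact: measurable_funTS.
- by move=> s _; have /andP[g0 gc] := g_itv s; rewrite ger0_norm.
Qed.

Lemma green_image_ge0 (t : R) : t \in `[0, 1] -> 0 <= u t.
Proof.
move=> tI; rewrite uE'//; apply: Rintegral_ge0 => s _.
by rewrite mulr_ge0 ?green_ext_ge0 //; case/andP: (g_itv s).
Qed.

Hypothesis u_cont : {within `[0, 1], continuous u}.

Lemma green_image_bounded : exists M, forall t : R, t \in `[0, 1] -> `|u t| <= M.
Proof.
have [m _ mmax] := EVT_max ler01 u_cont.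
by exists (u m) => t tI; rewrite ger0_norm ?green_image_ge0 ?mmax.
Qed.

Lemma maxnorm_ge (t : R) : t \in `[0, 1] -> u t <= maxnorm u.
Proof.
move=> tI; have [M Mb] := green_image_bounded.
apply: le_trans (ler_norm _) _.
by apply: (@max_on_ge _ _ _ (fun t => `|u t|) M).
Qed.

Lemma maxnorm_le k : (forall t : R, t \in `[0, 1] -> u t <= k) -> maxnorm u <= k.
Proof.
move=> uk; apply: max_on_le; first by exists 0; rewrite /= in_itv /= lexx ler01.
by move=> t tI; rewrite ger0_norm ?green_image_ge0 ?uk.
Qed.

Let oo_cc (s : R) : s \in `]0, 1[ -> s \in `[0, 1].
Proof. by rewrite !in_itv /= => /andP[/ltW-> /ltW->]. Qed.

Lemma Gmax_ge (t s : R) : t \in `[0, 1] -> s \in `[0, 1] -> G t s <= Gmax G s.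
Proof.
move=> tI sI; have [Gam _ Gb] := green_ext_bounded.
by apply: (@max_on_ge _ _ _ (G ^~ s) Gam) => // x xI; rewrite -(@green_extE _ G).
Qed.

Section Harnack.
Hypothesis alpha_ge0 : 0 <= alpha.
Hypothesis beta_le1 : beta <= 1.
Hypothesis eta0_gt0 : 0 < eta0.
Hypothesis G_min : forall s : R, s \in `[0, 1] ->
     eta0 * Gmax G s <= min_on `[alpha, beta] (G ^~ s).

Let sub_itv (t : R) : t \in `[alpha, beta] -> t \in `[0, 1].
Proof.
by rewrite !in_itv /= => /andP[a_t tb]; rewrite (le_trans alpha_ge0 a_t) (le_trans tb beta_le1).
Qed.

(** The lower bound of G on [alpha, beta] by its maximum in t passes to the
    integrals against a nonnegative g. *)
Lemma harnack (t : R) : t \in `[alpha, beta] -> eta0 * maxnorm u <= u t.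
Proof.
move=> tI; rewrite -ler_pdivlMl //; apply: maxnorm_le => tau tauI.
rewrite ler_pdivlMl //.
have tI' := sub_itv tI.
rewrite !uE' // -RintegralZl //; last exact: green_image_integrable.
apply: le_Rintegral => //.
- have := @integrableZl _ _ _ mu _ _ eta0 _ (green_image_integrable tau).
  by apply.
- exact: green_image_integrable.
move=> s sI; rewrite mulrA ler_wpM2r //; first by case/andP: (g_itv s).
rewrite !green_extE //; apply: le_trans (_ : eta0 * Gmax G s <= _).
  by rewrite ler_pM2l // Gmax_ge.
apply: le_trans (G_min sI) _; apply: (@min_on_le _ _ _ (G ^~ s) 0) => // x xI.
by apply: G_ge0 => //; exact: sub_itv.
Qed.

End Harnack.

Section MeanValue.
Hypothesis Gmax_gt0 : forall s : R, s \in `]0, 1[ -> 0 < Gmax G s.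

Lemma C0_le (s : R) : s \in `]0, 1[ ->
  C0_of G * Gmax G s <= \int[mu]_(t in `[0, 1]) green_ext G (t, s).
Proof.
move=> sI; rewrite -ler_pdivlMr ?Gmax_gt0 // mulrC.
have -> : \int[mu]_(t in `[0, 1]) green_ext G (t, s) = \int[mu]_(t in `[0, 1]) G t s.
  by apply: eq_Rintegral => t; rewrite inE /= => tI; rewrite green_extE // oo_cc.
apply: ge_inf; last by exists s.
exists 0 => _ [s' /= s'I <-]; rewrite mulr_ge0 ?invr_ge0 ?(ltW (Gmax_gt0 _)) //.
by apply: Rintegral_ge0 => t tI; apply: G_ge0 => //; exact: oo_cc.
Qed.

Hypothesis C0_ge0 : 0 <= C0_of G.

(** By Fubini the mean of u is the integral of g against the means of G(., s),
    which are at least C0 Gmax(s) >= C0 G(tau, s) for every tau. *)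
Lemma mean_value_ge : C0_of G * maxnorm u <= \int[mu]_(t in `[0, 1]) u t.
Proof.
have [C0E|C0pos] := eqVneq (C0_of G) 0.
  by rewrite C0E mul0r; apply: Rintegral_ge0 => t tI; exact: green_image_ge0.
have {}C0pos : 0 < C0_of G by rewrite lt_neqAle eq_sym C0pos.
rewrite -ler_pdivlMl //; apply: maxnorm_le => tau tauI; rewrite ler_pdivlMl //.
(* Fubini is used on the whole plane, for the restriction to the square. *)
pose h (z : R * R) := (green_ext G z * g z.2)%:E.
pose f := h \_ (I01 `*` I01).
have h0 z : (0 <= h z)%E.
  by rewrite lee_fin mulr_ge0 ?green_ext_ge0 //; case/andP: (g_itv z.2).
have f0 z : (0 <= f z)%E by rewrite /f patchE; case: ifP.
have mh : measurable_fun setT h.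
  apply/measurable_EFinP; apply: measurable_funM; first exact: green_ext_measurable.
  exact: (measurableT_comp g_measurable measurable_snd).
have mf : measurable_fun setT f.
  apply/(measurable_restrictT _ _).1; first exact: measurableX.
  exact: measurable_funTS.
have fub : (\int[mu]_x \int[mu]_y f (x, y) = \int[mu]_y \int[mu]_x f (x, y))%E.
  exact: (@fubini_tonelli _ _ _ _ _ mu mu f mf f0).
have ui : mu.-integrable I01 (EFin \o u).
  apply: continuous_compact_integrable; [exact: segment_compact|exact: u_cont].
have fin_u : ((\int[mu]_(x in I01) (u x)%:E) \is a fin_num)%E by exact: integrable_fin_num.
have slice_x x y : f (x, y) = if x \in I01 then ((fun y => h (x, y)) \_ I01) y else 0%E.
  by rewrite /f !patchE in_setX /=; case: (x \in I01).
have slice_y x y : f (x, y) = if y \in I01 then ((fun x => h (x, y)) \_ I01) x else 0%E.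
  by rewrite /f !patchE in_setX /= andbC; case: (y \in I01).
have inner_y x : (\int[mu]_y f (x, y) = ((EFin \o u) \_ I01) x)%E.
  rewrite patchE; case: ifPn => xI; last first.
    by apply: integral0_eq => y _; rewrite slice_x (negPf xI).
  under eq_integral do rewrite slice_x xI.
  rewrite -integral_mkcond /= uE'; last by move: xI; rewrite inE.
  rewrite fineK; first by [].
  by apply: integrable_fin_num => //; exact: green_image_integrable.
have inner_x y : y \in I01 ->
    (\int[mu]_x f (x, y) = ((\int[mu]_(x in `[0, 1]) green_ext G (x, y)) * g y)%:E)%E.
  move=> yI; under eq_integral do rewrite slice_y yI.
  have Gi : mu.-integrable I01 (EFin \o (fun x => green_ext G (x, y))).
    by apply: continuous_itv_integrable; exact: (green_ext_r GB).
  rewrite -integral_mkcond -(RintegralZr _ _ Gi); last exact: measurable_itv.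
  rewrite fineK; first by [].
  apply: integrable_fin_num => //.
  apply: (@bounded_integrable _ _ _ mu I01 (fun x => green_ext G (x, y)) (cst (g y)) c) => //.
  by move=> x _; have /andP[g0 gc] := g_itv y; rewrite ger0_norm.
have GI : mu.-integrable `]0, 1[ (EFin \o (fun s => C0_of G * (green_ext G (tau, s) * g s))).
  apply: (@integrableS _ _ _ mu I01) => //.
  by have := @integrableZl _ _ _ mu _ _ (C0_of G) _ (green_image_integrable tau); apply.
rewrite (uE' tauI) -(RintegralZl _ _ (green_image_integrable tau)); last exact: measurable_itv.
rewrite -Rintegral_oo; last first.
  by have := @integrableZl _ _ _ mu _ _ (C0_of G) _ (green_image_integrable tau); apply.
rewrite -lee_fin fineK; last exact: integrable_fin_num.
rewrite [leRHS]fineK // [leRHS]integral_mkcond.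
under [leRHS]eq_integral do rewrite -inner_y.
rewrite fub [leLHS]integral_mkcond; apply: ge0_le_integral; first exact: measurableT.
- move=> y _; rewrite patchE; case: ifP => _; last exact: lexx.
  rewrite lee_fin; apply: mulr_ge0; first exact: C0_ge0.
  by apply: mulr_ge0; [exact: green_ext_ge0|case/andP: (g_itv y)].
- apply/(measurable_restrictT _ _).1 => //.
  by have [] := integrableP _ _ _ GI.
- exact: (@measurable_fun_fubini_tonelli_G _ _ _ _ _ mu f mf f0).
move=> y _; rewrite patchE; case: ifPn => [|_]; last exact: integral_ge0.
rewrite inE /= => yI; rewrite inner_x; last by rewrite inE /=; exact: oo_cc.
rewrite lee_fin mulrA; apply: ler_wpM2r; first by case/andP: (g_itv y).
apply: le_trans (C0_le yI); rewrite (ler_pM2l C0pos) (green_extE G tauI (oo_cc yI)).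
by apply: Gmax_ge; [exact: tauI|exact: oo_cc].
Qed.

End MeanValue.
End ConeImage.

(** * Regularity of the constants and of the kernel *)

Section Constants.
Variables (R : realType) (b : R -> R) (alpha beta eta0 pm q : R).
Hypothesis eta0_gt0 : 0 < eta0.
Hypothesis pm_gt0 : 0 < pm.
Hypothesis q_gt1 : 1 < q.
Let Mb := Mbar_rho b alpha beta eta0 pm q.

Let q_gt0 : 0 < q. Proof. exact: lt_trans q_gt1. Qed.

Let factor_ge0 : 0 <= 1 / eta0 * (beta - alpha) `^ (- (q / pm)).
Proof. by rewrite mulr_ge0 ?powR_ge0 // divr_ge0 // ltW. Qed.

Let base_ge0 rho : 0 <= rho `^ (1 / q) *
  (convol (fun t => b t `^ (1 / (1 - q))) (cst 1) 1) `^ ((q - 1) / q) + 1.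
Proof. by rewrite addr_ge0 // mulr_ge0 // powR_ge0. Qed.

Lemma Mbar_ge0 rho : 0 <= Mb rho.
Proof. by rewrite /Mb /Mbar_rho mulr_ge0 ?powR_ge0. Qed.

Lemma Mbar_homo rho rho' : 0 <= rho -> rho <= rho' -> Mb rho <= Mb rho'.
Proof.
move=> r0 rr; rewrite /Mb /Mbar_rho; apply: ler_wpM2l; first exact: factor_ge0.
apply: ge0_ler_powR; rewrite ?nnegrE ?base_ge0 //; first by rewrite divr_ge0 // ltW.
rewrite lerD2r ler_wpM2r ?powR_ge0 //.
apply: ge0_ler_powR; rewrite ?nnegrE //; last exact: le_trans rr.
by rewrite divr_ge0 // ltW.
Qed.

Lemma Mbar_cvg (rho_ : nat -> R) rho : (forall n, 0 <= rho_ n) ->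
  rho_ n @[n --> \oo] --> rho -> Mb (rho_ n) @[n --> \oo] --> Mb rho.
Proof.
move=> r0 rr; apply: cvgMr; apply: powR_cvg => [|n|]; first exact: divr_gt0.
  exact: base_ge0.
apply: cvgD; last exact: cvg_cst.
apply: cvgMl; apply: powR_cvg => //; exact: divr_gt0.
Qed.

Lemma m_rho_gt0 pp rho : 0 < rho -> 0 < convol b (cst 1) 1 -> 0 < m_rho b pm pp rho.
Proof.
move=> r0 W0; have x0 : 0 < rho / convol b (cst 1) 1 by exact: divr_gt0.
rewrite /m_rho /eps_rho; case: ifP => _; last by rewrite addr0 powR_gt0.
by rewrite addrC subrK powR_gt0.
Qed.

End Constants.

Lemma Rintegral_cst_unit (R : realType) (k : R) :
  \int[lebesgue_measure]_(_ in `[(0 : R), 1]) k = k /\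
  \int[lebesgue_measure]_(_ in `](0 : R), 1[) k = k.
Proof.
have m_cc : fine (lebesgue_measure (`[0, 1]%classic : set R)) = 1.
  by rewrite lebesgue_measure_itv /= lte_fin ltr01 oppr0 addr0.
have m_oo : fine (lebesgue_measure (`]0, 1[%classic : set R)) = 1.
  by rewrite lebesgue_measure_itv /= lte_fin ltr01 oppr0 addr0.
split; (rewrite Rintegral_cst; last exact: measurable_itv).
  by transitivity (k * 1); [congr (k * _); exact: m_cc|rewrite mulr1].
by transitivity (k * 1); [congr (k * _); exact: m_oo|rewrite mulr1].
Qed.

Lemma max0_lipschitz (R : realType) (a b : R) :
  `|Num.max 0 a - Num.max 0 b| <= `|a - b|.
Proof.
have [a0|a0] := leP a 0; have [b0|b0] := leP b 0.
- by rewrite subrr normr0.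
- rewrite sub0r normrN gtr0_norm // ler0_norm; lra.
- rewrite subr0 gtr0_norm // ger0_norm; lra.
- by [].
Qed.

Lemma green_lipschitz (R : realType) (B : 'M[R]_(2, 4)) (G : R -> R -> R) (Gam : R) :
  is_green_function B G -> (forall z, 0 <= green_ext G z <= Gam) ->
  forall t t' s : R, t \in `[0, 1] -> t' \in `[0, 1] -> s \in `]0, 1[ ->
  `|G t s - G t' s| <= `|t - t'| * (Gam + Gam + 2).
Proof.
move=> GB Gb t t' s tI t'I sI; rewrite (green_formula GB tI sI) (green_formula GB t'I sI).
have sl : `|slope G s| <= Gam + Gam + 1.
  have := Gb (1, s); have := Gb (0, s); rewrite /slope.
  move: sI; rewrite in_itv /= => /andP[? ?] /andP[? ?] /andP[? ?].
  by rewrite ler_norml; apply/andP; split; lra.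
have -> : t * slope G s + (-1 * Num.max 0 (t - s) + G 0 s) -
    (t' * slope G s + (-1 * Num.max 0 (t' - s) + G 0 s)) =
  (t - t') * slope G s - (Num.max 0 (t - s) - Num.max 0 (t' - s)) by ring.
apply: le_trans (ler_normB _ _) _.
rewrite normrM (_ : Gam + Gam + 2 = Gam + Gam + 1 + 1); last by ring.
rewrite mulrDr mulr1; apply: lerD; first by rewrite ler_wpM2l.
by apply: le_trans (max0_lipschitz _ _) _; rewrite (_ : t - s - (t' - s) = t - t') //; ring.
Qed.

(** * The nonlocal term on a closure *)

Section Closure.
Variables (R : realType) (b p : R -> R) (pm pp : R) (K : set (R -> R)).
Notation mu := (@lebesgue_measure R).
Notation I01 := (`[0, 1]%classic : set R).
Hypothesis b_ge0 : forall t : R, t \in `]0, 1] -> 0 <= b t.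
Hypothesis b_L1 : mu.-integrable `]0, 1] (EFin \o b).
Hypothesis p_cont : {within `[0, 1], continuous p}.
Hypothesis pm_gt0 : 0 < pm.
Hypothesis p_bounds : forall t : R, t \in `[0, 1] -> pm <= p t /\ p t <= pp.
Hypothesis K_cont : forall u, K u -> {within `[0, 1], continuous u}.
Hypothesis K_ge0 : forall u (t : R), K u -> t \in `[0, 1] -> 0 <= u t.

(** A point of the closure is a uniform limit of a sequence from the set, and
    dominated convergence carries N along this sequence. *)
Lemma closure_nonlocal_le rho u : closure_in K (Vhat K b p rho) u -> nonlocal b p u <= rho.
Proof.
move=> [Ku cl].
have near_u n : exists v, Vhat K b p rho v /\ forall t : R, t \in `[0, 1] -> `|u t - v t| < n.+1%:R^-1.
  have e0 : 0 < n.+1%:R^-1 :> R by rewrite invr_gt0.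
  pose P : set {uniform` I01 -> R} := [set h | forall y, I01 y -> `|u y - h y| < n.+1%:R^-1].
  have nP : nbhs (u : {uniform` I01 -> R}) P.
    apply/uniform_nbhs; exists [set xy | ball xy.1 n.+1%:R^-1 xy.2]; split.
      exact: entourage_ball (PosNum e0).
    by move=> h H y Iy; exact: H.
  by have [v [Vv Pv]] := cl P nP; exists v.
have /choice[v_ vP] := near_u.
have [M _ uM] := EVT_max ler01 (K_cont Ku).
have m_of v : K v -> measurable_fun I01 v.
  by move=> Kv; apply: subspace_continuous_measurable_fun => //; exact: K_cont.
have ncvg : nonlocal b p (v_ n) @[n --> \oo] --> nonlocal b p u.
  apply: (@nonlocal_cvg R b p pm pp b_ge0 b_L1 p_cont pm_gt0 p_bounds _ _ (u M + 1)).
  - by move=> n; apply: m_of; have [[]] := vP n.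
  - exact: m_of.
  - move=> n s sI; have [[Kv _] vu] := vP n; rewrite (K_ge0 Kv sI) /=.
    have := vu s sI; have := uM s sI; have n1 : n.+1%:R^-1 <= 1 :> R.
      by rewrite invf_le1 // ler1n.
    move: n1; set e := _^-1; rewrite ltr_norml => e1 us /andP[ev _].
    move: ev; rewrite ltrBrDr addrC ltrBlDr => ev.
    by apply/ltW/(lt_le_trans ev); apply: lerD.
  - move=> s sI; apply: (@cvg_dist_le _ _ harmonic) cvg_harmonic => n.
    by have [_ vu] := vP n; rewrite distrC ltW // vu.
apply: (cvgr_to_le ncvg); apply: nearW => n.
by have [[_ /ltW]] := vP n.
Qed.

End Closure.

(** * The truncated operator and its fixed point *)

Section Operator.
Variables (R : realType) (lambda : R) (A : R -> R) (f : R -> R -> R) (b p : R -> R)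
  (rho1 rho2 pm pp q : R)
  (B : 'M[R]_(2, 4)) (G : R -> R -> R) (alpha beta eta0 : R).
Notation mu := (@lebesgue_measure R).
Notation I01 := (`[0, 1]%classic : set R).
Hypothesis lambda_gt0 : 0 < lambda.
Hypothesis A_cont : {within `[0, +oo[, continuous A}.
Hypothesis f_cont : {within `[0, 1] `*` `[0, +oo[,
               continuous (fun z : R * R => f z.1 z.2)}.
Hypothesis f_ge0 : forall t x : R, t \in `[0, 1] -> x \in `[0, +oo[ -> 0 <= f t x.
Hypothesis b_ge0 : forall t : R, t \in `]0, 1] -> 0 <= b t.
Hypothesis b_L1 : mu.-integrable `]0, 1] (EFin \o b).
Hypothesis b_neq0 : convol b (cst 1) 1 != 0.
Hypothesis rho1_gt0 : 0 < rho1.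
Hypothesis rho12 : rho1 < rho2.
Hypothesis A_pos : forall t : R, t \in `[rho1, rho2] -> 0 < A t.
Hypothesis p_cont : {within `[0, 1], continuous p}.
Hypothesis pm_gt0 : 0 < pm.
Hypothesis p_bounds : forall t : R, t \in `[0, 1] -> pm <= p t /\ p t <= pp.
Hypothesis G_ge0 : forall t s : R, t \in `[0, 1] -> s \in `[0, 1] -> 0 <= G t s.
Hypothesis GB : is_green_function B G.
Hypothesis eta0_gt0 : 0 < eta0.
Hypothesis q_gt1 : 1 < q.

Let Mb := Mbar_rho b alpha beta eta0 pm q.
Let low := eta0 * m_rho b pm pp rho1.

Definition f_ext (s x : R) := f (clip 0 1 s) (Num.max 0 x).
(** The range which the bounds on the norm force on a solution u with
    N(u) = rho >= rho1.  At rho = rho1 it is the interval of condition (1). *)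
Definition truncation rho s x := Num.min (Mb rho) (Num.max (low * \1_`[alpha, beta] s) x).
Definition clipped_nonlocal u := clip rho1 rho2 (nonlocal b p u).
Definition source u s :=
  lambda / A (clipped_nonlocal u) * f_ext s (truncation (clipped_nonlocal u) s (u s)).
Definition hammerstein u t := \int[mu]_(s in `[0, 1]) (green_ext G (t, s) * source u s).

Lemma f_ext_continuous : continuous (fun z : R * R => f_ext z.1 z.2).
Proof.
have rc : continuous (fun z : R * R => (clip 0 1 z.1, Num.max 0 z.2)).
  move=> z.
  have c1 : clip 0 1 z'.1 @[z' --> z] --> clip 0 1 z.1.
    by apply: (@cvg_comp _ _ _ fst (clip 0 1) _ (nbhs z.1)); [exact: cvg_fst|exact: clip_continuous].
  have c2 : Num.max 0 z'.2 @[z' --> z] --> Num.max 0 z.2.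
    by apply: cvg_maxr; [exact: cvg_cst|exact: cvg_snd].
  exact: cvg_pair c1 c2.
apply: (continuous_retract f_cont rc) => z; split; rewrite /= in_itv /= ?clip_itv //.
by rewrite andbT le_max lexx.
Qed.

Lemma f_ext_r s : continuous (f_ext s).
Proof.
move=> x; have sx : (s, y) @[y --> x] --> (s, x).
  by exact: cvg_pair (cvg_cst s) (@cvg_id _ (nbhs x)).
exact: (cvg_comp _ _ sx (@f_ext_continuous (s, x))).
Qed.

Lemma f_ext_l x : continuous (f_ext ^~ x).
Proof.
move=> s; have sx : (y, x) @[y --> s] --> (s, x).
  by exact: cvg_pair (@cvg_id _ (nbhs s)) (cvg_cst x).
exact: (cvg_comp _ _ sx (@f_ext_continuous (s, x))).
Qed.

Lemma f_ext_ge0 s x : 0 <= f_ext s x.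
Proof. by apply: f_ge0; rewrite in_itv /= ?clip_itv // andbT le_max lexx. Qed.

Lemma f_extE (s x : R) : s \in `[0, 1] -> 0 <= x -> f_ext s x = f s x.
Proof. by rewrite in_itv /= => sI x0; rewrite /f_ext clip_id // max_r. Qed.

Lemma f_bounded M : 0 <= M ->
  exists c, forall s x : R, s \in `[0, 1] -> x \in `[0, M] -> f s x <= c.
Proof.
move=> M0; apply: (@continuous_rect_bounded R (fun z => f z.1 z.2)) => //.
by apply: continuous_subspaceW f_cont => -[s x] /= [-> /=]; rewrite !in_itv /= => /andP[->].
Qed.

Lemma f_ext_le_rect_max M s x : 0 <= M -> x <= M -> f_ext s x <= rect_max f 0 1 0 M.
Proof.
move=> M0 xM; have [c fc] := f_bounded M0.
apply: (@max_on_ge _ _ (`[0, 1] `*` `[0, M]) (fun z : R * R => f z.1 z.2) c (clip 0 1 s, Num.max 0 x)).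
  by move=> [t y] /= [tI yI]; exact: fc.
by split; rewrite /= in_itv /= ?clip_itv // le_max lexx /= ge_max M0.
Qed.

Lemma measurable_f_ext (u : R -> R) : measurable_fun setT u ->
  measurable_fun setT (fun s => f_ext s (u s)).
Proof.
move=> mu_.
have -> : (fun s => f_ext s (u s)) = (fun s => f_ext (clip 0 1 s) (u s)).
  by apply/funext => s; rewrite /f_ext (@clip_id _ _ _ (clip 0 1 s)) ?clip_itv.
apply: (@measurable_caratheodory R _ _ (clip 0 1) (fun t s => f_ext t (u s))).
- by apply: continuous_measurable_fun; exact: clip_continuous.
- by move=> s; have /andP[] := @clip_itv R 0 1 s ler01.
- move=> t; apply: (measurableT_comp _ mu_).
  by apply: continuous_measurable_fun; exact: f_ext_r.
- by move=> s; exact: f_ext_l.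
Qed.

Let le12 : rho1 <= rho2. Proof. exact: ltW. Qed.

Lemma clipped_itv u : rho1 <= clipped_nonlocal u <= rho2.
Proof. exact: clip_itv. Qed.

Let clipped_ge0 u : 0 <= clipped_nonlocal u.
Proof. by have /andP[h _] := clipped_itv u; rewrite (le_trans (ltW rho1_gt0)). Qed.

Lemma coefficient_bounded : exists2 cA, 0 < cA &
  forall u, 0 < lambda / A (clipped_nonlocal u) <= cA.
Proof.
have Ac : {within `[rho1, rho2], continuous A}.
  apply: continuous_subspaceW A_cont => t /=; rewrite !in_itv /= => /andP[t1 _].
  by rewrite andbT (le_trans (ltW rho1_gt0)).
have [m mI mmin] := EVT_min le12 Ac.
exists (lambda / A m); first by rewrite divr_gt0 ?A_pos.
move=> u; have uI : clipped_nonlocal u \in `[rho1, rho2] by rewrite in_itv /= clipped_itv.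
by rewrite divr_gt0 ?A_pos //= ler_pM2l // lef_pV2 ?posrE ?A_pos // mmin.
Qed.

Lemma truncation_le rho s x : truncation rho s x <= Mb rho.
Proof. by rewrite ge_min lexx. Qed.

Lemma source_bounded : exists2 c, 0 < c & forall u s, 0 <= source u s <= c.
Proof.
have [cA cA0 cAb] := coefficient_bounded.
have F0 : 0 <= rect_max f 0 1 0 (Mb rho2).
  apply: le_trans (f_ext_ge0 0 0) _; apply: f_ext_le_rect_max; exact: Mbar_ge0.
exists (cA * rect_max f 0 1 0 (Mb rho2) + 1); first by rewrite ltr_wpDl // mulr_ge0 // ltW.
move=> u s; have /andP[c0 c1] := cAb u; have /andP[r1 r2] := clipped_itv u.
rewrite /source mulr_ge0 ?f_ext_ge0 ?(ltW c0) //=.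
apply: (@le_trans _ _ (cA * rect_max f 0 1 0 (Mb rho2))); last by rewrite lerDl.
rewrite ler_pM ?(ltW c0) ?f_ext_ge0 // f_ext_le_rect_max //; first exact: Mbar_ge0.
by apply: le_trans (truncation_le _ _ _) _; apply: Mbar_homo.
Qed.

Lemma source_measurable u : measurable_fun setT u -> measurable_fun setT (source u).
Proof.
move=> mu_; apply: measurable_funM => //; apply: measurable_f_ext.
apply: measurable_minr => //; apply: measurable_maxr => //.
by apply: measurable_funM => //; exact: measurable_indic.
Qed.

Lemma hammerstein_itv Gam c : (forall z, 0 <= green_ext G z <= Gam) ->
  (forall u s, 0 <= source u s <= c) ->
  forall u t, measurable_fun setT u -> 0 <= hammerstein u t <= Gam * c.
Proof.
move=> Gb sb u t mu_; have prod_ge0 s : 0 <= green_ext G (t, s) * source u s.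
  by have /andP[? _] := Gb (t, s); have /andP[? _] := sb u s; rewrite mulr_ge0.
apply/andP; split; first by apply: Rintegral_ge0.
have [<- _] := Rintegral_cst_unit (Gam * c).
apply: le_Rintegral => //.
- apply: (@green_image_integrable R B G GB (source u) c) => //; exact: source_measurable.
- by apply: continuous_itv_integrable => s; exact: cvg_cst.
move=> s _; have /andP[? ?] := Gb (t, s); have /andP[? ?] := sb u s.
by rewrite ler_pM.
Qed.

Lemma hammerstein_lipschitz Gam c : (forall z, 0 <= green_ext G z <= Gam) ->
  (forall u s, 0 <= source u s <= c) ->
  forall u (t t' : R), measurable_fun setT u -> t \in `[0, 1] -> t' \in `[0, 1] ->
  `|hammerstein u t - hammerstein u t'| <= `|t - t'| * (Gam + Gam + 2) * c.
Proof.
move=> Gb sb u t t' mu_ tI t'I.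
have int_G t0 : mu.-integrable I01 (EFin \o (fun s => green_ext G (t0, s) * source u s)).
  by apply: (@green_image_integrable R B G GB (source u) c) => //; exact: source_measurable.
have int_B : mu.-integrable I01
    (EFin \o (fun s => green_ext G (t, s) * source u s - green_ext G (t', s) * source u s)).
  suff : mu.-integrable I01 ((EFin \o (fun s => green_ext G (t, s) * source u s)%R) \-
      (EFin \o (fun s => green_ext G (t', s) * source u s)%R))%E by [].
  by apply: integrableB => //; exact: int_G.
rewrite /hammerstein -RintegralB // -Rintegral_oo //.
apply: le_trans (le_normr_Rintegral _ _) _ => //.
  by apply: integrableS int_B => // s /=; rewrite !in_itv /= => /andP[/ltW-> /ltW->].
set L := _ * c; have [_ <-] := Rintegral_cst_unit L.
have oo_cc : `]0, 1[ `<=` I01 by move=> s /=; rewrite !in_itv /= => /andP[/ltW-> /ltW->].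
apply: le_Rintegral => //.
- have := integrable_norm int_B; apply: integrableS => //.
- apply: (@integrableS _ _ _ mu I01) => //.
  by apply: continuous_itv_integrable => s; exact: cvg_cst.
move=> s sI; rewrite -mulrBl normrM; apply: ler_pM => //.
  by rewrite !green_extE ?(green_lipschitz GB Gb) //; exact: oo_cc.
by have /andP[s0 s1] := sb u s; rewrite ger0_norm.
Qed.

(** N, hence the clipped coefficient and the truncation level, converge by
    nonlocal_cvg; the integrands then converge pointwise under a constant bound. *)
Lemma hammerstein_cvg M (u_ : nat -> R -> R) u :
  (forall n, bounded_measurable M (u_ n)) -> bounded_measurable M u ->
  (forall t : R, t \in `[0, 1] -> u_ n t @[n --> \oo] --> u t) ->
  forall t : R, t \in `[0, 1] -> hammerstein (u_ n) t @[n --> \oo] --> hammerstein u t.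
Proof.
move=> ub_ ub uu t tI.
have [Gam Gam0 Gb] := green_ext_bounded GB.
have [c c0 sb] := source_bounded.
have rho_cvg : clipped_nonlocal (u_ n) @[n --> \oo] --> clipped_nonlocal u.
  apply: (@cvg_comp _ _ _ (fun n => nonlocal b p (u_ n)) (clip rho1 rho2)); last exact: clip_continuous.
  apply: (@nonlocal_cvg R b p pm pp b_ge0 b_L1 p_cont pm_gt0 p_bounds _ _ M) => //.
  - by move=> n; apply: measurable_funTS; have [] := ub_ n.
  - by apply: measurable_funTS; have [] := ub.
  - by move=> n s _; have [_] := ub_ n.
have A_cvg : A (clipped_nonlocal (u_ n)) @[n --> \oo] --> A (clipped_nonlocal u).
  have Ac : continuous (A \o clip rho1 rho2).
    apply: (continuous_retract A_cont); first exact: clip_continuous.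
    by move=> x; have /andP[h _] := clip_itv x le12; rewrite /= in_itv /= andbT (le_trans (ltW rho1_gt0)).
  have AE v : (A \o clip rho1 rho2) (clipped_nonlocal v) = A (clipped_nonlocal v).
    by rewrite /= (@clip_id _ _ _ (clipped_nonlocal v)) // clipped_itv.
  have := cvg_comp _ _ rho_cvg (Ac (clipped_nonlocal u)).
  rewrite AE; apply: cvg_trans; apply: near_eq_cvg; apply: nearW => n; exact: AE.
apply: (@Rintegral_dominated _ _ _ mu _ _ _ (cst (Gam * c))) => //.
- move=> n; apply: measurable_funTS; apply: measurable_funM.
    by apply: continuous_measurable_fun; exact: (green_ext_l GB).
  by apply: source_measurable; have [] := ub_ n.
- by apply: continuous_itv_integrable => s; exact: cvg_cst.
- move=> n s _; have /andP[s0 s1] := sb (u_ n) s; have g0 := green_ext_ge0 G_ge0 (t, s).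
  by rewrite /= ger0_norm; [apply: ler_pM|exact: mulr_ge0].
move=> s sI; apply: cvgMr; apply: cvgM.
  apply: cvgMr; apply: cvgV; last exact: A_cvg.
  by rewrite lt0r_neq0 // A_pos // in_itv /= clipped_itv.
apply: (@cvg_comp _ _ _ _ (f_ext s) _ (nbhs (truncation (clipped_nonlocal u) s (u s)))); last exact: f_ext_r.
apply: cvg_minr; first exact: Mbar_cvg.
by apply: cvg_maxr; [exact: cvg_cst|exact: uu].
Qed.

Theorem hammerstein_fixed_point : exists M u, [/\ bounded_measurable M u,
  {within `[0, 1], continuous u} & forall t : R, t \in `[0, 1] -> hammerstein u t = u t].
Proof.
have [Gam Gam0 Gb'] := green_ext_bounded GB.
have Gb z : 0 <= green_ext G z <= Gam by rewrite green_ext_ge0 //=.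
have [c c0 sb] := source_bounded.
exists (Gam * c).
apply: (@equicontinuous_fixed_point R (Gam * c) _ hammerstein).
- exact: mulr_gt0.
- by move=> u t [mu_ _] _; exact: (hammerstein_itv Gb sb).
- move=> e e0; have L0 : 0 < (Gam + Gam + 2) * c by rewrite mulr_gt0 // !addr_gt0.
  exists (e / ((Gam + Gam + 2) * c)); first exact: divr_gt0.
  move=> u s t [mu_ _] sI tI st.
  apply: le_trans (hammerstein_lipschitz Gb sb mu_ sI tI) _.
  by rewrite -mulrA -ler_pdivlMr.
- exact: hammerstein_cvg.
Qed.

(** * The modifications are inactive at a fixed point *)

Section Solution.
Hypothesis b_pos : {ae mu, forall t : R, t \in `]0, 1] -> 0 < b t}.
Hypothesis alpha_ge0 : 0 <= alpha.
Hypothesis alpha_beta : alpha < beta.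
Hypothesis beta_le1 : beta <= 1.
Hypothesis eta0_le1 : eta0 <= 1.
Hypothesis G_min : forall s : R, s \in `[0, 1] ->
     eta0 * Gmax G s <= min_on `[alpha, beta] (G ^~ s).
Hypothesis Gmax_gt0 : forall s : R, s \in `]0, 1[ -> 0 < Gmax G s.
Hypothesis C0_gt0 : 0 < C0_of G.
Hypothesis bq_L1 : mu.-integrable `]0, 1] (EFin \o (fun t => b t `^ (1 / (1 - q)))).
Hypothesis cond1 :
     rho1 / eta0 `^ pp <
     ((lambda * rect_min f alpha beta low (Mb rho1) / A rho1 * Gint_max G alpha beta) `^ pm - 1)
     * \int[lebesgue_measure]_(s in `[alpha, beta]) b (1 - s).
Hypothesis cond2 :
     let y := lambda * rect_max f 0 1 0 (Mb rho2) * Gint_max G 0 1 / A rho2 in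
     Num.max (y `^ pp) (y `^ pm) < rho2 / convol b (cst 1) 1.

Variables (M : R) (u : R -> R).
Hypothesis u_bounded : bounded_measurable M u.
Hypothesis u_cont : {within `[0, 1], continuous u}.
Hypothesis u_fixed : forall t : R, t \in `[0, 1] -> hammerstein u t = u t.

Let W_gt0 : 0 < convol b (cst 1) 1.
Proof. exact: convol1_gt0. Qed.

Let zero_in : (0 : R) \in `[0, 1].
Proof. by rewrite in_itv /= lexx ler01. Qed.

Let pm_le_pp : pm <= pp.
Proof. by have [p0 p1] := p_bounds zero_in; exact: le_trans p0 p1. Qed.

Let sub_itv (t : R) : t \in `[alpha, beta] -> t \in `[0, 1].
Proof.
by rewrite !in_itv /= => /andP[a_t tb]; rewrite (le_trans alpha_ge0 a_t) (le_trans tb beta_le1).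
Qed.

Let low_gt0 : 0 < low.
Proof. by rewrite mulr_gt0 ?m_rho_gt0. Qed.

Let u_green (t : R) : t \in `[0, 1] -> u t = \int[mu]_(s in `[0, 1]) (G t s * source u s).
Proof.
move=> tI; rewrite -u_fixed //; apply: eq_Rintegral => s; rewrite inE /= => sI.
by rewrite green_extE.
Qed.

Let source_meas : measurable_fun setT (source u).
Proof. by apply: source_measurable; case: u_bounded. Qed.

Let u_meas : measurable_fun I01 u.
Proof. by apply: measurable_funTS; case: u_bounded. Qed.

Let u_ge0 t : 0 <= u t.
Proof. by have [_ /(_ t)/andP[]] := u_bounded. Qed.

Let u_le_norm (t : R) : t \in `[0, 1] -> u t <= maxnorm u.
Proof.
have [c _ sb] := source_bounded.
exact: (maxnorm_ge G_ge0 (sb u) u_green u_cont).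
Qed.

Let u_itv (t : R) : t \in `[0, 1] -> 0 <= u t <= maxnorm u.
Proof. by move=> tI; rewrite u_ge0 u_le_norm. Qed.

Let norm_ge0 : 0 <= maxnorm u.
Proof. exact: le_trans (u_ge0 0) (u_le_norm zero_in). Qed.

Let u_harnack (t : R) : t \in `[alpha, beta] -> eta0 * maxnorm u <= u t.
Proof.
have [c _ sb] := source_bounded.
exact: (harnack GB G_ge0 source_meas (sb u) u_green alpha_ge0 beta_le1 eta0_gt0 G_min).
Qed.

Lemma fixed_point_cone : cone alpha beta eta0 (C0_of G) u.
Proof.
have [c _ sb] := source_bounded.
split=> //.
- by apply: min_on_ge => //; exists alpha; rewrite /= in_itv /= lexx ltW.
- rewrite /convol; under eq_Rintegral do rewrite /= mul1r.
  apply: (mean_value_ge GB G_ge0 source_meas (sb u) u_green u_cont Gmax_gt0); exact: ltW.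
Qed.

(** u is at most its norm, so N(u) is at most max(c^pp, c^pm) (b * 1)(1) with c
    the norm. *)
Lemma m_rho_le_maxnorm rho : 0 < rho -> rho <= nonlocal b p u -> m_rho b pm pp rho <= maxnorm u.
Proof.
move=> r0 rN; apply: m_rho_le => //; apply: le_trans rN _.
exact: nonlocal_le.
Qed.

(** On [alpha, beta] u is at least eta0 times its norm, so the integral of
    b(1 - s) there is small if the norm is large; Hoelder bounds it below. *)
Lemma maxnorm_le_Mbar rho : 0 < rho -> nonlocal b p u <= rho -> maxnorm u <= Mb rho.
Proof.
move=> r0 Nr; pose I := \int[mu]_(s in `[alpha, beta]) b (1 - s).
have I0 : 0 <= I.
  by rewrite /I reflected_integral1 //; apply: Rintegral_ge0 => s _; exact: reflected_ge0.
pose V := (convol (fun t => b t `^ (1 / (1 - q))) (cst 1) 1) `^ ((q - 1) / q).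
rewrite /Mb /Mbar_rho div1r -[leRHS]mulrA ler_pdivlMl //.
apply: (@root_product_le R (eta0 * maxnorm u) I V rho (beta - alpha) pm q) => //.
- by rewrite mulr_ge0 // ltW.
- exact: powR_ge0.
- by rewrite subr_gt0 alpha_beta /= lerBlDr (le_trans beta_le1) // lerDl.
- move=> X1; apply: le_trans Nr.
  apply: (nonlocal_ge b_ge0 b_L1 p_cont pm_gt0 p_bounds u_meas u_itv) => //; first exact: powR_ge0.
  move=> s sI; have [p0 p1] := p_bounds (sub_itv sI).
  apply: (@le_trans _ _ (u s `^ pm)).
    by apply: ge0_ler_powR; rewrite ?nnegrE ?u_ge0 ?u_harnack ?mulr_ge0 // ltW.
  by apply: ler_powR => //; apply: le_trans X1 _; exact: u_harnack.
- exact: interval_length_le.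
Qed.

Let rect_max_bound rho s : rho1 <= rho <= rho2 ->
  f_ext s (truncation rho s (u s)) <= rect_max f 0 1 0 (Mb rho2).
Proof.
move=> /andP[r1 r2]; apply: f_ext_le_rect_max; first exact: Mbar_ge0.
by apply: le_trans (truncation_le _ _ _) _; apply: Mbar_homo => //; exact: le_trans (ltW rho1_gt0) r1.
Qed.

(** Otherwise the clipped value is rho2, and condition (2) bounds u pointwise. *)
Lemma nonlocal_lt_rho2 : nonlocal b p u < rho2.
Proof.
rewrite ltNge; apply/negP => N2.
have rhoE : clipped_nonlocal u = rho2.
  by rewrite /clipped_nonlocal /clip min_l // max_r.
have A2 : 0 < A rho2 by apply: A_pos; rewrite in_itv /= lexx ltW.
pose fM := rect_max f 0 1 0 (Mb rho2).
have k0 : 0 <= lambda / A rho2 * fM.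
  rewrite mulr_ge0 //; first by rewrite divr_ge0 // ltW.
  apply: le_trans (f_ext_ge0 0 (truncation rho2 0 (u 0))) _.
  by apply: rect_max_bound; rewrite lexx ltW.
have [Gam Gam0 Gb] := green_ext_bounded GB.
have Gi (t : R) : mu.-integrable I01 (EFin \o (fun s => green_ext G (t, s))).
  by apply: continuous_itv_integrable; exact: (green_ext_l GB).
have Gint (t : R) : t \in `[0, 1] -> \int[mu]_(s in `[0, 1]) green_ext G (t, s) <= Gint_max G 0 1.
  move=> tI; have -> : \int[mu]_(s in `[0, 1]) green_ext G (t, s) = \int[mu]_(s in `[0, 1]) G t s.
    by apply: eq_Rintegral => s; rewrite inE /= => sI; rewrite green_extE.
  apply: (@max_on_ge _ _ I01 (fun t => \int[mu]_(s in `[0, 1]) G t s) Gam) => // x xI.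
  have [<- _] := Rintegral_cst_unit Gam.
  have -> : \int[mu]_(s in `[0, 1]) G x s = \int[mu]_(s in `[0, 1]) green_ext G (x, s).
    by apply: eq_Rintegral => s; rewrite inE /= => sI; rewrite green_extE.
  apply: le_Rintegral => //.
  by apply: continuous_itv_integrable => s; exact: cvg_cst.
pose y := lambda * fM * Gint_max G 0 1 / A rho2.
have uy (t : R) : t \in `[0, 1] -> 0 <= u t <= y.
  move=> tI; rewrite u_ge0 /= -u_fixed //.
  have -> : y = lambda / A rho2 * fM * Gint_max G 0 1 by rewrite /y; ring.
  apply: (@le_trans _ _ (\int[mu]_(s in `[0, 1]) (lambda / A rho2 * fM * green_ext G (t, s)))); last first.
    by rewrite RintegralZl // ler_wpM2l // Gint.
  have [c _ sb] := source_bounded.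
  apply: le_Rintegral => //.
  - exact: (green_image_integrable GB source_meas (sb u)).
  - have := @integrableZl _ _ _ mu _ _ (lambda / A rho2 * fM) _ (Gi t); exact.
  move=> s sI; rewrite mulrC ler_wpM2r ?green_ext_ge0 // /source rhoE ler_wpM2l //.
    by rewrite divr_ge0 // ltW.
  by apply: rect_max_bound; rewrite lexx ltW.
have := nonlocal_le b_ge0 b_L1 p_cont pm_gt0 p_bounds u_meas uy.
move=> /(le_trans N2); apply/negP; rewrite -ltNge -ltr_pdivlMr //; exact: cond2.
Qed.

(** Otherwise the clipped value is rho1, and condition (1) makes u large. *)
Lemma rho1_lt_nonlocal : rho1 < nonlocal b p u.
Proof.
rewrite ltNge; apply/negP => N1.
have rhoE : clipped_nonlocal u = rho1.
  by rewrite /clipped_nonlocal /clip min_r ?max_l // (le_trans N1).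
have A1 : 0 < A rho1 by apply: A_pos; rewrite in_itv /= lexx ltW.
pose fm := rect_min f alpha beta low (Mb rho1).
pose I := \int[mu]_(s in `[alpha, beta]) b (1 - s).
pose X := lambda * fm / A rho1 * Gint_max G alpha beta.
have XI : rho1 / eta0 `^ pp < (X `^ pm - 1) * I := cond1.
have I0 : 0 <= I.
  by rewrite /I reflected_integral1 //; apply: Rintegral_ge0 => s _; exact: reflected_ge0.
have eta_pp : 0 < eta0 `^ pp by exact: powR_gt0.
have cond1_gt0 : 0 < (X `^ pm - 1) * I.
  by apply: lt_trans XI; exact: divr_gt0.
have X1 : 1 < X `^ pm.
  rewrite ltNge; apply/negP => X1; move: cond1_gt0; apply/negP.
  by rewrite -leNgt mulr_le0_ge0 // subr_le0.
(* Otherwise the rectangle of (1) is empty, its minimum is inf of the empty set,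
   which is 0, and X = 0. *)
have lowM : low <= Mb rho1.
  rewrite leNgt; apply/negP => lowM; move: X1.
  have -> : X = 0.
    rewrite /X /fm /rect_min /min_on (_ : [set _ | _ in _] = set0).
      by rewrite inf0 mulr0 !mul0r.
    rewrite -subset0 => _ [[s x] /= [_ +] _]; rewrite in_itv /= => /andP[lx xM].
    by move: lowM; rewrite ltNge (le_trans lx xM).
  by rewrite powR0 ?lt0r_neq0 // ltr10.
have rect_in s : s \in `[alpha, beta] -> fm <= f_ext s (truncation rho1 s (u s)).
  move=> sI; have sI' := sub_itv sI.
  have tr_ge : low <= truncation rho1 s (u s).
    by rewrite /truncation le_min lowM le_max indicE mem_set // mulr1 lexx.
  rewrite f_extE //; last exact: le_trans (ltW low_gt0) tr_ge.
  apply: (@min_on_le _ _ (`[alpha, beta] `*` `[low, Mb rho1]) (fun z : R * R => f z.1 z.2) 0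
    (s, truncation rho1 s (u s))).
    move=> [t x] /= [tI]; rewrite in_itv /= => /andP[lx _].
    by apply: f_ge0; [exact: sub_itv|rewrite in_itv /= andbT (le_trans (ltW low_gt0))].
  by split => //=; rewrite in_itv /= tr_ge truncation_le.
have fm0 : 0 <= fm.
  apply: min_on_ge.
    by exists (alpha, low); split; rewrite /= in_itv /= lexx // ltW.
  move=> [t x] /= [tI]; rewrite in_itv /= => /andP[lx _].
  by apply: f_ge0; [exact: sub_itv|rewrite in_itv /= andbT (le_trans (ltW low_gt0))].
pose k := lambda / A rho1 * fm.
have k0 : 0 <= k by rewrite mulr_ge0 // divr_ge0 // ltW.
have uk (t : R) : t \in `[0, 1] -> k * \int[mu]_(s in `[alpha, beta]) G t s <= u t.
  move=> tI; have [c _ sb] := source_bounded.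
  have gi := green_image_integrable GB source_meas (sb u) t.
  have sub : `[alpha, beta] `<=` I01 by move=> s; exact: sub_itv.
  rewrite -u_fixed //.
  apply: (@le_trans _ _ (\int[mu]_(s in `[alpha, beta]) (green_ext G (t, s) * source u s))); last first.
    apply: Rintegral_subset => // s _; rewrite mulr_ge0 ?green_ext_ge0 //.
    by have /andP[] := sb u s.
  have -> : \int[mu]_(s in `[alpha, beta]) G t s = \int[mu]_(s in `[alpha, beta]) green_ext G (t, s).
    by apply: eq_Rintegral => s; rewrite inE /= => sI; rewrite green_extE // sub_itv.
  have Gi : mu.-integrable `[alpha, beta] (EFin \o (fun s => green_ext G (t, s))).
    by apply: continuous_itv_integrable; exact: (green_ext_l GB).
  rewrite -RintegralZl //; apply: le_Rintegral => //.
  - have := @integrableZl _ _ _ mu _ _ k _ Gi; exact.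
  - exact: integrableS gi.
  move=> s sI; rewrite mulrC ler_wpM2l ?green_ext_ge0 // /source rhoE ler_wpM2l ?rect_in //.
  by rewrite divr_ge0 // ltW.
have Xnorm : X <= maxnorm u.
  have -> : X = k * Gint_max G alpha beta by rewrite /X /k; ring.
  move: k0; rewrite le_eqVlt => /predU1P[<-|k0]; first by rewrite mul0r.
  rewrite -ler_pdivlMl //; apply: max_on_le; first by exists 0.
  by move=> t tI; rewrite ler_pdivlMl // (le_trans (uk t tI)) // u_le_norm.
(* A negative X is excluded by the convention that its real powers are 1. *)
have X0 : 1 <= X.
  rewrite leNgt; apply/negP => X0; move: X1; apply/negP; rewrite -leNgt.
  have [Xn|Xn] := leP 0 X; last by rewrite lt0_powR1.
  by rewrite ltW // powR_lt1 ?Xn.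
have := nonlocal_ge b_ge0 b_L1 p_cont pm_gt0 p_bounds u_meas u_itv alpha_ge0 beta_le1
  (k := eta0 `^ pp * X `^ pm).
rewrite mulr_ge0 ?powR_ge0 // => /(_ isT) H.
have {H} : eta0 `^ pp * X `^ pm * I <= nonlocal b p u.
  apply: H => s sI; have sI' := sub_itv sI; have [p0 p1] := p_bounds sI'.
  apply: (@le_trans _ _ ((eta0 * X) `^ p s)).
    by apply: powR_var_ge; rewrite ?p0 ?eta0_gt0.
  apply: ge0_ler_powR.
  - exact: le_trans (ltW pm_gt0) p0.
  - by rewrite nnegrE mulr_ge0 // ?(ltW eta0_gt0) // (le_trans ler01 X0).
  - by rewrite nnegrE.
  - by apply: (le_trans _ (u_harnack sI)); rewrite ler_pM2l.
move=> /le_trans/(_ N1); apply/negP; rewrite -ltNge.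
move: XI; rewrite ltr_pdivrMr // => /lt_le_trans; apply.
rewrite mulrC -mulrA ler_pM2l // ler_wpM2r //.
by rewrite lerBlDr lerDl.
Qed.

Let N := nonlocal b p u.

Let clippedE : clipped_nonlocal u = N.
Proof. by rewrite /clipped_nonlocal clip_id // !ltW ?rho1_lt_nonlocal ?nonlocal_lt_rho2. Qed.

Let N_gt0 : 0 < N.
Proof. exact: lt_trans rho1_lt_nonlocal. Qed.

Let AN_gt0 : 0 < A N.
Proof. by apply: A_pos; rewrite in_itv /= !ltW ?rho1_lt_nonlocal ?nonlocal_lt_rho2. Qed.

(** The upper level is Mbar at N(u) itself, and m_rho1 is a lower bound of the
    norm because N(u) > rho1. *)
Lemma truncation_inactive (s : R) : s \in `[0, 1] -> truncation N s (u s) = u s.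
Proof.
move=> sI; rewrite /truncation max_r.
  by rewrite min_r // (le_trans (u_le_norm sI)) // maxnorm_le_Mbar.
rewrite indicE; have [/set_mem sab|_] := boolP (s \in _); last by rewrite mulr0 u_ge0.
rewrite mulr1; apply: le_trans (u_harnack sab); rewrite ler_pM2l //.
by apply: m_rho_le_maxnorm => //; exact: ltW rho1_lt_nonlocal.
Qed.

Lemma sourceE (s : R) : s \in `[0, 1] -> source u s = lambda / A N * f s (u s).
Proof. by move=> sI; rewrite /source clippedE truncation_inactive // f_extE. Qed.

Lemma fixed_point_Tmap (t : R) : t \in `[0, 1] -> u t = Tmap lambda A b p G f u t.
Proof.
move=> tI; rewrite /Tmap.
have -> : \int[mu]_(s in `[0, 1]) ((A (nonlocal b p u))^-1 * G t s * f s (u s)) =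
    \int[mu]_(s in `[0, 1]) (lambda^-1 * (green_ext G (t, s) * source u s)).
  apply: eq_Rintegral => s; rewrite inE /= => sI; rewrite sourceE // green_extE // -/N.
  by field; rewrite !lt0r_neq0.
have [c _ sb] := source_bounded.
rewrite RintegralZl //; last exact: (green_image_integrable GB source_meas (sb u)).
by rewrite mulVKf ?lt0r_neq0 // -[RHS]/(hammerstein u t) u_fixed.
Qed.

(** N(u) > rho1 > 0 excludes u = 0. *)
Lemma fixed_point_neq0 : exists2 t : R, t \in `[0, 1] & u t != 0.
Proof.
apply: contrapT => none; have [c _ sb] := source_bounded.
have norm0 : maxnorm u <= 0.
  apply: (maxnorm_le G_ge0 (sb u) u_green) => t tI; rewrite le_eqVlt; apply/orP; left.
  by apply/negPn/negP => ut; apply: none; exists t.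
have : m_rho b pm pp rho1 <= 0.
  by apply: le_trans norm0; apply: m_rho_le_maxnorm => //; exact: ltW rho1_lt_nonlocal.
by apply/negP; rewrite -ltNge m_rho_gt0.
Qed.

Lemma fixed_point_solves_bvp : solves_bvp B lambda A b p f u.
Proof.
pose g s := lambda / A N * f_ext s (u (clip 0 1 s)).
have uc : continuous (u \o clip 0 1).
  apply: (continuous_retract u_cont); first exact: clip_continuous.
  by move=> s; rewrite /= in_itv /= clip_itv.
have gc : continuous g.
  move=> s; apply: cvgMr.
  have su : (y, u (clip 0 1 y)) @[y --> s] --> (s, u (clip 0 1 s)).
    exact: cvg_pair (@cvg_id _ (nbhs s)) (@uc s).
  exact: (cvg_comp _ _ su (@f_ext_continuous (s, u (clip 0 1 s)))).
have gE (s : R) : s \in `[0, 1] -> g s = lambda / A N * f s (u s).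
  by move=> sI; rewrite /g clip_id -?in_itv // f_extE.
have ug (t : R) : t \in `[0, 1] -> u t = \int[mu]_(s in `[0, 1]) (G t s * g s).
  move=> tI; rewrite u_green //; apply: eq_Rintegral => s; rewrite inE /= => sI.
  by rewrite sourceE // gE.
split=> // [t tI|]; last exact: (representation_boundary GB gc ug).
have [d2 dE] := representation_twice_derivable GB gc ug tI.
split; first exact: d2.
have tI' : t \in `[0, 1] by move: tI; rewrite !in_itv /= => /andP[/ltW-> /ltW->].
by rewrite dE mulrNN gE // -/N; field; exact: lt0r_neq0.
Qed.

Lemma fixed_point_positive_solution :
  positive_solution (cone alpha beta eta0 (C0_of G)) lambda A b p G f u.
Proof.
split; [exact: fixed_point_cone|exact: fixed_point_neq0|exact: AN_gt0|].
exact: fixed_point_Tmap.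
Qed.

Lemma fixed_point_localised :
  let K := cone alpha beta eta0 (C0_of G) in
  (Vhat K b p rho2 `\` closure_in K (Vhat K b p rho1)) u /\
  m_rho b pm pp rho1 <= maxnorm u <= Mb rho2.
Proof.
move=> K; split.
  split; first by split; [exact: fixed_point_cone|exact: nonlocal_lt_rho2].
  move=> ucl; have := rho1_lt_nonlocal; rewrite ltNge => /negP; apply.
  apply: (closure_nonlocal_le b_ge0 b_L1 p_cont pm_gt0 p_bounds _ _ ucl).
    by move=> v [].
  by move=> v t [_ v0 _ _]; exact: v0.
rewrite maxnorm_le_Mbar ?andbT; first exact: m_rho_le_maxnorm (ltW rho1_lt_nonlocal).
  exact: lt_trans rho12.
exact: ltW nonlocal_lt_rho2.
Qed.

Lemma fixed_point_conclusion :
  let K := cone alpha beta eta0 (C0_of G) in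
  [/\ positive_solution K lambda A b p G f u, solves_bvp B lambda A b p f u,
      (Vhat K b p rho2 `\` closure_in K (Vhat K b p rho1)) u
    & m_rho b pm pp rho1 <= maxnorm u <= Mb rho2].
Proof.
move=> K; have [Vu nu] := fixed_point_localised.
by split; [exact: fixed_point_positive_solution|exact: fixed_point_solves_bvp|..].
Qed.

End Solution.
End Operator.

(** * Existence and localisation of a positive solution *)

Theorem theorem3p6 (R : realType)
  (lambda : R) (A : R -> R) (f : R -> R -> R) (b p : R -> R)
  (rho1 rho2 pm pp q : R)
  (B : 'M[R]_(2, 4)) (G : R -> R -> R) (alpha beta eta0 : R)
  (lambda_gt0 : 0 < lambda)
  (A_cont : {within `[0, +oo[, continuous A})
  (f_cont : {within `[0, 1] `*` `[0, +oo[,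
               continuous (fun z : R * R => f z.1 z.2)})
  (f_ge0 : forall t x : R, t \in `[0, 1] -> x \in `[0, +oo[ -> 0 <= f t x)
  (b_ge0 : forall t : R, t \in `]0, 1] -> 0 <= b t)
  (b_L1 : (@lebesgue_measure R).-integrable `]0, 1] (EFin \o b))
  (b_pos : {ae @lebesgue_measure R, forall t : R, t \in `]0, 1] -> 0 < b t})
  (b_neq0 : convol b (cst 1) 1 != 0)
  (rho1_gt0 : 0 < rho1) (rho12 : rho1 < rho2)
  (A_pos : forall t : R, t \in `[rho1, rho2] -> 0 < A t)
  (p_cont : {within `[0, 1], continuous p})
  (pm_gt0 : 0 < pm) (pp_le1 : pp <= 1)
  (p_bounds : forall t : R, t \in `[0, 1] -> pm <= p t /\ p t <= pp)
  (G_ge0 : forall t s : R, t \in `[0, 1] -> s \in `[0, 1] -> 0 <= G t s)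
  (G_green : is_green_function B G)
  (alpha_ge0 : 0 <= alpha) (alpha_beta : alpha < beta) (beta_le1 : beta <= 1)
  (eta0_gt0 : 0 < eta0) (eta0_le1 : eta0 <= 1)
  (G_min : forall s : R, s \in `[0, 1] ->
     eta0 * Gmax G s <= min_on `[alpha, beta] (G ^~ s))
  (Gmax_gt0 : forall s : R, s \in `]0, 1[ -> 0 < Gmax G s)
  (C0_gt0 : 0 < C0_of G)
  (q_gt1 : 1 < q)
  (bq_L1 : (@lebesgue_measure R).-integrable `]0, 1]
             (EFin \o (fun t => b t `^ (1 / (1 - q)))))
  (cond1 :
     rho1 / eta0 `^ pp <
     ((lambda * rect_min f alpha beta (eta0 * m_rho b pm pp rho1)
                                      (Mbar_rho b alpha beta eta0 pm q rho1)
         / A rho1 * Gint_max G alpha beta) `^ pm - 1)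
     * \int[lebesgue_measure]_(s in `[alpha, beta]) b (1 - s))
  (cond2 :
     let y := lambda * rect_max f 0 1 0 (Mbar_rho b alpha beta eta0 pm q rho2)
                * Gint_max G 0 1 / A rho2 in
     Num.max (y `^ pp) (y `^ pm) < rho2 / convol b (cst 1) 1) :
  let K := cone alpha beta eta0 (C0_of G) in
  exists u0 : R -> R,
    [/\ positive_solution K lambda A b p G f u0,
        solves_bvp B lambda A b p f u0,
        (Vhat K b p rho2 `\` closure_in K (Vhat K b p rho1)) u0
      & (rho1 / convol b (cst 1) 1) `^ (1 / pp) + eps_rho b pm pp rho1 <= maxnorm u0
        /\ maxnorm u0 <=
           1 / eta0 * (beta - alpha) `^ (- (q / pm)) *
           (rho2 `^ (1 / q) *
              (convol (fun t => b t `^ (1 / (1 - q))) (cst 1) 1) `^ ((q - 1) / q) + 1)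
             `^ (q / pm)].
Proof.
move=> K.
have [M [u [ub uc uE]]] := hammerstein_fixed_point alpha beta lambda_gt0 A_cont
  f_cont f_ge0 b_ge0 b_L1 rho1_gt0 rho12 A_pos p_cont pm_gt0 p_bounds G_ge0 G_green eta0_gt0 q_gt1.
exists u.
have [pu su Vu /andP[lo hi]] : [/\ positive_solution K lambda A b p G f u,
    solves_bvp B lambda A b p f u, (Vhat K b p rho2 `\` closure_in K (Vhat K b p rho1)) u
  & m_rho b pm pp rho1 <= maxnorm u <= Mbar_rho b alpha beta eta0 pm q rho2].
  by apply: (fixed_point_conclusion (A := A) (f := f)) ub uc uE.
by split.
Qed.
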